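(* There is an absolute constant $C_{\mathrm E}$ (arising from Esseen's inequality) such that the following holds with $C_3=\max(C_2,2^{3/2}C_{\mathrm E})$. Let $\psi:\mathbb R\to\mathbb R^+$ be even, convex and such that $\frac{\psi(x)}{x^2}$ and $\frac{x^3}{\psi(x)}$ are non-decreasing on $\mathbb R^+$. Let $n\ge1$, let $X_1,\dots,X_n$ be independent, square integrable random variables with values in the lattice $\mathcal L(v_0,D)$, with $\vartheta_{X_j}>0$ and $\mathbb E\,\psi(X_j)<\infty$ for $j=1,\dots,n$, let $S_n=X_1+\dots+X_n$, and let $0<\vartheta_j\le\vartheta_{X_j}$ ($j=1,\dots,n$). Put $\Theta_n=\sum_{j=1}^n\vartheta_j$ and $$L_n=\frac{\sum_{j=1}^n\mathbb E\,\psi(X_j)}{\psi\big(\sqrt{\mathrm{Var}(S_n)}\big)}.$$ Assume that $\Theta_n>1$ and $\frac{\log\Theta_n}{\Theta_n}\le\frac1{14}$. Then, for all $\kappa\in\mathcal L(v_0n,D)$ such that $$\frac{(\kappa-\mathbb E S_n)^2}{\mathrm{Var}(S_n)}\le\sqrt{\frac{7\log\Theta_n}{2\Theta_n}},$$ we have $$\Big|\mathbb P\{S_n=\kappa\}-\frac{D\,e^{-\frac{(\kappa-\mathbb E S_n)^2}{2\mathrm{Var}(S_n)}}}{\sqrt{2\pi\,\mathrm{Var}(S_n)}}\Big|\le C_3\Big\{D\Big(\frac{\log\Theta_n}{\mathrm{Var}(S_n)\,\Theta_n}\Big)^{1/2}+\frac{L_n+\Theta_n^{-1}}{\sqrt{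\Theta_n}}\Big\}.$$
   Context: Lattice: $v_0\in\mathbb R$ and $D>0$ are given, $v_k=v_0+Dk$ for $k\in\mathbb Z$, and $\mathcal L(v_0,D)=\{v_k:k\in\mathbb Z\}$; likewise $\mathcal L(v_0n,D)=\{v_0n+Dk:k\in\mathbb Z\}$. For a random variable $X$ with $\mathbb P\{X\in\mathcal L(v_0,D)\}=1$, put $\vartheta_X=\sum_{k\in\mathbb Z}\min(\mathbb P\{X=v_k\},\mathbb P\{X=v_{k+1}\})$. Constants: $C_0$ is an absolute constant such that for all integers $N\ge1$, $\sup_{z\in\mathbb Z}\big|\mathbb P\{\mathcal B_N=z\}-\sqrt{\tfrac{2}{\pi N}}\,e^{-(2z-N)^2/(2N)}\big|\le C_0N^{-3/2}$, where $\mathcal B_N$ is a sum of $N$ i.i.d. variables taking the values $0$ and $1$ with probability $1/2$ each (such a constant exists). $C_1=\max(4,C_0)$ and $C_2=12(C_1+1)$. ''Absolute'' means not depending on $n$, $v_0$, $D$, $\psi$, the laws of the $X_j$, or the $\vartheta_j$. *)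

(* Defs.v *)
From HB Require Import structures.
From mathcomp Require Import all_boot all_order all_algebra.
From mathcomp Require Import all_classical all_reals all_analysis.
Set Implicit Arguments.
Unset Strict Implicit.
Unset Printing Implicit Defensive.
Import Order.TTheory GRing.Theory Num.Theory.
Import numFieldNormedType.Exports.
Local Open Scope classical_set_scope.
Local Open Scope ring_scope.

Definition lattice_point (R : realType) (v0 D : R) (k : int) : R :=
  v0 + D * k%:~R.

Definition lattice (R : realType) (v0 D : R) : set R :=
  range (lattice_point v0 D).

Definition vartheta (d : measure_display) (T : measurableType d)
    (R : realType) (P : probability T R) (v0 D : R) (X : {RV P >-> R}) :
    \bar R :=
  \esum_(k in [set: int])
    (Num.min (pmf X (lattice_point v0 D k))
             (pmf X (lattice_point v0 D (k + 1))))%:E.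

Definition mutually_independent (d : measure_display) (T : measurableType d)
    (R : realType) (P : probability T R) (I : finType)
    (X : I -> {RV P >-> R}) : Prop :=
  forall (J : {set I}) (A : I -> set R), (forall i, measurable (A i)) ->
    fine (P (\bigcap_(i in [set` J]) (X i @^-1` A i)))
      = \prod_(i in J) fine (P (X i @^-1` A i)).

Definition rv_sum (d : measure_display) (T : measurableType d) (R : realType)
    (P : probability T R) (n : nat) (X : 'I_n -> {RV P >-> R}) : T -> R :=
  fun w => \sum_(j < n) X j w.

(* C0 bounds the error of the local limit theorem for any sum of N independent
   fair coin tosses, on whatever probability space they are realized. *)
Definition binomial_llt_constant (R : realType) (C0 : R) : Prop :=
  forall N : nat, (1 <= N)%N ->
  forall (d : measure_display) (T : measurableType d) (P : probability T R)
    (B : 'I_N -> {RV P >-> R}),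
    mutually_independent B ->
    (forall i, pmf (B i) 0 = 2^-1 /\ pmf (B i) 1 = 2^-1) ->
  forall z : int,
    `| fine (P (rv_sum B @^-1` [set z%:~R]))
       - Num.sqrt (2 / (pi * N%:R))
         * expR (- ((2 * z%:~R - N%:R) ^+ 2 / (2 * N%:R))) |
    <= C0 * N%:R `^ (- (3 / 2)).

(* The monotonicity conditions are read on ]0, +oo[, where the quotients make
   sense: they force psi 0 = 0, and x ^+ 3 / psi x presupposes psi x != 0
   (which the convention a / 0 = 0 would not enforce). *)
Definition moment_function (R : realType) (psi : R -> R) : Prop :=
  [/\ forall x, 0 <= psi x,
      forall x, 0 < x -> 0 < psi x,
      forall x, psi (- x) = psi x,
      convex_function [set: R^o] psi
    & {in `]0, +oo[ &, nondecreasing_fun (fun x => psi x / x ^+ 2)} /\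
      {in `]0, +oo[ &, nondecreasing_fun (fun x => x ^+ 3 / psi x)}].

Definition Lratio (d : measure_display) (T : measurableType d) (R : realType)
    (P : probability T R) (psi : R -> R) (n : nat)
    (X : 'I_n -> {RV P >-> R}) : R :=
  (\sum_(j < n) fine 'E_P[psi \o X j])
    / psi (Num.sqrt (fine 'V_P[rv_sum X])).

(* Main.v *)
Require Import Defs.
From HB Require Import structures.
From mathcomp Require Import all_boot all_order all_algebra.
From mathcomp Require Import zify ring lra.
From mathcomp Require Import all_classical all_reals all_analysis measurable_realfun.
Import Order.TTheory GRing.Theory Num.Theory.
Import numFieldNormedType.Exports.
Local Open Scope classical_set_scope.
Local Open Scope ring_scope.
Set Implicit Arguments.
Unset Strict Implicit.
Unset Printing Implicit Defensive.

(** Rescaling turns the lattice into the integers. Split the sum into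
    independent blocks [S = S1 + S2], where [S2] keeps a third of [Theta] and
    [S1] keeps half of the variance. If [F1] is the distribution function of
    [S1], then
      [P (S = k) = E (F1 (k - S2) - F1 (k - S2 - 1))],
    the expectation of a unit increment of a bounded function, taken at [S2].

    Two estimates act on this formula. First, each summand contains a fair coin
    with weight [theta j] (its Bernoulli part), so that
    [E (h (S2 + 1) - h S2)] is at most a constant times
    [sup |h| / sqrt Theta] for every bounded [h] ([smoothing]). Second, [F1] is
    within a constant times [L] of a Gaussian distribution function, by the
    Berry-Esseen bound ([berry_esseen]), proved by Stein's method and a
    concentration inequality for sums. Taking for [h] the difference of [F1] and
    its Gaussian approximation replaces the former by the latter at the cost
    [L / sqrt Theta]: this is where the two small factors multiply.

    What remains is a unit increment of a Gaussian distribution function. It is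
    the Gaussian density up to the cube of the inverse standard deviation, hence
    up to [Theta ^ (- 3 / 2)], because the variance is at least a multiple of
    [Theta] ([gauss_pdf_midpoint], [theta_le_variance]). Finally the summands of
    [S2] are absorbed one at a time into the density, whose variance grows as
    prescribed by the heat equation ([lindeberg]). Altogether the error is of
    order [(L + Theta^-1) / sqrt Theta].

    This is done first for finitely supported laws, where expectations are finite
    sums ([lattice_llt]). The general case follows by truncation: the sums of
    truncated variables are eventually constant at almost every outcome, and
    dominated convergence carries every quantity of the estimate to its limit
    ([cvg_expect_trunc], [coord_sum_llt]).

    All error terms are expressed through [min (u ^ 2, |u| ^ 3)], called
    [trunc_cube]. The two monotonicity conditions on a moment function [psi] say
    that [trunc_cube (x / s) <= psi x / psi s] ([trunc_cube_le_moment]), and this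
    is how [L] bounds them. *)

(** * Expectation on a finite product space *)

Section ProductExpectation.
Context {R : realFieldType} {I A : finType} (p : I -> A -> R).

Definition expect1 i (f : A -> R) : R := \sum_a p i a * f a.

Definition expect (F : {ffun I -> A} -> R) : R :=
  \sum_(w : {ffun I -> A}) (\prod_i p i (w i)) * F w.

Definition update (w : {ffun I -> A}) i a : {ffun I -> A} :=
  [ffun j => if j == i then a else w j].

Definition free_of i (F : {ffun I -> A} -> R) :=
  forall w a, F (update w i a) = F w.

Hypothesis p_ge0 : forall i a, 0 <= p i a.
Hypothesis p_sum1 : forall i, \sum_a p i a = 1.

Lemma update_same w i a : update w i a i = a.
Proof. by rewrite ffunE eqxx. Qed.

Lemma update_other w i a j : j != i -> update w i a j = w j.
Proof. by rewrite ffunE => /negPf ->. Qed.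

Lemma expect1_ext i f g : f =1 g -> expect1 i f = expect1 i g.
Proof. by move=> fg; apply: eq_bigr => a _; rewrite fg. Qed.

Lemma expect1D i f g :
  expect1 i (fun a => f a + g a) = expect1 i f + expect1 i g.
Proof. by rewrite -big_split; apply: eq_bigr => a _; rewrite mulrDr. Qed.

Lemma expect1Zl i c f : expect1 i (fun a => c * f a) = c * expect1 i f.
Proof. by rewrite mulr_sumr; apply: eq_bigr => a _; rewrite mulrCA. Qed.

Lemma expect1B i f g :
  expect1 i (fun a => f a - g a) = expect1 i f - expect1 i g.
Proof.
rewrite -[in RHS]mulN1r -expect1Zl -expect1D.
by apply: expect1_ext => a; rewrite mulN1r.
Qed.

Lemma expect1_cst i c : expect1 i (fun=> c) = c.
Proof. by rewrite /expect1 -mulr_suml p_sum1 mul1r. Qed.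

Lemma ler_expect1 i f g :
  (forall a, f a <= g a) -> expect1 i f <= expect1 i g.
Proof. by move=> fg; apply: ler_sum => a _; apply: ler_wpM2l. Qed.

Lemma expect1_ge0 i f : (forall a, 0 <= f a) -> 0 <= expect1 i f.
Proof. by move=> f0; apply: sumr_ge0 => a _; apply: mulr_ge0. Qed.

Lemma ler_norm_expect1 i f : `|expect1 i f| <= expect1 i (fun a => `|f a|).
Proof.
rewrite /expect1 (le_trans (ler_norm_sum _ _ _)) //; apply: ler_sum => a _.
by rewrite normrM (ger0_norm (p_ge0 _ _)).
Qed.

Lemma expect_ext F G : F =1 G -> expect F = expect G.
Proof. by move=> FG; apply: eq_bigr => w _; rewrite FG. Qed.

Lemma expectD F G : expect (fun w => F w + G w) = expect F + expect G.
Proof. by rewrite -big_split; apply: eq_bigr => w _; rewrite mulrDr. Qed.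

Lemma expectZl c F : expect (fun w => c * F w) = c * expect F.
Proof. by rewrite mulr_sumr; apply: eq_bigr => w _; rewrite mulrCA. Qed.

Lemma expectN F : expect (fun w => - F w) = - expect F.
Proof. by rewrite -sumrN; apply: eq_bigr => w _; rewrite mulrN. Qed.

Lemma expectB F G : expect (fun w => F w - G w) = expect F - expect G.
Proof. by rewrite expectD expectN. Qed.

Lemma expect_sum (J : Type) (s : seq J) (Q : pred J) (F : J -> _ -> R) :
  expect (fun w => \sum_(j <- s | Q j) F j w) = \sum_(j <- s | Q j) expect (F j).
Proof.
rewrite exchange_big; apply: eq_bigr => w _.
by rewrite mulr_sumr.
Qed.

Lemma expect_cst c : expect (fun=> c) = c.
Proof.
rewrite /expect -mulr_suml -(bigA_distr_bigA (fun i a => p i a)) /=.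
by rewrite big1 ?mul1r// => i _; rewrite p_sum1.
Qed.

Lemma ler_expect F G : (forall w, F w <= G w) -> expect F <= expect G.
Proof.
by move=> FG; apply: ler_sum => w _; apply: ler_wpM2l => //; apply: prodr_ge0.
Qed.

Lemma expect_ge0 F : (forall w, 0 <= F w) -> 0 <= expect F.
Proof.
by move=> F0; rewrite -(expect_cst 0); apply: ler_expect.
Qed.

Lemma ler_norm_expect F : `|expect F| <= expect (fun w => `|F w|).
Proof.
rewrite ler_norml -expectN; apply/andP; split; apply: ler_expect => w.
  by rewrite lerNl -normrN ler_norm.
exact: ler_norm.
Qed.

(** Exchanging the coordinate [w i] with an independent copy [a] is a
    weight-preserving involution of the pairs [(w, a)]. *)
Lemma expect_resample i F :
  expect F = expect (fun w => expect1 i (fun a => F (update w i a))).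
Proof.
pose swap (u : {ffun I -> A} * A) := (update u.1 i u.2, u.1 i).
have swapK : involutive swap.
  move=> [w a]; rewrite /swap /= update_same; congr pair.
  by apply/ffunP => j; rewrite !ffunE; case: eqP => // ->.
have wtE w : \prod_j p j (w j) = p i (w i) * \prod_(j | j != i) p j (w j).
  by rewrite (bigD1 i).
transitivity (\sum_(u : {ffun I -> A} * A) (\prod_j p j (u.1 j)) * p i u.2 * F u.1).
  rewrite -(pair_bigA _ (fun (w : {ffun I -> A}) a => (\prod_j p j (w j)) * p i a * F w)) /=.
  apply: eq_bigr => w _; rewrite -mulr_suml -mulr_sumr p_sum1.
  by rewrite mulr1.
rewrite (reindex_inj (inv_inj swapK)) /=.
rewrite -(pair_bigA _ (fun (w : {ffun I -> A}) a => (\prod_j p j (update w i a j)) * p i (w i)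
                                   * F (update w i a))) /=.
apply: eq_bigr => w _; rewrite /expect1 mulr_sumr; apply: eq_bigr => a _.
rewrite (wtE w) (wtE (update w i a)) update_same.
rewrite (eq_bigr (fun j => p j (w j))); last first.
  by move=> j ji; rewrite update_other.
ring.
Qed.

(** Independence of a coordinate from the others, read off by resampling it. *)
Lemma expectM_free i f G : free_of i G ->
  expect (fun w => f (w i) * G w) = expect1 i f * expect G.
Proof.
move=> freeG; rewrite (expect_resample i) -expectZl.
apply: expect_ext => w; rewrite mulrC -expect1Zl; apply: expect1_ext => a.
by rewrite update_same freeG mulrC.
Qed.

Lemma expect_coord i f : expect (fun w => f (w i)) = expect1 i f.
Proof.
have := @expectM_free i f (fun=> 1) (fun _ _ => erefl).
by rewrite expect_cst mulr1 => <-; apply: expect_ext => w; rewrite mulr1.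
Qed.

Lemma free_of_sum i (s : seq I) (Q : pred I) (f : I -> A -> R) :
  i \notin [seq j <- s | Q j] ->
  free_of i (fun w => \sum_(j <- s | Q j) f j (w j)).
Proof.
move=> iNs w a; rewrite -big_filter -[RHS]big_filter big_seq_cond.
rewrite [RHS]big_seq_cond; apply: eq_bigr => j; rewrite andbT => js.
by rewrite update_other//; apply: contra iNs => /eqP <-.
Qed.

(** Bienayme: the cross terms of independent centred summands vanish. *)
Lemma expect_sum_sqr (Q : pred I) (f : I -> A -> R) :
  (forall i, expect1 i (f i) = 0) ->
  expect (fun w => (\sum_(i | Q i) f i (w i)) ^+ 2)
    = \sum_(i | Q i) expect1 i (fun a => f i a ^+ 2).
Proof.
move=> f0; transitivity (expect (fun w => \sum_(i | Q i) f i (w i) *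
   (f i (w i) + \sum_(j | Q j && (j != i)) f j (w j)))).
  apply: expect_ext => w; rewrite expr2 mulr_suml; apply: eq_bigr => i Qi.
  by rewrite (bigD1 i).
rewrite expect_sum; apply: eq_bigr => i Qi.
rewrite -(expect_coord i (fun a => f i a ^+ 2)).
rewrite (expect_ext (G := fun w => f i (w i) ^+ 2 +
   f i (w i) * \sum_(j | Q j && (j != i)) f j (w j))); last first.
  by move=> w; rewrite mulrDr -expr2.
rewrite expectD expectM_free ?f0 ?mul0r ?addr0//.
by apply: free_of_sum; rewrite mem_filter eqxx !andbF.
Qed.

(** Cauchy-Schwarz, in the form [2 c |F| <= F ^ 2 + c ^ 2]. *)
Lemma ler_expect_norm_sqr F (c : R) :
  0 < c -> expect (fun w => F w ^+ 2) <= c ^+ 2 -> expect (fun w => `|F w|) <= c.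
Proof.
move=> c0 Fc.
suff : expect (fun w => 2 * c * `|F w|) <= 2 * c * c.
  by rewrite expectZl ler_pM2l// mulr_gt0.
apply: (@le_trans _ _ (expect (fun w => F w ^+ 2 + c ^+ 2))).
  by apply: ler_expect => w; rewrite -(real_normK (num_real (F w)));
     have := sqr_ge0 (`|F w| - c); nra.
by rewrite expectD expect_cst; nra.
Qed.

End ProductExpectation.

Arguments expect1_ext {R I A p i f} g _.
Arguments expect_ext {R I A p F} G _.

(** * Concentration of sums of independent variables *)

(** This is [min (u ^ 2, |u| ^ 3)]: the error of a second-order expansion of a
    function with bounded second and third derivatives. *)
Definition trunc_cube {R : realFieldType} (u : R) : R := u ^+ 2 * Num.min 1 `|u|.

Section TruncCube.
Context {R : realFieldType}.
Implicit Types u v : R.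

Lemma min1_norm_ge0 u : 0 <= Num.min 1 `|u|.
Proof. by rewrite le_min ler01 normr_ge0. Qed.

Lemma trunc_cube_ge0 u : 0 <= trunc_cube u.
Proof. by rewrite mulr_ge0 ?sqr_ge0 ?min1_norm_ge0. Qed.

Lemma trunc_cube_norm u : trunc_cube `|u| = trunc_cube u.
Proof. by rewrite /trunc_cube normr_id real_normK ?num_real. Qed.

Lemma trunc_cube_le_sqr u : trunc_cube u <= u ^+ 2.
Proof. by rewrite ler_piMr ?sqr_ge0// ge_min lexx. Qed.

Lemma le_trunc_cube u v : `|u| <= `|v| -> trunc_cube u <= trunc_cube v.
Proof.
move=> uv; rewrite /trunc_cube ler_pM ?sqr_ge0 ?min1_norm_ge0//.
  by rewrite -(real_normK (num_real u)) -(real_normK (num_real v)) lerXn2r ?nnegrE.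
by rewrite le_min !ge_min lexx uv orbT.
Qed.

Lemma trunc_cubeZ (c u : R) : 1 <= c -> trunc_cube (c * u) <= c ^+ 3 * trunc_cube u.
Proof.
move=> c1; have c0 : 0 <= c by lra.
rewrite /trunc_cube exprMn.
have -> : c ^+ 3 * (u ^+ 2 * Num.min 1 `|u|)
  = c ^+ 2 * u ^+ 2 * (c * Num.min 1 `|u|) by ring.
apply: ler_wpM2l; first by rewrite mulr_ge0 ?sqr_ge0.
rewrite normrM (ger0_norm c0) minr_pMr// mulr1.
by rewrite le_min !ge_min lexx c1 orbT.
Qed.

(** The larger of the two terms, doubled, dominates the sum. *)
Lemma trunc_cubeD u v : trunc_cube (u + v) <= 8 * (trunc_cube u + trunc_cube v).
Proof.
have H (a b : R) : `|a| <= `|b| -> trunc_cube (a + b) <= 8 * trunc_cube b.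
  move=> ab; apply: (@le_trans _ _ (trunc_cube (2 * b))).
    apply: le_trunc_cube; rewrite normrM ger0_norm// (le_trans (ler_normD _ _))//.
    by lra.
  by apply: le_trans (trunc_cubeZ _ _) _; lra.
have [uv|/ltW uv] := leP `|u| `|v|.
  by have := H _ _ uv; have := trunc_cube_ge0 u; lra.
by rewrite addrC; have := H _ _ uv; have := trunc_cube_ge0 v; lra.
Qed.

End TruncCube.

Section Concentration.
Context {R : realFieldType} {I A : finType} (p : I -> A -> R).
Hypothesis p_ge0 : forall i a, 0 <= p i a.
Hypothesis p_sum1 : forall i, \sum_a p i a = 1.
Variable (xi : I -> A -> R).
Hypothesis xi_mean0 : forall i, expect1 p i (xi i) = 0.

Local Notation E := (expect p).
Local Notation E1 := (expect1 p).
Let var i := E1 i (fun a => xi i a ^+ 2).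
Let W (Q : pred I) (w : {ffun I -> A}) := \sum_(i | Q i) xi i (w i).

Let clamp (lo hi : R) w := Num.min (Num.max w lo) hi.

Let clamp_mono lo hi u v : u <= v -> clamp lo hi u <= clamp lo hi v.
Proof.
move=> uv; rewrite /clamp le_min !ge_min !lexx !orbT andbT.
by rewrite ge_max !le_max uv lexx orbT.
Qed.

Let clamp_slope (a b d w x : R) : a <= b -> 0 <= d -> a <= w <= b ->
  `|x| * Num.min d `|x|
     <= x * (clamp (a - d) (b + d) w - clamp (a - d) (b + d) (w - x)).
Proof.
move=> ab d0 /andP[aw wb]; rewrite /clamp.
rewrite (max_l (_ : a - d <= w)); last by lra.
rewrite (min_l (_ : w <= b + d)); last by lra.
have [x0|x0] := leP 0 x.
  rewrite ger0_norm// ler_wpM2l//.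
  case: (leP d x) => dx; case: (leP (w - x) (a - d)) => h1;
  case: (leP _ (b + d)) => h2; lra.
rewrite ltr0_norm// -[leRHS]mulrNN; apply: ler_wpM2l; first by lra.
case: (leP d (- x)) => dx; case: (leP (w - x) (a - d)) => h1;
  case: (leP _ (b + d)) => h2; lra.
Qed.

(** A clamped linear function [f] with slope one on [[a - d, b + d]] turns the
    event [a <= W <= b] into a moment. Since [f] is monotone and the rest of the
    sum is independent of the centred [xi i], the identity
    [E (W f W) = sum_i E (xi i (f W - f (W - xi i)))] bounds [E (W f W)] below by
    the expectation of [N = sum_i |xi i| min (d, |xi i|)] on that event, and
    [N] fluctuates by at most [d]. On the other side [f] is bounded by
    [(b - a) / 2 + d]. *)
Lemma concentration (Q : pred I) (a b d : R) : a <= b -> 0 < d ->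
  \sum_(i | Q i) var i <= 1 ->
  2^-1 <= \sum_(i | Q i) E1 i (fun a => `|xi i a| * Num.min d `|xi i a|) ->
  E (fun w => ((a <= W Q w <= b)%R)%:R) <= b - a + 4 * d.
Proof.
move=> ab d0 var1 eta_half.
have d0' := ltW d0.
pose eta i x := `|xi i x| * Num.min d `|xi i x|.
pose N w := \sum_(i | Q i) eta i (w i).
pose f w := clamp (a - d) (b + d) w - (a + b) / 2.
have f_bound w : `|f w| <= (b - a) / 2 + d.
  rewrite /f /clamp; case: (leP w (a - d)) => h1; case: (leP _ (b + d)) => h2;
  by rewrite ler_norml; apply/andP; split; lra.
have EW1 : E (fun w => `|W Q w|) <= 1.
  by apply: ler_expect_norm_sqr => //; rewrite expect_sum_sqr// expr1n.
have upper : E (fun w => W Q w * f (W Q w)) <= (b - a) / 2 + d.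
  apply: (@le_trans _ _ (E (fun w => ((b - a) / 2 + d) * `|W Q w|))).
    apply: ler_expect => // w; apply: le_trans (ler_norm _) _.
    by rewrite normrM mulrC ler_wpM2r.
  by rewrite expectZl ler_piMr//; lra.
have lower : E (fun w => ((a <= W Q w <= b)%R)%:R * N w)
    <= E (fun w => W Q w * f (W Q w)).
  have -> : E (fun w => W Q w * f (W Q w)) = \sum_(i | Q i)
      E (fun w => xi i (w i) * (f (W Q w) - f (W Q w - xi i (w i)))).
    transitivity (\sum_(i | Q i) E (fun w => xi i (w i) * f (W Q w))).
      by rewrite -expect_sum; apply: expect_ext => w; rewrite -mulr_suml.
    apply: eq_bigr => i Qi.
    rewrite [RHS](expect_ext (fun w => xi i (w i) * f (W Q w) -
       xi i (w i) * f (W Q w - xi i (w i)))); last by move=> w; rewrite mulrBr.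
    rewrite expectB (@expectM_free _ _ _ _ _ i (xi i) (fun w => f (W Q w - xi i (w i))))//.
      by rewrite xi_mean0 mul0r subr0.
    have WE w : W Q w - xi i (w i) = \sum_(j | Q j && (j != i)) xi j (w j).
      by rewrite /W (bigD1 i)//= addrAC subrr add0r.
    move=> w x; rewrite !WE; congr f; apply: free_of_sum.
    by rewrite mem_filter eqxx !andbF.
  rewrite -expect_sum; apply: ler_expect => // w.
  rewrite /N mulr_sumr; apply: ler_sum => i _.
  have -> : f (W Q w) - f (W Q w - xi i (w i)) = clamp (a - d) (b + d) (W Q w)
     - clamp (a - d) (b + d) (W Q w - xi i (w i)) by rewrite /f; lra.
  case: (boolP (a <= W Q w <= b)) => h.
    by rewrite mul1r; apply: clamp_slope.
  rewrite mul0r; have [x0|x0] := leP 0 (xi i (w i)).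
    by rewrite mulr_ge0// subr_ge0 clamp_mono//; lra.
  by rewrite mulr_le0 ?(ltW x0)// subr_le0 clamp_mono//; lra.
have fluct : E (fun w => `|N w - \sum_(i | Q i) E1 i (eta i)|) <= d.
  apply: ler_expect_norm_sqr => //.
  pose eta0 i x := eta i x - E1 i (eta i).
  rewrite (expect_ext (fun w => (\sum_(i | Q i) eta0 i (w i)) ^+ 2)); last first.
    by move=> w; rewrite sumrB.
  have eta0_mean i : E1 i (eta0 i) = 0 by rewrite expect1B expect1_cst// subrr.
  rewrite expect_sum_sqr//.
  apply: (@le_trans _ _ (\sum_(i | Q i) d ^+ 2 * var i)); last first.
    by rewrite -mulr_sumr ler_piMr// sqr_ge0.
  apply: ler_sum => i _.
  apply: (@le_trans _ _ (E1 i (fun x => eta i x ^+ 2))).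
    have -> : E1 i (fun x => eta0 i x ^+ 2)
       = E1 i (fun x => eta i x ^+ 2) - E1 i (eta i) ^+ 2.
      rewrite (expect1_ext (fun x => (eta i x ^+ 2 + E1 i (eta i) ^+ 2)
          - 2 * E1 i (eta i) * eta i x)); last by move=> x; rewrite /eta0; ring.
      by rewrite expect1B expect1D expect1_cst// expect1Zl; ring.
    by rewrite gerBl sqr_ge0.
  rewrite /var -expect1Zl; apply: ler_expect1 => // x.
  rewrite /eta exprMn real_normK ?num_real// mulrC ler_wpM2r ?sqr_ge0//.
  by rewrite lerXn2r ?nnegrE// ?ge_min ?lexx// le_min d0' /=.
have : E (fun w => 2^-1 * ((a <= W Q w <= b)%R)%:R
         - `|N w - \sum_(i | Q i) E1 i (eta i)|)
    <= E (fun w => ((a <= W Q w <= b)%R)%:R * N w).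
  apply: ler_expect => // w.
  have := ler_norm (- (N w - \sum_(i | Q i) E1 i (eta i))); rewrite normrN.
  have : 0 <= N w.
    by apply: sumr_ge0 => i _; rewrite mulr_ge0// le_min d0' normr_ge0.
  have := normr_ge0 (N w - \sum_(i | Q i) E1 i (eta i)).
  move: eta_half; rewrite -/eta.
  case: (a <= W Q w <= b) => /=; lra.
rewrite expectB expectZl; lra.
Qed.

(** From [min (d, y) >= y - y ^ 2 / (4 d)]: a cut-off at [d] loses little of the
    variance as soon as [d] exceeds the truncated third moment. *)
Lemma eta_lower i d : 0 < d <= 4^-1 ->
  var i - E1 i (fun a => trunc_cube (xi i a)) / (4 * d)
    <= E1 i (fun a => `|xi i a| * Num.min d `|xi i a|).
Proof.
move=> /andP[d0 d4]; rewrite /var mulrC -expect1Zl -expect1B.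
apply: ler_expect1 => // x; rewrite /trunc_cube -[xi i x ^+ 2]real_normK ?num_real//.
set y := `|xi i x|; have y0 : 0 <= y by exact: normr_ge0.
rewrite lerBlDr -lerBlDl.
have d4p : 0 < 4 * d by lra.
rewrite [leRHS]mulrC ler_pdivlMr//.
have [dy|yd] := leP d y; last first.
  rewrite -expr2 subrr mul0r mulr_ge0 ?sqr_ge0// le_min ler01 y0 //.
have [y1|y1] := leP 1 y.
  nra.
have : 0 <= (y - 2 * d) ^+ 2 by exact: sqr_ge0.
nra.
Qed.

End Concentration.

(** * Mean values and Taylor bounds on the real line *)

Section Calculus.
Context {R : realType}.
Implicit Types (f g : R -> R) (a x y : R).

Lemma is_derive_add f g x df dg : is_derive x 1 f df -> is_derive x 1 g dg ->
  is_derive x 1 (fun y => f y + g y) (df + dg).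
Proof. by move=> hf hg; apply: is_deriveD. Qed.

Lemma is_derive_sub f g x df dg : is_derive x 1 f df -> is_derive x 1 g dg ->
  is_derive x 1 (fun y => f y - g y) (df - dg).
Proof. by move=> hf hg; apply: is_deriveB. Qed.

Lemma is_derive_opp f x df : is_derive x 1 f df ->
  is_derive x 1 (fun y => - f y) (- df).
Proof. by move=> hf; apply: is_deriveN. Qed.

Lemma is_derive_mul f g x df dg : is_derive x 1 f df -> is_derive x 1 g dg ->
  is_derive x 1 (fun y => f y * g y) (df * g x + f x * dg).
Proof.
by move=> hf hg; apply: is_derive_eq; rewrite /GRing.scale/= addrC mulrC.
Qed.

Lemma is_derive_const c x : is_derive x 1 (fun=> c : R) 0.
Proof. exact: is_derive_cst. Qed.

Lemma is_derive_var x : is_derive x 1 (fun y : R => y) 1.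
Proof. exact: is_derive_id. Qed.

Lemma is_derive_exp f x df : is_derive x 1 f df ->
  is_derive x 1 (fun y => expR (f y)) (df * expR (f x)).
Proof.
by move=> hf; apply: is_derive_eq (is_derive1_comp (is_derive_expR _) hf) _; rewrite mulrC.
Qed.

Lemma is_derive_to f x df df' : is_derive x 1 f df -> df = df' -> is_derive x 1 f df'.
Proof. by move=> hf <-. Qed.

(** The condition [0 <= (y - a) * (x - y)] says that [y] lies between [a] and
    [x] without deciding which of the two is larger, so that expansions to the
    left and to the right of [a] need a single statement. *)
Lemma mean_value f df a x :
  (forall y, 0 <= (y - a) * (x - y) -> is_derive y 1 f (df y)) ->
  exists2 c, 0 <= (c - a) * (x - c) & f x - f a = df c * (x - a).
Proof.
move=> hf; have cont u v : (forall y, u <= y <= v -> is_derive y 1 f (df y)) ->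
  {within `[u, v], continuous f}.
  move=> huv; apply: derivable_within_continuous => y; rewrite in_itv/= => yuv.
  by have [] := huv y yuv.
have [ax|/ltW xa] := leP a x.
  have [||c] := @MVT_segment _ f df a x ax.
  - by move=> y; rewrite in_itv/= => /andP[ay yx]; apply: hf; nra.
  - by apply: cont => y /andP[ay yx]; apply: hf; nra.
  by rewrite in_itv/= => /andP[ac cx] e; exists c => //; nra.
have [||c] := @MVT_segment _ f df x a xa.
- by move=> y; rewrite in_itv/= => /andP[ay yx]; apply: hf; nra.
- by apply: cont => y /andP[ay yx]; apply: hf; nra.
by rewrite in_itv/= => /andP[ac cx] e; exists c; [nra|lra].
Qed.

Lemma betweenP a x y :
  0 <= (y - a) * (x - y) <-> (a <= y /\ y <= x) \/ (x <= y /\ y <= a).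
Proof.
split=> [h|[[ay yx]|[xy ya]]]; last 2 first.
- by rewrite mulr_ge0// subr_ge0.
- by rewrite mulr_le0// subr_le0.
have [ay|ya|ay] := ltgtP a y; last by subst y; have [?|?] := leP a x; [left|right]; split => //; lra.
- by left; split; [by []|]; rewrite -subr_ge0 -(pmulr_rge0 _ (_ : 0 < y - a))// subr_gt0.
- by right; split; [|by []]; rewrite -subr_le0 -(nmulr_rge0 _ (_ : y - a < 0))// subr_lt0.
Qed.

Lemma between_dist a x y : 0 <= (y - a) * (x - y) -> `|y - a| <= `|x - a|.
Proof.
move=> /betweenP[[h1 h2]|[h1 h2]].
  by rewrite !ger0_norm; lra.
by rewrite !ler0_norm; lra.
Qed.

Lemma between_trans a x y z : 0 <= (y - a) * (x - y) -> 0 <= (z - a) * (y - z) ->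
  0 <= (z - a) * (x - z).
Proof.
move=> /betweenP[[h1 h2]|[h1 h2]] /betweenP[[h3 h4]|[h3 h4]]; apply/betweenP.
- by left; lra.
- by left; lra.
- by right; lra.
- by right; lra.
Qed.

(** One integration of a bound on a derivative. Iterating it gives Taylor's
    formula up to the factorial in the constant. *)
Lemma growth_bound f df a x M k :
  (forall y, 0 <= (y - a) * (x - y) -> is_derive y 1 f (df y)) ->
  (forall y, 0 <= (y - a) * (x - y) -> `|df y| <= M * `|y - a| ^+ k) -> 0 <= M ->
  forall y, 0 <= (y - a) * (x - y) -> `|f y - f a| <= M * `|y - a| ^+ k.+1.
Proof.
move=> hf hM M0 y yx; have [|c ac ->] := @mean_value f df a y.
  by move=> z zy; apply: hf; apply: between_trans yx zy.
rewrite normrM exprSr mulrA ler_wpM2r//.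
apply: le_trans (hM _ (between_trans yx ac)) _.
by rewrite ler_wpM2l// lerXn2r ?nnegrE// between_dist.
Qed.

Lemma taylor2 f f1 f2 a x M :
  (forall y, 0 <= (y - a) * (x - y) -> is_derive y 1 f (f1 y)) ->
  (forall y, 0 <= (y - a) * (x - y) -> is_derive y 1 f1 (f2 y)) ->
  (forall y, 0 <= (y - a) * (x - y) -> `|f2 y| <= M) ->
  `|f x - f a - f1 a * (x - a)| <= M * `|x - a| ^+ 2.
Proof.
move=> h0 h1 hM.
have aa : 0 <= (a - a) * (x - a) by rewrite subrr mul0r.
have xx : 0 <= (x - a) * (x - x) by rewrite subrr mulr0.
have M0 : 0 <= M by apply: le_trans (hM a aa).
have b1 : forall y, 0 <= (y - a) * (x - y) -> `|f1 y - f1 a| <= M * `|y - a| ^+ 1.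
  apply: (growth_bound (df := f2)) => // y yx.
  by rewrite expr0 mulr1; apply: hM.
have := @growth_bound (fun y => f y - f1 a * (y - a)) (fun y => f1 y - f1 a) a x M 1.
move=> /(_ _ b1 M0 x xx) h.
have -> : f x - f a - f1 a * (x - a) = f x - f1 a * (x - a) - (f a - f1 a * (a - a)).
  by ring.
apply: h => y yx.
apply: is_derive_to (is_derive_sub (h0 y yx) (is_derive_mul (is_derive_const _ _)
   (is_derive_sub (is_derive_var _) (is_derive_const _ _)))) _.
by ring.
Qed.

Lemma taylor3 f f1 f2 f3 a x M :
  (forall y, is_derive y 1 f (f1 y)) ->
  (forall y, is_derive y 1 f1 (f2 y)) ->
  (forall y, is_derive y 1 f2 (f3 y)) ->
  (forall y, `|f3 y| <= M) ->
  `|f x - f a - f1 a * (x - a) - f2 a / 2 * (x - a) ^+ 2| <= M * `|x - a| ^+ 3.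
Proof.
move=> h0 h1 h2 hM.
have M0 : 0 <= M by apply: le_trans (hM a).
have xx : 0 <= (x - a) * (x - x) by rewrite subrr mulr0.
have b1 y : 0 <= (y - a) * (x - y) ->
    `|f1 y - f1 a - f2 a * (y - a)| <= M * `|y - a| ^+ 2.
  by move=> _; apply: (taylor2 (f2 := f3)).
have := @growth_bound (fun y => f y - f1 a * (y - a) - f2 a / 2 * (y - a) ^+ 2)
  (fun y => f1 y - f1 a - f2 a * (y - a)) a x M 2.
move=> /(_ _ b1 M0 x xx) h.
have -> : f x - f a - f1 a * (x - a) - f2 a / 2 * (x - a) ^+ 2 =
  f x - f1 a * (x - a) - f2 a / 2 * (x - a) ^+ 2
  - (f a - f1 a * (a - a) - f2 a / 2 * (a - a) ^+ 2).
  by ring.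
apply: h => y yx.
have hid := is_derive_sub (is_derive_var y) (is_derive_const a y).
apply: is_derive_to (is_derive_sub (is_derive_sub (h0 y)
   (is_derive_mul (is_derive_const _ _) hid))
   (is_derive_mul (is_derive_const _ _) (is_derive_mul hid hid))) _.
by field.
Qed.

End Calculus.

(** * The Gaussian density and distribution function *)

Definition bell {R : realType} (t : R) : R := expR (- (t ^+ 2 / 2)).

Definition std_normal_cdf {R : realType} (x : R) : R :=
  fine (normal_prob 0 1 `]-oo, x]).

Section Bell.
Context {R : realType}.
Implicit Types (t x y : R).

Local Notation root2pi := (Num.sqrt (2 * pi : R)).
Local Notation Phi := (@std_normal_cdf R).

Lemma root2pi_bounds : 1 <= root2pi <= 3.
Proof.
have h1 := @pi_ge2 R; have [/andP[_ h2] _] := @pihalf_02_cos_pihalf R.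
have h0 : 0 <= root2pi by exact: sqrtr_ge0.
have : root2pi ^+ 2 = 2 * pi by rewrite sqr_sqrtr//; lra.
by move=> h3; apply/andP; split; nra.
Qed.

Lemma bell_gt0 t : 0 < bell t.
Proof. exact: expR_gt0. Qed.

Lemma is_derive_bell t : is_derive t 1 bell (- t * bell t).
Proof.
have hid := is_derive_var t.
have := is_derive_exp (is_derive_mul (is_derive_const (- 2^-1) t) (is_derive_mul hid hid)).
rewrite (_ : (fun y : R => expR _) = bell).
  by move=> h; apply: (is_derive_to h); rewrite /bell; congr (_ * expR _); field.
by apply/funext => y; rewrite /bell; congr expR; field.
Qed.

(** The exponential beats each power: the source of all uniform bounds on the
    derivatives of the Gaussian kernel below. *)
Lemma expRN_mul_le1 x : 0 <= x -> x * expR (- x) <= 1.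
Proof.
move=> x0; rewrite expRN ler_pdivrMr ?expR_gt0// mul1r.
by have := expR_ge1Dx x; lra.
Qed.

Lemma bell_le1 t : bell t <= 1.
Proof. by rewrite /bell expR_le1 oppr_le0 divr_ge0// sqr_ge0. Qed.

Lemma sqr_bell_le t : t ^+ 2 * bell t <= 2.
Proof.
have := @expRN_mul_le1 (t ^+ 2 / 2); rewrite divr_ge0 ?sqr_ge0// => /(_ isT).
rewrite /bell; lra.
Qed.

Lemma fourth_bell_le t : t ^+ 4 * bell t <= 16.
Proof.
have h := @expRN_mul_le1 (t ^+ 2 / 4).
have {}h := h (divr_ge0 (sqr_ge0 t) (ler0n _ 4)).
have -> : t ^+ 4 * bell t = 16 * (t ^+ 2 / 4 * expR (- (t ^+ 2 / 4))) ^+ 2.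
  rewrite exprMn -expRM_natr /bell.
  have -> : - (t ^+ 2 / 4) * 2 = - (t ^+ 2 / 2) by field.
  by field.
have h0 : 0 <= t ^+ 2 / 4 * expR (- (t ^+ 2 / 4)).
  by rewrite mulr_ge0 ?expR_ge0// divr_ge0// sqr_ge0.
nra.
Qed.

Lemma is_derive_bell1 t : is_derive t 1 (fun t => - t * bell t) ((t ^+ 2 - 1) * bell t).
Proof.
apply: is_derive_to (is_derive_mul (is_derive_opp (is_derive_var t))
  (is_derive_bell t)) _.
by ring.
Qed.

Lemma is_derive_bell2 t :
  is_derive t 1 (fun t => (t ^+ 2 - 1) * bell t) ((3 * t - t ^+ 3) * bell t).
Proof.
have hid := is_derive_var t.
apply: is_derive_to (is_derive_mul (is_derive_sub (is_derive_mul hid hid)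
  (is_derive_const 1 t)) (is_derive_bell t)) _.
by ring.
Qed.

Lemma bell2_le t : `|(t ^+ 2 - 1) * bell t| <= 3.
Proof.
have := sqr_bell_le t; have := bell_le1 t; have := bell_gt0 t => h1 h2 h3.
have : 0 <= t ^+ 2 * bell t by rewrite mulr_ge0 ?sqr_ge0// ltW.
rewrite ler_norml => h4; apply/andP; split; nra.
Qed.

Lemma bell3_le t : `|(3 * t - t ^+ 3) * bell t| <= 15.
Proof.
have := sqr_bell_le t; have := bell_le1 t; have := bell_gt0 t => h1 h2 h3.
have h4 := fourth_bell_le t; have h1' := ltW h1.
have : `|3 * t - t ^+ 3| <= 3 / 2 * (1 + t ^+ 2) + (t ^+ 2 + t ^+ 4) / 2.
  have h5 : 0 <= (t - 1) ^+ 2 by exact: sqr_ge0.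
  have h6 : 0 <= (t + 1) ^+ 2 by exact: sqr_ge0.
  have h7 : 0 <= (t * (t - 1)) ^+ 2 by exact: sqr_ge0.
  have h8 : 0 <= (t * (t + 1)) ^+ 2 by exact: sqr_ge0.
  by rewrite ler_norml; apply/andP; split; lra.
rewrite normrM (ger0_norm h1') => /(ler_wpM2r h1') h5; apply: le_trans h5 _.
by lra.
Qed.

Section Cdf.

Let N01 := normal_prob (0 : R) 1.

Lemma Phi_ge0 x : 0 <= Phi x.
Proof. by rewrite fine_ge0. Qed.

Lemma Phi_le1 x : Phi x <= 1.
Proof.
by rewrite -[1]/(fine 1%E) fine_le// ?fin_num_measure//; exact: probability_le1.
Qed.

Let normal_pdf_bell x : normal_pdf 0 1 x = bell x / root2pi.
Proof.
rewrite normal_pdfE ?oner_eq0// /normal_peak /normal_fun mulrC subr0 expr1n mul1r.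
rewrite /bell; congr (expR _ / Num.sqrt _); first by field.
by rewrite mulr_natl.
Qed.

Lemma is_derive_Phi x : is_derive x 1 Phi (bell x / root2pi).
Proof.
have [||||dF vF] := @continuous_FTC1 R (normal_pdf 0 1) -oo%O x (x + 1).
- by rewrite ltrDl.
- by apply: integrableS (integrable_normal_pdf _ _).
- by rewrite ltNyr.
- by apply: continuous_normal_pdf; rewrite oner_eq0.
rewrite -normal_pdf_bell -vF derive1E.
exact/derivableP.
Qed.

Let idR : measurableTypeR R -> R := idfun.

#[local] HB.instance Definition _ :=
  @isMeasurableFun.Build _ _ _ _ idR (@measurable_id _ _ setT).

Let cdf_fine : fine \o cdf (idR : {RV N01 >-> R}) = Phi.
Proof. by []. Qed.

Lemma Phi_to1 e : 0 < e -> exists y, forall z, y <= z -> 1 - e < Phi z.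
Proof.
move=> e0; have /fine_cvgP[_] := @cvg_cdfy1 _ _ _ N01 idR.
rewrite cdf_fine => /cvgrPdist_lt/(_ e e0)[M [Mreal HM]].
exists (M + 1) => z Mz; have /= := HM z; rewrite ltr_norml.
have Mz' : M < z by lra.
move=> /(_ Mz')/andP[_]; lra.
Qed.

Lemma Phi_to0 e : 0 < e -> exists y, forall z, z <= y -> Phi z < e.
Proof.
move=> e0; have /fine_cvgP[_] := @cvg_cdfNy0 _ _ _ N01 idR.
rewrite cdf_fine => /cvgrPdist_lt/(_ e e0)[M [Mreal HM]].
exists (M - 1) => z Mz; have /= := HM z; rewrite ltr_norml.
have Mz' : z < M by lra.
move=> /(_ Mz')/andP[]; lra.
Qed.

End Cdf.

End Bell.

(** * Stein's equation *)

Section SteinEquation.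
Context {R : realType}.
Implicit Types (w x y z : R).

Local Notation root2pi := (Num.sqrt (2 * pi : R)).
Local Notation Phi := (@std_normal_cdf R).

Let root2pi_gt0 : 0 < root2pi.
Proof. by have /andP[] := @root2pi_bounds R; lra. Qed.

(** Mills' ratio. The function [- bell / root2pi - w Phi] has derivative
    [(x - w) bell x / root2pi], so it increases on the right of [w]; let its
    argument tend to infinity. *)
Lemma mills_right w : w * (1 - Phi w) <= bell w / root2pi.
Proof.
have q0 : 0 <= bell w / root2pi by rewrite divr_ge0// ltW// bell_gt0.
have [w0|w0] := ltP 0 w; last first.
  by apply: le_trans q0; rewrite mulr_le0_ge0// subr_ge0 Phi_le1.
rewrite leNgt; apply/negP => lt_q.
pose e := (w * (1 - Phi w) - bell w / root2pi) / w.
have e0 : 0 < e by rewrite divr_gt0// subr_gt0.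
have [y0 /(_ (Num.max y0 w))] := Phi_to1 e0.
rewrite le_max lexx => /(_ isT); set y := Num.max _ _ => ye.
have wy : w <= y by rewrite le_max lexx orbT.
pose F x := - (bell x / root2pi) - w * Phi x.
have dF x : is_derive x 1 F ((x - w) * bell x / root2pi).
  apply: is_derive_to (is_derive_sub (is_derive_opp (is_derive_mul
    (is_derive_bell x) (is_derive_const root2pi^-1 x)))
    (is_derive_mul (is_derive_const w x) (is_derive_Phi x))) _.
  by field; apply: lt0r_neq0.
have [c /betweenP hc Fc] := @mean_value _ F _ w y (fun x _ => dF x).
have : 0 <= F y - F w.
  have wc : w <= c by case: hc => -[]; lra.
  by rewrite Fc mulr_ge0 ?divr_ge0 ?mulr_ge0 ?subr_ge0 ?(ltW (bell_gt0 _)) ?(ltW root2pi_gt0).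
have : 0 <= bell y / root2pi by rewrite divr_ge0// ltW// bell_gt0.
have : w * (1 - Phi w) - bell w / root2pi = e * w by rewrite divfK// lt0r_neq0.
rewrite /F; nra.
Qed.

Lemma mills_left w : - w * Phi w <= bell w / root2pi.
Proof.
have q0 : 0 <= bell w / root2pi by rewrite divr_ge0// ltW// bell_gt0.
have [w0|w0] := ltP w 0; last first.
  by apply: le_trans q0; rewrite mulr_le0_ge0 ?Phi_ge0//; lra.
rewrite leNgt; apply/negP => lt_q.
pose e := (- w * Phi w - bell w / root2pi) / - w.
have e0 : 0 < e by rewrite divr_gt0 ?subr_gt0//; lra.
have [y0 /(_ (Num.min y0 w))] := Phi_to0 e0.
rewrite ge_min lexx => /(_ isT); set y := Num.min _ _ => ye.
have wy : y <= w by rewrite ge_min lexx orbT.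
pose F x := - (bell x / root2pi) - w * Phi x.
have dF x : is_derive x 1 F ((x - w) * bell x / root2pi).
  apply: is_derive_to (is_derive_sub (is_derive_opp (is_derive_mul
    (is_derive_bell x) (is_derive_const root2pi^-1 x)))
    (is_derive_mul (is_derive_const w x) (is_derive_Phi x))) _.
  by field; apply: lt0r_neq0.
have [c /betweenP hc Fc] := @mean_value _ F _ w y (fun x _ => dF x).
have : 0 <= F y - F w.
  have wc : c <= w by case: hc => -[]; lra.
  rewrite Fc mulr_le0 ?subr_le0//.
  by rewrite pmulr_lle0 ?invr_gt0// mulr_le0_ge0 ?subr_le0// ltW// bell_gt0.
have : 0 <= bell y / root2pi by rewrite divr_ge0// ltW// bell_gt0.
have : - w * Phi w - bell w / root2pi = e * - w by rewrite divfK// oppr_eq0 lt_eqF.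
rewrite /F; nra.
Qed.

Let inv_pdf w := root2pi * expR (w ^+ 2 / 2).

Let inv_pdfE w : inv_pdf w = (bell w / root2pi)^-1.
Proof. by rewrite /inv_pdf /bell expRN invf_div invrK. Qed.

Let inv_pdf_gt0 w : 0 < inv_pdf w.
Proof. by rewrite mulr_gt0// expR_gt0. Qed.

Let pdf_mul w : bell w / root2pi * inv_pdf w = 1.
Proof. by rewrite inv_pdfE mulfV// mulf_neq0 ?invr_eq0// lt0r_neq0// bell_gt0. Qed.

Let is_derive_inv_pdf w : is_derive w 1 inv_pdf (w * inv_pdf w).
Proof.
have hid := is_derive_var w.
have h := is_derive_mul (is_derive_const root2pi w) (is_derive_exp
  (is_derive_mul (is_derive_mul hid hid) (is_derive_const 2^-1 w))).
by apply: is_derive_to h _; rewrite /inv_pdf; field.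
Qed.

(** Multiplying by the integrating factor [inv_pdf] solves [f' = w f + 1] and
    [f' = w f - 1]; [stein z] glues suitable multiples at [z], and thus satisfies
    [f' w = w f w + 1_{w <= z} - Phi z] away from [z]. *)
Definition stein_left w := Phi w * inv_pdf w.
Definition stein_right w := (1 - Phi w) * inv_pdf w.

Definition stein z w :=
  if w <= z then (1 - Phi z) * stein_left w else Phi z * stein_right w.

Lemma is_derive_stein_left w : is_derive w 1 stein_left (w * stein_left w + 1).
Proof.
apply: is_derive_to (is_derive_mul (is_derive_Phi w) (is_derive_inv_pdf w)) _.
by rewrite pdf_mul /stein_left; ring.
Qed.

Lemma is_derive_stein_right w : is_derive w 1 stein_right (w * stein_right w - 1).
Proof.
apply: is_derive_to (is_derive_mul (is_derive_sub (is_derive_const 1 w)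
  (is_derive_Phi w)) (is_derive_inv_pdf w)) _.
by rewrite sub0r mulNr pdf_mul /stein_right; ring.
Qed.

(** Both branches of [stein z] are below this function, which no longer
    depends on [z]. *)
Let ratio w := Phi w * (1 - Phi w) * inv_pdf w.

Let Phi_mono x y : x <= y -> Phi x <= Phi y.
Proof.
move=> xy; have [c _ e] := @mean_value _ Phi _ x y (fun y _ => is_derive_Phi y).
by rewrite -subr_ge0 e mulr_ge0 ?subr_ge0// divr_ge0 ?(ltW (bell_gt0 _)) ?ltW.
Qed.

Let stein_ge0 z w : 0 <= stein z w.
Proof.
by rewrite /stein; case: ifP => _; rewrite !mulr_ge0 ?subr_ge0 ?Phi_ge0 ?Phi_le1//;
  apply: ltW.
Qed.

Let stein_le_ratio z w : stein z w <= ratio w.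
Proof.
have i0 := ltW (inv_pdf_gt0 w).
rewrite /stein /ratio; case: (leP w z) => [wz|/ltW zw].
  have -> : (1 - Phi z) * stein_left w = Phi w * (1 - Phi z) * inv_pdf w.
    by rewrite /stein_left; ring.
  apply: ler_wpM2r => //; apply: ler_wpM2l; first exact: Phi_ge0.
  by have := Phi_mono wz; lra.
rewrite /stein_right mulrA.
apply: ler_wpM2r => //; apply: ler_wpM2r; first by rewrite subr_ge0 Phi_le1.
exact: Phi_mono.
Qed.

Let norm_ratio_le1 w : `|w| * ratio w <= 1.
Proof.
have H x y : 0 <= x <= 1 -> y <= bell w / root2pi -> x * y * inv_pdf w <= 1.
  move=> /andP[x0 x1] y1; rewrite -(pdf_mul w) ler_wpM2r ?(ltW (inv_pdf_gt0 _))//.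
  have : 0 <= bell w / root2pi by rewrite divr_ge0// ltW// bell_gt0.
  have [y0|/ltW y0] := leP 0 y; first by nra.
  by move=> h; apply: le_trans h; rewrite mulr_ge0_le0.
rewrite /ratio; have [w0|w0] := leP 0 w.
  rewrite ger0_norm//.
  have -> : w * (Phi w * (1 - Phi w) * inv_pdf w)
    = Phi w * (w * (1 - Phi w)) * inv_pdf w by ring.
  by apply: H (mills_right w); rewrite Phi_ge0 Phi_le1.
rewrite ltr0_norm//.
have -> : - w * (Phi w * (1 - Phi w) * inv_pdf w) = (1 - Phi w) * (- w * Phi w) * inv_pdf w.
  by ring.
apply: H (mills_left w); have := Phi_ge0 w; have := Phi_le1 w; lra.
Qed.

Let ratio_le2 w : ratio w <= 2.
Proof.
have r0 : 0 <= ratio w.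
  by rewrite !mulr_ge0 ?subr_ge0 ?Phi_ge0 ?Phi_le1// ltW.
have [w1|w1] := leP 1 `|w|; first by have := norm_ratio_le1 w; nra.
have P4 : Phi w * (1 - Phi w) <= 4^-1.
  by have := sqr_ge0 (Phi w - 2^-1); lra.
have : inv_pdf w <= 8.
  have /andP[_ c3] := @root2pi_bounds R.
  have e2 : expR (w ^+ 2 / 2) <= 2.
    have wb : w ^+ 2 / 2 <= 2^-1.
      by rewrite -(real_normK (num_real w)); have := normr_ge0 w; nra.
    have : expR (w ^+ 2 / 2) * expR (- (w ^+ 2 / 2)) = 1.
      by rewrite expRN mulfV// lt0r_neq0// expR_gt0.
    have := expR_ge1Dx (- (w ^+ 2 / 2)); have := expR_gt0 (w ^+ 2 / 2); nra.
  rewrite /inv_pdf; have := expR_gt0 (w ^+ 2 / 2); nra.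
rewrite /ratio; have := inv_pdf_gt0 w; nra.
Qed.

Lemma stein_bounds z w : 0 <= stein z w <= 2.
Proof. by rewrite stein_ge0 (le_trans (stein_le_ratio _ _) (ratio_le2 _)). Qed.

Lemma norm_mul_stein_le1 z w : `|w * stein z w| <= 1.
Proof.
rewrite normrM (ger0_norm (stein_ge0 z w)).
by apply: le_trans (norm_ratio_le1 w); rewrite ler_wpM2l// stein_le_ratio.
Qed.

(** The right-hand side of Stein's equation, which is the derivative of
    [stein z] where that exists and its left derivative at [z]. *)
Definition stein_deriv z w := w * stein z w + ((w <= z)%R)%:R - Phi z.

Lemma norm_stein_deriv_le z w : `|stein_deriv z w| <= 2.
Proof.
have := norm_mul_stein_le1 z w; have := Phi_ge0 z; have := Phi_le1 z.
rewrite /stein_deriv !ler_norml => h1 h2 /andP[h3 h4].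
by case: (w <= z) => /=; apply/andP; split; lra.
Qed.

Let steinE_right z w : z <= w -> stein z w = Phi z * stein_right w.
Proof.
rewrite /stein; case: (leP w z) => // wz zw.
have -> : w = z by apply/le_anti; rewrite wz zw.
by rewrite /stein_left /stein_right; ring.
Qed.

Let stein_mean_left z a b : a <= z -> b <= z ->
  exists2 c, 0 <= (c - a) * (b - c) &
    stein z b - stein z a = (b - a) * (c * stein z c + (1 - Phi z)).
Proof.
move=> az bz; have [c ac e] := @mean_value _ _ _ a b
  (fun y _ => is_derive_mul (is_derive_const (1 - Phi z) y) (is_derive_stein_left y)).
exists c => //; have cz : c <= z by move/betweenP: ac => [[]|[]]; lra.
by rewrite /stein az bz cz e /=; ring.
Qed.

Let stein_mean_right z a b : z <= a -> z <= b ->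
  exists2 c, 0 <= (c - a) * (b - c) &
    stein z b - stein z a = (b - a) * (c * stein z c - Phi z).
Proof.
move=> za zb; have [c ac e] := @mean_value _ _ _ a b
  (fun y _ => is_derive_mul (is_derive_const (Phi z) y) (is_derive_stein_right y)).
exists c => //; have zc : z <= c by move/betweenP: ac => [[]|[]]; lra.
by rewrite !steinE_right// e /=; ring.
Qed.

Let stein_lipschitz_side z a b : (a <= z) && (b <= z) || (z <= a) && (z <= b) ->
  `|stein z b - stein z a| <= 2 * `|b - a|.
Proof.
have P0 := Phi_ge0 z; have P1 := Phi_le1 z.
move=> /orP[/andP[az bz]|/andP[za zb]].
  have [c _ ->] := stein_mean_left az bz; rewrite normrM mulrC ler_wpM2r//.
  have := norm_mul_stein_le1 z c; rewrite !ler_norml => /andP[h1 h2].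
  by apply/andP; split; lra.
have [c _ ->] := stein_mean_right za zb; rewrite normrM mulrC ler_wpM2r//.
have := norm_mul_stein_le1 z c; rewrite !ler_norml => /andP[h1 h2].
by apply/andP; split; lra.
Qed.

Lemma stein_lipschitz z a b : `|stein z b - stein z a| <= 2 * `|b - a|.
Proof.
have H u v : u <= z -> z <= v -> `|stein z v - stein z u| <= 2 * (v - u).
  move=> uz zv; rewrite -(subrKA (stein z z)) (le_trans (ler_normD _ _))//.
  have := @stein_lipschitz_side z z v; rewrite lexx zv orbT => /(_ isT).
  have := @stein_lipschitz_side z u z; rewrite lexx uz => /(_ isT).
  by rewrite [`|z - u|]ger0_norm ?[`|v - z|]ger0_norm ?subr_ge0//; lra.
case: (leP a z) => [az|/ltW za]; case: (leP b z) => [bz|/ltW zb].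
- by apply: stein_lipschitz_side; rewrite az bz.
- by rewrite [`|b - a|]ger0_norm ?H//; lra.
- by rewrite distrC [`|b - a|]distrC [`|a - b|]ger0_norm ?H//; lra.
- by apply: stein_lipschitz_side; rewrite za zb orbT.
Qed.

Lemma mul_stein_lipschitz z a b :
  `|b * stein z b - a * stein z a| <= (2 * `|a| + 2) * `|b - a|.
Proof.
have -> : b * stein z b - a * stein z a
  = a * (stein z b - stein z a) + (b - a) * stein z b by ring.
rewrite (le_trans (ler_normD _ _))// !normrM mulrDl lerD//.
  by rewrite mulrAC mulrC ler_wpM2r// stein_lipschitz.
have /andP[f0 f2] := stein_bounds z b.
by rewrite mulrC ler_wpM2r// ger0_norm.
Qed.

Let crossing_bound (y1 y2 d1 d2 e K : R) : `|d1| <= K -> `|d2| <= K -> `|e| <= 1 ->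
  `|y1 * (d2 + e) + y2 * d1| <= (`|y1| + `|y2|) * (K + 1).
Proof.
move=> h1 h2 he; rewrite mulrDl (le_trans (ler_normD _ _))// !normrM.
apply: lerD; apply: ler_wpM2l => //; last by lra.
by rewrite (le_trans (ler_normD _ _))// lerD.
Qed.

(** The derivative of Stein's solution jumps at [z] only, so the error of a
    first-order expansion from [a] is quadratic unless the step crosses [z]. *)
Lemma stein_expansion z a x :
  `|stein z (a + x) - stein z a - x * stein_deriv z a|
    <= `|x| * ((2 * `|a| + 2) * `|x| + ((`|z - a| <= `|x|)%R)%:R).
Proof.
have [P0 P1] := (Phi_ge0 z, Phi_le1 z).
pose H c := c * stein z c.
have HL c : 0 <= (c - a) * (a + x - c) -> `|H c - H a| <= (2 * `|a| + 2) * `|x|.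
  move=> ac; apply: le_trans (mul_stein_lipschitz z a c) _.
  apply: ler_wpM2l; first by have := normr_ge0 a; lra.
  by have := between_dist ac; rewrite [a + x]addrC addrK.
have K0 : 0 <= (2 * `|a| + 2) * `|x| by rewrite mulr_ge0// addr_ge0// mulr_ge0.
have ind0 : 0 <= ((`|z - a| <= `|x|)%R)%:R :> R by [].
case: (leP a z) => [az|za]; case: (leP (a + x) z) => [bz|zb].
- have [c ac ->] := stein_mean_left az bz; rewrite /stein_deriv az /=.
  have -> : (a + x - a) * (c * stein z c + (1 - Phi z)) - x * (a * stein z a + 1 - Phi z)
    = x * (H c - H a) by rewrite /H; ring.
  rewrite normrM; apply: ler_wpM2l => //.
  by apply: (le_trans (HL c ac)); rewrite lerDl.
- have [c1 ac1 e1] := stein_mean_left az (lexx z).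
  have [c2 ac2 e2] := stein_mean_right (lexx z) (ltW zb).
  have x0 : 0 < x by lra.
  have -> : stein z (a + x) - stein z a
    = (stein z (a + x) - stein z z) + (stein z z - stein z a) by ring.
  rewrite e1 e2 /stein_deriv az /=.
  have -> : (`|z - a| <= `|x|)%R = true by apply/idP; rewrite !ger0_norm; lra.
  have /HL : 0 <= (c1 - a) * (a + x - c1).
    by apply/betweenP; move/betweenP: ac1 => [[]|[]] h1 h2; left; lra.
  have /HL : 0 <= (c2 - a) * (a + x - c2).
    by apply/betweenP; move/betweenP: ac2 => [[]|[]] h1 h2; left; lra.
  move=> h2 h1.
  have -> : (a + x - z) * (c2 * stein z c2 - Phi z) + (z - a) * (c1 * stein z c1 + (1 - Phi z)) -
    x * (a * stein z a + 1 - Phi z) = (a + x - z) * (H c2 - H a - 1) + (z - a) * (H c1 - H a).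
    by rewrite /H; ring.
  have xE : `|x| = `|a + x - z| + `|z - a| by rewrite !ger0_norm; lra.
  by rewrite [X in _ <= X * _]xE; apply: crossing_bound; rewrite ?normrN1.
- have [c1 ac1 e1] := stein_mean_right (ltW za) (lexx z).
  have [c2 ac2 e2] := stein_mean_left (lexx z) bz.
  have x0 : x < 0 by lra.
  have -> : stein z (a + x) - stein z a
    = (stein z (a + x) - stein z z) + (stein z z - stein z a) by ring.
  rewrite e1 e2 /stein_deriv (lt_geF za) /=.
  have -> : (`|z - a| <= `|x|)%R = true by apply/idP; rewrite !ler0_norm; lra.
  have /HL : 0 <= (c1 - a) * (a + x - c1).
    by apply/betweenP; move/betweenP: ac1 => [[]|[]] h1 h2; right; lra.
  have /HL : 0 <= (c2 - a) * (a + x - c2).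
    by apply/betweenP; move/betweenP: ac2 => [[]|[]] h1 h2; right; lra.
  move=> h2 h1.
  have -> : (a + x - z) * (c2 * stein z c2 + (1 - Phi z)) + (z - a) * (c1 * stein z c1 - Phi z) -
    x * (a * stein z a + 0 - Phi z) = (a + x - z) * (H c2 - H a + 1) + (z - a) * (H c1 - H a).
    by rewrite /H; ring.
  have xE : `|x| = `|a + x - z| + `|z - a| by rewrite !ler0_norm; lra.
  by rewrite [X in _ <= X * _]xE; apply: crossing_bound; rewrite ?normr1.
- have [c ac ->] := stein_mean_right (ltW za) (ltW zb).
  rewrite /stein_deriv (lt_geF za) /=.
  have -> : (a + x - a) * (c * stein z c - Phi z) - x * (a * stein z a + 0 - Phi z)
    = x * (H c - H a) by rewrite /H; ring.
  rewrite normrM; apply: ler_wpM2l => //.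
  by apply: (le_trans (HL c ac)); rewrite lerDl.
Qed.

Lemma stein_deriv_variation z a x :
  `|stein_deriv z (a + x) - stein_deriv z a|
    <= (2 * `|a| + 2) * `|x| + ((`|z - a| <= `|x|)%R)%:R.
Proof.
have := mul_stein_lipschitz z a (a + x); rewrite [in `|a + x - a|]addrAC subrr add0r.
set K := _ * `|x|; set b := (`|_| <= _)%R => HL.
have -> : stein_deriv z (a + x) - stein_deriv z a =
  ((a + x) * stein z (a + x) - a * stein z a) + (((a + x <= z)%R)%:R - ((a <= z)%R)%:R).
  by rewrite /stein_deriv; ring.
rewrite (le_trans (ler_normD _ _))// lerD// /b.
case: (leP (a + x) z) => h1; case: (leP a z) => h2; rewrite ?subrr ?normr0 ?subr0 ?sub0r ?normrN ?normr1 //.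
  by rewrite ler1n lt0b !ler0_norm; lra.
by rewrite ler1n lt0b !ger0_norm; lra.
Qed.

End SteinEquation.

(** * The Berry-Esseen bound *)

Section BerryEsseen.
Context {R : realType} {I A : finType} (p : I -> A -> R).
Hypothesis p_ge0 : forall i a, 0 <= p i a.
Hypothesis p_sum1 : forall i, \sum_a p i a = 1.
Variable (xi : I -> A -> R).
Hypothesis xi_mean0 : forall i, expect1 p i (xi i) = 0.

Local Notation E := (expect p).
Local Notation E1 := (expect1 p).
Local Notation Phi := (@std_normal_cdf R).
Let var i := E1 i (fun a => xi i a ^+ 2).
Let mom i := E1 i (fun a => trunc_cube (xi i a)).

(** Split according to [|xi i| <= l]. *)
Lemma var_le_trunc i l : 0 < l <= 1 -> var i <= l ^+ 2 + mom i / l.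
Proof.
move=> /andP[l0 l1]; rewrite /mom mulrC -expect1Zl -[l ^+ 2](expect1_cst p_sum1 i).
rewrite -expect1D; apply: ler_expect1 => // a; rewrite /trunc_cube.
rewrite -(real_normK (num_real (xi i a))).
set y := `|_|; have y0 : 0 <= y by exact: normr_ge0.
have [yl|/ltW ly] := leP y l.
  rewrite -[leLHS]addr0 lerD ?lerXn2r ?nnegrE ?(ltW l0)//.
  by rewrite !mulr_ge0 ?invr_ge0 ?(ltW l0) ?sqr_ge0// le_min ler01 y0.
rewrite -[leLHS]add0r lerD ?sqr_ge0// mulrC ler_pdivlMr// ler_wpM2l ?sqr_ge0//.
by rewrite le_min l1 ly.
Qed.

Let mom_ge0 i : 0 <= mom i.
Proof. by apply: expect1_ge0 => // a; apply: trunc_cube_ge0. Qed.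

Let var_ge0 i : 0 <= var i.
Proof. by apply: expect1_ge0 => // a; apply: sqr_ge0. Qed.

Lemma sqr_norm_mean_le i : E1 i (fun a => `|xi i a|) ^+ 2 <= var i.
Proof.
set e := E1 i _; have : 0 <= E1 i (fun a => (`|xi i a| - e) ^+ 2).
  by apply: expect1_ge0 => // a; apply: sqr_ge0.
rewrite (expect1_ext (fun a => xi i a ^+ 2 + e ^+ 2 - 2 * e * `|xi i a|)); last first.
  by move=> a; rewrite -[xi i a ^+ 2](real_normK (num_real _)); ring.
rewrite expect1B expect1D expect1_cst// expect1Zl -/e -/(var i); lra.
Qed.

(** The bound above at [l = e / 2], where [e] is the first absolute moment:
    as [e ^ 2] is at most the variance, the term [l ^ 2] is absorbed. *)
Lemma var_mul_norm_mean_le i : var i <= 1 ->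
  var i * E1 i (fun a => `|xi i a|) <= 3 * mom i.
Proof.
move=> v1; have := sqr_norm_mean_le i; set e := E1 i _ => ev.
have e0 : 0 <= e by apply: expect1_ge0.
have m0 := mom_ge0 i; have v0 := var_ge0 i.
have [e_le0|e_gt0] := leP e 0.
  have -> : e = 0 by apply/le_anti; rewrite e_le0 e0.
  by rewrite mulr0 mulr_ge0.
have := @var_le_trunc i (e / 2); rewrite divr_gt0//= => /(_ ltac:(nra)) h.
have : (e / 2) * var i <= (e / 2) * ((e / 2) ^+ 2 + mom i / (e / 2)).
  by rewrite ler_wpM2l// divr_ge0.
rewrite mulrDr [_ * (mom i / _)]mulrC divfK ?lt0r_neq0 ?divr_gt0//.
nra.
Qed.

Variables (Q : pred I) (z d : R).
Hypothesis var_sum1 : \sum_(i | Q i) var i = 1.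
Hypothesis d_gt0 : 0 < d.
Hypothesis d_small : d <= 100^-1.
Hypothesis mom_le : \sum_(i | Q i) mom i <= d.

Let W (w : {ffun I -> A}) := \sum_(i | Q i) xi i (w i).
Let W_ i (w : {ffun I -> A}) := \sum_(j | Q j && (j != i)) xi j (w j).

Let W_split i w : Q i -> W w = W_ i w + xi i (w i).
Proof. by move=> Qi; rewrite /W (bigD1 i)//= addrC. Qed.

Let W_free i : free_of i (W_ i).
Proof. by apply: free_of_sum; rewrite mem_filter eqxx !andbF. Qed.

Let W_indep i (h : A -> R) (g : R -> R) :
  E (fun w => h (w i) * g (W_ i w)) = E1 i h * E (fun w => g (W_ i w)).
Proof. by apply: expectM_free => // w a; rewrite W_free. Qed.

Let var_le i : Q i -> var i <= 4^-1.
Proof.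
move=> Qi; have := @var_le_trunc i (4^-1); rewrite invr_gt0 ltr0n/= => /(_ ltac:(lra)).
have : mom i <= d.
  by apply: le_trans mom_le; rewrite (bigD1 i)//= lerDl sumr_ge0.
rewrite invrK (_ : 4^-1 ^+ 2 = 16^-1 :> R); last by field.
move: d_small; lra.
Qed.

Let W_norm i : Q i -> E (fun w => `|W_ i w|) <= 1.
Proof.
move=> Qi; apply: ler_expect_norm_sqr => //; rewrite expect_sum_sqr// expr1n.
by rewrite -var_sum1 [leRHS](bigD1 i)//= lerDr.
Qed.

(** With [d] above the sum of the truncated third moments, no single variance
    exceeds one quarter, so at least half of the variance survives both the
    removal of [xi i] and the cut-off in [concentration]. *)
Let W_concentrated i r : Q i -> 0 <= r ->
  E (fun w => ((`|z - W_ i w| <= r)%R)%:R) <= 2 * r + 4 * d.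
Proof.
move=> Qi r0.
rewrite (expect_ext (fun w => ((z - r <= W_ i w <= z + r)%R)%:R)); last first.
  by move=> w; congr (nat_of_bool _)%:R; rewrite distrC ler_distl.
have : \sum_(j | Q j && (j != i)) var j = 1 - var i.
  by rewrite -var_sum1 [in RHS](bigD1 i)//= addrAC subrr add0r.
have vi := var_le Qi => vsum.
have -> : 2 * r + 4 * d = (z + r) - (z - r) + 4 * d by ring.
apply: concentration => //; first by lra.
  by rewrite [leLHS]vsum; have := var_ge0 i; lra.
apply: (@le_trans _ _ (\sum_(j | Q j && (j != i)) (var j - mom j / (4 * d)))).
  rewrite sumrB vsum -mulr_suml.
  have : \sum_(j | Q j && (j != i)) mom j <= d.
    by apply: le_trans mom_le; rewrite [leRHS](bigD1 i)//= lerDr.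
  have d4 : 0 < 4 * d by rewrite mulr_gt0.
  rewrite -(ler_pM2r (_ : 0 < (4 * d)^-1)) ?invr_gt0//.
  have -> : d / (4 * d) = 4^-1 by field; apply: lt0r_neq0.
  lra.
apply: ler_sum => j _; apply: eta_lower => //.
by rewrite d_gt0/=; move: d_small; lra.
Qed.

(** The crossing event has probability of order [|x| + d] given [xi i = x], by
    concentration of the remaining sum; averaging against a weight in [x]. *)
Let crossing i (h : A -> R) : Q i -> (forall a, 0 <= h a) ->
  E (fun w => h (w i) * ((`|z - W_ i w| <= `|xi i (w i)|)%R)%:R)
    <= E1 i (fun a => h a * Num.min 1 (2 * `|xi i a| + 4 * d)).
Proof.
move=> Qi h0; rewrite (expect_resample p_sum1 i).
rewrite (expect_ext (fun w => \sum_a p i a * h a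
   * ((`|z - W_ i w| <= `|xi i a|)%R)%:R)); last first.
  by move=> w; apply: eq_bigr => a _; rewrite update_same W_free mulrA.
rewrite expect_sum; apply: ler_sum => a _.
rewrite expectZl -mulrA ler_wpM2l// ler_wpM2l// le_min W_concentrated// andbT.
rewrite -[leRHS](expect_cst p_sum1); apply: ler_expect => // w.
by rewrite lern1 leq_b1.
Qed.

Local Notation f := (stein z).
Local Notation G := (stein_deriv z).

(** By independence, [xi i] may be paired with the increment of [f] over the
    step [xi i] instead of with [f] itself; expand that increment from [W_ i]. *)
Let increment i : Q i ->
  `|E (fun w => xi i (w i) * f (W w)) - var i * E (fun w => G (W_ i w))|
    <= 8 * mom i + 4 * d * var i.
Proof.
move=> Qi.
have -> : E (fun w => xi i (w i) * f (W w)) - var i * E (fun w => G (W_ i w)) =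
  E (fun w => xi i (w i) * (f (W_ i w + xi i (w i)) - f (W_ i w)
     - xi i (w i) * G (W_ i w))).
  rewrite [RHS](expect_ext (fun w => xi i (w i) * f (W w)
      - xi i (w i) * f (W_ i w) - xi i (w i) ^+ 2 * G (W_ i w))); last first.
    by move=> w; rewrite (W_split w Qi); ring.
  rewrite [RHS]expectB [X in _ = X - _]expectB (W_indep i (xi i) f) xi_mean0 mul0r subr0; congr (_ - _).
  exact/esym/(W_indep i (fun a => xi i a ^+ 2) G).
apply: le_trans (ler_norm_expect p_ge0 _) _.
apply: (@le_trans _ _ (E (fun w => trunc_cube (xi i (w i)) * (2 * `|W_ i w| + 4)
  + xi i (w i) ^+ 2 * ((`|z - W_ i w| <= `|xi i (w i)|)%R)%:R))).
  apply: ler_expect => // w; set x := xi i (w i); set u := W_ i w.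
  rewrite normrM /trunc_cube -(real_normK (num_real x)).
  have h1 := stein_expansion z u x.
  have h2 : `|f (u + x) - f u - x * G u| <= 4 * `|x|.
    rewrite (le_trans (ler_normB _ _))// normrM.
    have := stein_lipschitz z u (u + x); rewrite [u + x]addrC addrK.
    have := norm_stein_deriv_le z u; have := normr_ge0 x; nra.
  have u0 := normr_ge0 u; have x0 := normr_ge0 x.
  rewrite expr2 -!mulrA -mulrDr; apply: ler_wpM2l => //.
  have i0 : 0 <= ((`|z - u| <= `|x|)%R)%:R :> R by [].
  case: (leP 1 `|x|) => x1.
    apply: le_trans h2 _; rewrite mul1r -mulrDr mulrC; apply: ler_wpM2l => //.
    by lra.
  apply: le_trans h1 _; rewrite -mulrDr; apply: ler_wpM2l => //.
  by rewrite lerD2r mulrC; apply: ler_wpM2l => //; lra.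
rewrite expectD.
have -> : E (fun w => trunc_cube (xi i (w i)) * (2 * `|W_ i w| + 4))
    = mom i * (2 * E (fun w => `|W_ i w|) + 4).
  rewrite -expectZl -[X in _ + X](expect_cst p_sum1) -expectD.
  exact: (W_indep i (fun a => trunc_cube (xi i a)) (fun u => 2 * `|u| + 4)).
have := @crossing i (fun a => xi i a ^+ 2) Qi (fun a => sqr_ge0 _).
have : E1 i (fun a => xi i a ^+ 2 * Num.min 1 (2 * `|xi i a| + 4 * d))
   <= 2 * mom i + 4 * d * var i.
  rewrite /mom /var -!expect1Zl -expect1D; apply: ler_expect1 => // a.
  rewrite /trunc_cube mulrCA [4 * d * _]mulrC -mulrDr; apply: ler_wpM2l; first exact: sqr_ge0.
  have := d_gt0; have := normr_ge0 (xi i a).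
  by case: (leP 1 `|xi i a|) => h1 h2 h3; rewrite ge_min; apply/orP; [left|right]; lra.
have := W_norm Qi; have := mom_ge0 i; nra.
Qed.

Let transfer i : Q i ->
  `|var i * E (fun w => G (W_ i w)) - var i * E (fun w => G (W w))|
    <= 18 * mom i + 4 * d * var i.
Proof.
move=> Qi; have v0 := var_ge0 i.
rewrite -mulrBr normrM (ger0_norm v0) -expectB.
have h : `|E (fun w => G (W_ i w) - G (W w))| <= 6 * E1 i (fun a => `|xi i a|) + 4 * d.
  apply: le_trans (ler_norm_expect p_ge0 _) _.
  apply: (@le_trans _ _ (E (fun w => `|xi i (w i)| * (2 * `|W_ i w| + 2)
     + 1 * ((`|z - W_ i w| <= `|xi i (w i)|)%R)%:R))).
    apply: ler_expect => // w; rewrite (W_split w Qi) distrC mul1r mulrC.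
    exact: stein_deriv_variation.
  rewrite expectD.
  have -> : E (fun w => `|xi i (w i)| * (2 * `|W_ i w| + 2))
      = E1 i (fun a => `|xi i a|) * (2 * E (fun w => `|W_ i w|) + 2).
    rewrite -expectZl -[X in _ + X](expect_cst p_sum1) -expectD.
    exact: (W_indep i (fun a => `|xi i a|) (fun u => 2 * `|u| + 2)).
  have := @crossing i (fun=> 1) Qi (fun a => ler01).
  have : E1 i (fun a => 1 * Num.min 1 (2 * `|xi i a| + 4 * d))
     <= 2 * E1 i (fun a => `|xi i a|) + 4 * d.
    rewrite -expect1Zl -[4 * d](expect1_cst p_sum1 i) -expect1D.
    by apply: ler_expect1 => // a; rewrite expect1_cst// mul1r ge_min lexx orbT.
  have : 0 <= E1 i (fun a => `|xi i a|) by apply: expect1_ge0.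
  have := W_norm Qi; nra.
have v1 : var i <= 1 by have := var_le Qi; lra.
have := var_mul_norm_mean_le v1.
have : var i * `|E (fun w => G (W_ i w) - G (W w))| <=
   var i * (6 * E1 i (fun a => `|xi i a|) + 4 * d) by apply: ler_wpM2l.
lra.
Qed.

(** By Stein's equation the left side is [E (G W - W f W)]. Write [G W] as the
    variance-weighted sum of its copies and compare each copy with
    [xi i * f W] through [G (W_ i)]. *)
Lemma berry_esseen_small : `|E (fun w => ((W w <= z)%R)%:R) - Phi z| <= 34 * d.
Proof.
have -> : E (fun w => ((W w <= z)%R)%:R) - Phi z =
  - \sum_(i | Q i) ((E (fun w => xi i (w i) * f (W w)) - var i * E (fun w => G (W_ i w)))
    + (var i * E (fun w => G (W_ i w)) - var i * E (fun w => G (W w)))).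
  rewrite (eq_bigr (fun i => E (fun w => xi i (w i) * f (W w))
    - var i * E (fun w => G (W w)))); last by move=> i _; rewrite addrA subrK.
  rewrite sumrB -mulr_suml var_sum1 mul1r -expect_sum -[Phi z](expect_cst p_sum1).
  rewrite -!expectB -expectN; apply: expect_ext => w.
  by rewrite -mulr_suml -/(W w) /stein_deriv; ring.
rewrite normrN (le_trans (ler_norm_sum _ _ _))//.
apply: (@le_trans _ _ (\sum_(i | Q i) (26 * mom i + 8 * d * var i))).
  apply: ler_sum => i Qi; rewrite (le_trans (ler_normD _ _))//.
  apply: le_trans (lerD (increment Qi) (transfer Qi)) _.
  by rewrite le_eqVlt; apply/orP; left; apply/eqP; ring.
rewrite big_split/= -!mulr_sumr var_sum1; move: mom_le; lra.
Qed.

End BerryEsseen.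

(** * Smoothing by the Bernoulli part *)

Section HalfStep.
Context {R : rcfType}.
Implicit Types (h : int -> R) (j k : int).

Definition half_step h k : R := (h k + h (k + 1)) / 2.
Definition increment h k : R := h (k + 1) - h k.

Lemma iter_half_step_le N h1 h2 k : (forall k, h1 k <= h2 k) ->
  iter N half_step h1 k <= iter N half_step h2 k.
Proof.
move=> h12; elim: N k => [//|N IH] k /=.
by rewrite /half_step; have := IH k; have := IH (k + 1); lra.
Qed.

Lemma iter_half_step_affine N h (c d : R) k :
  iter N half_step (fun i => c * h i + d) k = c * iter N half_step h k + d.
Proof. by elim: N k => [//|N IH] k /=; rewrite /half_step !IH; field. Qed.

(** The second moment of a walk with [N] fair steps. *)
Lemma iter_half_step_square N (c : R) k :
  iter N half_step (fun i => (2 * i%:~R - c) ^+ 2) k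
    = (2 * k%:~R + N%:R - c) ^+ 2 + N%:R.
Proof.
elim: N k => [|N IH] k /=; first by rewrite !addr0.
by rewrite /half_step !IH -natr1 intrD; field.
Qed.

(** Integration by parts for the symmetric binomial law: the linear weight
    [2 i - c] trades one of the [N] averaging steps for a difference. *)
Lemma iter_half_step_weight N h (c : R) k :
  iter N half_step (fun i => (2 * i%:~R - c) * h i) k
    = (2 * k%:~R + N%:R - c) * iter N half_step h k
      + N%:R / 2 * increment (iter N.-1 half_step h) k.
Proof.
elim: N k => [|N IH] k; first by rewrite /= !mul0r !addr0.
rewrite iterS {1}/half_step !IH intrD -[N.+1%:R]natr1 [iter N.+1 _ h]iterS /half_step.
rewrite /increment [N.+1.-1]/=; case: N {IH} => [|N] /=; first by field.
by rewrite /half_step; field.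
Qed.

(** With [c] the mean, integration by parts writes the increment as the
    expectation of [h] against the centred binomial weight [2 B - c], divided by
    half the number of steps; the weight has standard deviation [r], the square
    root of that number. *)
Lemma increment_iter_half_step_le N h k : (forall i, `|h i| <= 1) ->
  `|increment (iter N half_step h) k| <= 2 / Num.sqrt N.+1%:R.
Proof.
move=> h1; set r := Num.sqrt _.
have r0 : 0 < r by rewrite sqrtr_gt0.
have rr : r ^+ 2 = N.+1%:R by rewrite sqr_sqrtr.
pose c : R := 2 * k%:~R + N.+1%:R.
have eqI : r ^+ 2 / 2 * increment (iter N half_step h) k =
   iter N.+1 half_step (fun i => (2 * i%:~R - c) * h i) k.
  by rewrite iter_half_step_weight rr /c subrr mul0r add0r.
have sq : iter N.+1 half_step (fun i => (2 * r)^-1 * (2 * i%:~R - c) ^+ 2 + r / 2) k = r.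
  rewrite (iter_half_step_affine N.+1 (fun i => (2 * i%:~R - c) ^+ 2)) iter_half_step_square.
  by rewrite subrr -rr; field; apply: lt0r_neq0.
have dom i : `|(2 * i%:~R - c) * h i| <= (2 * r)^-1 * (2 * i%:~R - c) ^+ 2 + r / 2.
  set y := _ - c; rewrite normrM.
  apply: (@le_trans _ _ `|y|); first by rewrite ler_piMr.
  rewrite -(real_normK (num_real y)); have := normr_ge0 y; set t := `|y| => t0.
  rewrite -(ler_pM2l (_ : 0 < 2 * r)) ?mulr_gt0// mulrDr mulrA mulfV ?lt0r_neq0 ?mulr_gt0// mul1r.
  by have := sqr_ge0 (t - r); lra.
have up : r ^+ 2 / 2 * increment (iter N half_step h) k <= r.
  rewrite eqI -[leRHS]sq; apply: iter_half_step_le => i.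
  exact: le_trans (ler_norm _) (dom i).
have lo : - r <= r ^+ 2 / 2 * increment (iter N half_step h) k.
  have -> : - r = iter N.+1 half_step (fun i =>
      - 1 * ((2 * r)^-1 * (2 * i%:~R - c) ^+ 2 + r / 2) + 0) k.
    by rewrite iter_half_step_affine sq; ring.
  rewrite eqI; apply: iter_half_step_le => i.
  by have := dom i; rewrite ler_norml => /andP[]; lra.
by rewrite ler_norml ler_pdivlMr// -mulNr ler_pdivrMr//; apply/andP; split; nra.
Qed.

Lemma half_step_increment N h : half_step (increment (iter N half_step h)) =1
  increment (iter N.+1 half_step h).
Proof. by move=> k; rewrite /= /increment /half_step; field. Qed.

End HalfStep.

(** One factor [1 / sqrt] absorbs a coin of weight [t]: by convexity of the
    square, and then [(1 - t) / y + t / (y + 1) <= 1 / (y + t / 2)]. *)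
Lemma inv_sqrt_mixture {R : rcfType} (t y : R) : 0 <= t <= 1 -> 1 <= y ->
  (1 - t) / Num.sqrt y + t / Num.sqrt (y + 1) <= (Num.sqrt (y + t / 2))^-1.
Proof.
move=> /andP[t0 t1] y1.
have y0 : 0 < y by lra.
have yt0 : 0 < y + t / 2 by lra.
have y10 : 0 < y + 1 by lra.
set u := (Num.sqrt y)^-1; set v := (Num.sqrt (y + 1))^-1.
have u0 : 0 <= u by rewrite invr_ge0 sqrtr_ge0.
have v0 : 0 <= v by rewrite invr_ge0 sqrtr_ge0.
have uu : u ^+ 2 = y^-1 by rewrite exprVn sqr_sqrtr// ltW.
have vv : v ^+ 2 = (y + 1)^-1 by rewrite exprVn sqr_sqrtr// ltW.
have s0 : 0 <= (Num.sqrt (y + t / 2))^-1 by rewrite invr_ge0 sqrtr_ge0.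
rewrite -(ler_pXn2r (ltn0Sn 1)) ?nnegrE//; last first.
  by rewrite addr_ge0// mulr_ge0// subr_ge0.
rewrite exprVn (sqr_sqrtr (ltW yt0)).
apply: (@le_trans _ _ ((1 - t) * u ^+ 2 + t * v ^+ 2)).
  have : 0 <= t * (1 - t) * (u - v) ^+ 2 by apply: mulr_ge0 (sqr_ge0 _); apply: mulr_ge0; lra.
  lra.
rewrite uu vv -(ler_pM2r (_ : 0 < y * (y + 1) * (y + t / 2))) ?mulr_gt0//.
have -> : ((1 - t) / y + t / (y + 1)) * (y * (y + 1) * (y + t / 2))
  = ((1 - t) * (y + 1) + t * y) * (y + t / 2) by field; rewrite !lt0r_neq0.
have -> : (y + t / 2)^-1 * (y * (y + 1) * (y + t / 2)) = y * (y + 1).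
  by field; rewrite lt0r_neq0//; lra.
nra.
Qed.

(** The law [q] of [x] dominates the law of [K + eps], scaled to total mass [t],
    where [eps] is a fair coin independent of [K] and [tau] is the law of [K]. *)
Definition has_bernoulli_part {R : realFieldType} {A : finType}
    (q : A -> R) (x : A -> int) (t : R) :=
  exists tau : A -> R, [/\ forall a, 0 <= tau a, \sum_a tau a = t &
    forall h : int -> R, (forall k, 0 <= h k) ->
      \sum_a tau a * ((h (x a) + h (x a + 1)) / 2) <= \sum_a q a * h (x a)].

Section Smoothing.
Context {R : rcfType} {I A : finType} (p : I -> A -> R) (x : I -> A -> int).
Hypothesis p_ge0 : forall i a, 0 <= p i a.
Hypothesis p_sum1 : forall i, \sum_a p i a = 1.

Local Notation E := (expect p).
Local Notation E1 := (expect1 p).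
Implicit Types (s : seq I) (h g : int -> R) (k : int).

Definition shift_expect s h k : R := E (fun w => h (k + \sum_(i <- s) x i (w i))).

Lemma shift_expect_nil h k : shift_expect [::] h k = h k.
Proof.
by rewrite /shift_expect -[RHS](expect_cst p_sum1); apply: expect_ext => w; rewrite big_nil addr0.
Qed.

Lemma shift_expect_cons i s h k : i \notin s ->
  shift_expect (i :: s) h k = E1 i (fun a => shift_expect s h (k + x i a)).
Proof.
move=> is_; rewrite /shift_expect (expect_resample p_sum1 i).
rewrite (expect_ext (fun w => \sum_a p i a * h (k + x i a + \sum_(j <- s) x j (w j)))).
  by rewrite expect_sum; apply: eq_bigr => a _; rewrite expectZl.
move=> w; apply: eq_bigr => a _; rewrite big_cons update_same addrA.
congr (_ * h (_ + _)); apply: eq_big_seq => j js.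
by rewrite update_other//; apply: contraNneq is_ => <-.
Qed.

Lemma shift_expect_ext s h g : h =1 g -> shift_expect s h =1 shift_expect s g.
Proof. by move=> hg k; apply: expect_ext => w; rewrite hg. Qed.

Lemma shift_expect_cat s1 s2 h k : uniq (s1 ++ s2) ->
  shift_expect (s1 ++ s2) h k = shift_expect s1 (shift_expect s2 h) k.
Proof.
elim: s1 k => [|i s1 IH] k /=; first by rewrite shift_expect_nil.
move=> /andP[is12 us]; rewrite !shift_expect_cons//; last first.
  by apply: contra is12; rewrite mem_cat => ->.
by apply: expect1_ext => a; rewrite IH.
Qed.

Lemma shift_expectB s h g k :
  shift_expect s (fun j => h j - g j) k = shift_expect s h k - shift_expect s g k.
Proof. exact: expectB. Qed.

Lemma shift_expectZl s c h k :
  shift_expect s (fun j => c * h j) k = c * shift_expect s h k.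
Proof. exact: expectZl. Qed.

Lemma shift_expect_shift s h k j :
  shift_expect s (fun i => h (i + j)) k = shift_expect s h (k + j).
Proof. by apply: expect_ext => w; rewrite addrAC. Qed.

Lemma shift_expect_norm_le s h k c : (forall j, `|h j| <= c) -> `|shift_expect s h k| <= c.
Proof.
move=> hc; rewrite (le_trans (ler_norm_expect p_ge0 _))//.
by rewrite -[leRHS](expect_cst p_sum1); apply: ler_expect.
Qed.

Variable theta : I -> R.
Hypothesis theta_part : forall i, has_bernoulli_part (p i) (x i) (theta i).

Lemma theta_ge0 i : 0 <= theta i.
Proof. by have [tau [t0 <- _]] := theta_part i; apply: sumr_ge0. Qed.

Lemma theta_le1 i : theta i <= 1.
Proof.
have [tau [t0 <- /(_ (fun=> 1) (fun=> ler01))]] := theta_part i.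
by rewrite -!mulr_suml p_sum1; lra.
Qed.

(** On the Bernoulli part the average of [F] is one of [half_step F]; on the
    rest, of mass [1 - theta i], only the bound on [F] is available. *)
Lemma bernoulli_part_average i (F : int -> R) k (b c : R) :
  (forall j, `|F j| <= b) -> (forall j, `|half_step F j| <= c) ->
  `|E1 i (fun a => F (k + x i a))| <= (1 - theta i) * b + theta i * c.
Proof.
have [tau [tau0 tau1 part]] := theta_part i => Fb Fc.
have H (e : R) : `|e| = 1 -> e * E1 i (fun a => F (k + x i a)) <=
    (1 - theta i) * b + theta i * c.
  move=> e1; have := part (fun j => b - e * F (k + j)).
  have h0 j : 0 <= b - e * F (k + j).
    by rewrite subr_ge0 (le_trans (ler_norm _))// normrM e1 mul1r.
  move=> /(_ h0); rewrite -/(expect1 p i (fun a => b - e * F (k + x i a))).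
  rewrite expect1B expect1_cst// expect1Zl.
  have : \sum_a tau a * (b - c) <= \sum_a tau a *
     ((b - e * F (k + x i a) + (b - e * F (k + (x i a + 1)))) / 2).
    apply: ler_sum => a _; apply: ler_wpM2l => //.
    have : e * half_step F (k + x i a) <= c.
      by rewrite (le_trans (ler_norm _))// normrM e1 mul1r.
    by rewrite /half_step -(addrA k); lra.
  rewrite -mulr_suml tau1; lra.
have := H 1; rewrite normr1 => /(_ erefl).
have := H (- 1); rewrite normrN1 => /(_ erefl).
by rewrite ler_norml => h1 h2; apply/andP; split; lra.
Qed.

(** Each summand contributes, with weight [theta i], one more fair step and
    hence one more averaging of [h]. The number [N] of steps collected so far is
    general to let the induction run. *)
Lemma smoothing s N h k : uniq s -> (forall j, `|h j| <= 1) ->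
  `|shift_expect s (increment (iter N half_step h)) k|
    <= 2 / Num.sqrt (N.+1%:R + (\sum_(i <- s) theta i) / 2).
Proof.
move=> + h1; elim: s N k => [|i s IH] N k /=.
  by rewrite shift_expect_nil big_nil mul0r addr0 => _; apply: increment_iter_half_step_le.
move=> /andP[is_ us]; rewrite shift_expect_cons// big_cons.
set T := \sum_(j <- s) theta j.
have T0 : 0 <= T by apply: sumr_ge0 => j _; apply: theta_ge0.
pose F := shift_expect s (increment (iter N half_step h)).
have F2 j : half_step F j = shift_expect s (increment (iter N.+1 half_step h)) j.
  rewrite -(shift_expect_ext s (half_step_increment N h)) /half_step /F.
  rewrite -shift_expect_shift /shift_expect mulrC -expectD -expectZl.
  by apply: expect_ext => w; rewrite mulrC.
apply: le_trans (bernoulli_part_average i k (F := F) (fun j => IH N j us) (c :=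
    2 / Num.sqrt (N.+2%:R + T / 2)) _) _.
  by move=> j; rewrite F2; apply: IH.
have := @inv_sqrt_mixture _ (theta i) (N.+1%:R + T / 2).
rewrite theta_ge0 theta_le1 => /(_ isT).
have N1 : 1 <= N.+1%:R :> R by rewrite ler1n.
have -> : N.+1%:R + T / 2 + 1 = N.+2%:R + T / 2 by rewrite -[N.+2%:R]natr1; ring.
have -> : N.+1%:R + T / 2 + theta i / 2 = N.+1%:R + (theta i + T) / 2 by field.
by move=> /(_ ltac:(lra)); lra.
Qed.

End Smoothing.

(** * The heat kernel *)

Definition gauss_pdf {R : realType} (v y : R) : R :=
  expR (- (y ^+ 2 / (2 * v))) / Num.sqrt (2 * pi * v).

Section HeatKernel.
Context {R : realType}.
Implicit Types (t y v r : R).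

Local Notation root2pi := (Num.sqrt (2 * pi : R)).

Let root2pi_ge1 : 1 <= root2pi.
Proof. by have /andP[] := @root2pi_bounds R. Qed.

Let root2pi_gt0 : 0 < root2pi.
Proof. by rewrite (lt_le_trans ltr01). Qed.

Lemma gauss_pdfE v y : 0 < v ->
  gauss_pdf v y = bell (y / Num.sqrt v) / (root2pi * Num.sqrt v).
Proof.
move=> v0; rewrite /gauss_pdf /bell sqrtrM ?mulr_ge0 ?pi_ge0//.
congr (expR (- _) / _); rewrite exprMn exprVn sqr_sqrtr ?(ltW v0)//.
by field; apply: lt0r_neq0.
Qed.

(** Expanding at the centre of the interval cancels the terms of even order. *)
Lemma gauss_pdf_midpoint v y : 0 < v ->
  `|std_normal_cdf ((y + 2^-1) / Num.sqrt v) - std_normal_cdf ((y - 2^-1) / Num.sqrt v)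
    - gauss_pdf v y| <= (Num.sqrt v ^+ 3)^-1.
Proof.
move=> v0; rewrite gauss_pdfE//; set r := Num.sqrt v.
have r0 : 0 < r by rewrite sqrtr_gt0.
have T u := @taylor3 R std_normal_cdf (fun t => bell t / root2pi)
  (fun t => - t * bell t / root2pi) (fun t => (t ^+ 2 - 1) * bell t / root2pi) (y / r) u 3
  (@is_derive_Phi R).
have div_derive (f : R -> R) df t : is_derive t 1 f df ->
    is_derive t 1 (fun t => f t / root2pi) (df / root2pi).
  move=> h; apply: is_derive_to (is_derive_mul h (is_derive_const root2pi^-1 t)) _.
  by rewrite mulr0 addr0.
have {}T u := T u (fun t => div_derive _ _ _ (is_derive_bell t))
   (fun t => div_derive _ _ _ (is_derive_bell1 t)).
have b3 t : `|(t ^+ 2 - 1) * bell t / root2pi| <= 3.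
  rewrite normrM (le_trans _ (bell2_le t))// ler_piMr//.
  by rewrite ger0_norm ?invr_ge0 ?(ltW root2pi_gt0)// invf_le1.
have := T ((y + 2^-1) / r) b3; have := T ((y - 2^-1) / r) b3.
have -> : (y + 2^-1) / r - y / r = (2 * r)^-1 by field; apply: lt0r_neq0.
have -> : (y - 2^-1) / r - y / r = - (2 * r)^-1 by field; apply: lt0r_neq0.
rewrite normrN (ger0_norm (_ : 0 <= (2 * r)^-1)) ?invr_ge0 ?mulr_ge0 ?(ltW r0)//.
have -> : 3 * (2 * r)^-1 ^+ 3 = 3 / 8 * (r ^+ 3)^-1 by field; apply: lt0r_neq0.
have -> : bell (y / r) / (root2pi * r) = 2 * (bell (y / r) / root2pi * (2 * r)^-1).
  by field; rewrite !lt0r_neq0.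
have : 0 <= (r ^+ 3)^-1 by rewrite invr_ge0 exprn_ge0// ltW.
rewrite sqrrN !ler_norml => h0 /andP[h1 h2] /andP[h3 h4].
by apply/andP; split; lra.
Qed.

Let sqr_mul_expRN_le4 (q : R) : 0 <= q -> q ^+ 2 * expR (- q) <= 4.
Proof.
move=> q0; have h := @expRN_mul_le1 _ (q / 2); have {}h := h (divr_ge0 q0 (ler0n _ 2)).
have -> : q ^+ 2 * expR (- q) = 4 * (q / 2 * expR (- (q / 2))) ^+ 2.
  rewrite exprMn -expRM_natr; have -> : - (q / 2) * 2 = - q by field.
  by field.
have : 0 <= q / 2 * expR (- (q / 2)) by rewrite mulr_ge0 ?divr_ge0 ?expR_ge0.
nra.
Qed.

(** The Gaussian kernel of variance [r], up to a constant; writing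
    [r ^ (- 1 / 2)] as an exponential makes it differentiable in [r] by the chain
    rule alone. *)
Let heat t r := expR (- (ln r / 2) - t ^+ 2 / 2 * r^-1).
Let heat1 t r := heat t r * (- (2 * r)^-1 + t ^+ 2 / 2 * (r^-1) ^+ 2).
Let heat2 t r := heat t r * ((- (2 * r)^-1 + t ^+ 2 / 2 * (r^-1) ^+ 2) ^+ 2
   + (r^-1) ^+ 2 / 2 - t ^+ 2 * (r^-1) ^+ 3).

Let is_derive_inv r : 0 < r -> is_derive r 1 (fun r => r^-1) (- (r^-1) ^+ 2).
Proof.
move=> r0; have := @is_deriveV R id r 1 1 (lt0r_neq0 r0) (is_derive_var r).
by move=> h; apply: is_derive_to h _; rewrite /GRing.scale/= mulr1 -exprVn.
Qed.

Let is_derive_heat t r : 0 < r -> is_derive r 1 (heat t) (heat1 t r).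
Proof.
move=> r0; apply: is_derive_to (is_derive_exp (is_derive_sub
  (is_derive_opp (is_derive_mul (is_derive1_ln r0) (is_derive_const 2^-1 r)))
  (is_derive_mul (is_derive_const (t ^+ 2 / 2) r) (is_derive_inv r0)))) _.
by rewrite /heat1 /heat; field; apply: lt0r_neq0.
Qed.

Let is_derive_heat1 t r : 0 < r -> is_derive r 1 (heat1 t) (heat2 t r).
Proof.
move=> r0; have hi := is_derive_inv r0.
rewrite (_ : heat1 t = fun r => heat t r *
    (- (2^-1) * r^-1 + t ^+ 2 / 2 * (r^-1 * r^-1))); last first.
  by apply/funext => u; rewrite /heat1 invfM mulNr.
apply: is_derive_to (is_derive_mul (is_derive_heat t r0) (is_derive_add
  (is_derive_mul (is_derive_const (- 2^-1) r) hi)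
  (is_derive_mul (is_derive_const (t ^+ 2 / 2) r) (is_derive_mul hi hi)))) _.
by rewrite /heat2 /heat1; field; apply: lt0r_neq0.
Qed.

Let heat2_le t r : 1 <= r -> `|heat2 t r| <= 8.
Proof.
move=> r1; have r0 : 0 < r by lra.
pose q := t ^+ 2 / 2 * r^-1.
have i0 : 0 < r^-1 by rewrite invr_gt0.
have i1 : r^-1 <= 1 by rewrite invf_le1.
have q0 : 0 <= q by rewrite mulr_ge0 ?divr_ge0 ?sqr_ge0// ltW.
have -> : heat2 t r = heat t r * (r^-1) ^+ 2 * (q ^+ 2 - 3 * q + 3 / 4).
  by rewrite /heat2 /q; field; apply: lt0r_neq0.
have h0 : 0 < heat t r by exact: expR_gt0.
have hq : heat t r <= expR (- q).
  by rewrite ler_expR /q; have := ln_ge0 r1; lra.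
have e0 := expR_gt0 (- q).
have e1 : expR (- q) <= 1 by rewrite expR_le1; lra.
have e2 := expRN_mul_le1 q0.
have e3 := sqr_mul_expRN_le4 q0.
have ii : 0 <= (r^-1) ^+ 2 <= 1 by rewrite sqr_ge0 expr_le1 ?i1// ltW.
rewrite normrM ger0_norm; last by rewrite mulr_ge0 ?(ltW h0)//; case/andP: ii.
apply: (@le_trans _ _ (expR (- q) * (q ^+ 2 + 3 * q + 1))); last by lra.
apply: ler_pM => //.
- by rewrite mulr_ge0 ?(ltW h0)//; case/andP: ii.
- apply: le_trans hq; rewrite ler_piMr ?(ltW h0)//; by case/andP: ii.
by have := sqr_ge0 q; rewrite ler_norml => ?; apply/andP; split; lra.
Qed.

Let heat_at1 t : heat t 1 = bell t.
Proof. by rewrite /heat ln1 mul0r oppr0 sub0r invr1 mulr1. Qed.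

(** The heat equation: the first-order term is half the second derivative of
    [bell], which cancels the second-order term of [bell_expansion]. *)
Lemma heat_expansion t s : 0 <= s ->
  `|heat t (1 + s) - bell t - s / 2 * ((t ^+ 2 - 1) * bell t)| <= 8 * s ^+ 2.
Proof.
move=> s0; have hr y : 0 <= (y - 1) * (1 + s - y) -> 1 <= y.
  by move=> /betweenP[[]|[]]; lra.
have := @taylor2 R (heat t) (heat1 t) (heat2 t) 1 (1 + s) 8.
have -> : 1 + s - 1 = s by ring.
have -> : s / 2 * ((t ^+ 2 - 1) * bell t) = heat1 t 1 * s.
  by rewrite /heat1 heat_at1 invr1; field.
rewrite heat_at1 (ger0_norm s0); apply.
- by move=> y /hr y1; apply: is_derive_heat; lra.
- by move=> y /hr y1; apply: is_derive_heat1; lra.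
- by move=> y /hr; apply: heat2_le.
Qed.

Lemma gauss_pdf_heat v s y : 0 < v -> 0 <= s ->
  gauss_pdf (v + v * s) y = heat (y / Num.sqrt v) (1 + s) / (root2pi * Num.sqrt v).
Proof.
move=> v0 s0; have s1 : 0 < 1 + s by lra.
have -> : v + v * s = v * (1 + s) by ring.
have inv_sqrt : expR (- (ln (1 + s) / 2)) = (Num.sqrt (1 + s))^-1.
  have e0 : 0 <= expR (ln (1 + s) / 2) by exact: expR_ge0.
  rewrite expRN; congr (_^-1); rewrite -[LHS](ger0_norm e0) -sqrtr_sqr -expRM_natr.
  by rewrite divfK// lnK.
have -> : heat (y / Num.sqrt v) (1 + s)
    = expR (- (y ^+ 2 / (2 * (v * (1 + s))))) / Num.sqrt (1 + s).
  rewrite /heat expRD inv_sqrt mulrC; congr (expR _ * _).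
  rewrite exprMn exprVn sqr_sqrtr ?(ltW v0)//.
  by field; rewrite !lt0r_neq0.
have pi2 : 0 <= 2 * pi :> R by rewrite mulr_ge0 ?pi_ge0.
have s2 : Num.sqrt (2 * pi * (v * (1 + s))) = root2pi * Num.sqrt v * Num.sqrt (1 + s).
  by rewrite mulrA (sqrtrM _ (mulr_ge0 pi2 (ltW v0))) (sqrtrM _ pi2).
by rewrite /gauss_pdf s2; set e := expR _; rewrite !invfM; ring.
Qed.

Lemma bell_expansion t Y :
  `|bell (t - Y) - bell t - t * bell t * Y - (t ^+ 2 - 1) * bell t / 2 * Y ^+ 2|
    <= 15 * trunc_cube Y.
Proof.
have h3 := @taylor3 R bell _ _ _ t (t - Y) 15 (@is_derive_bell R) (@is_derive_bell1 R)
  (@is_derive_bell2 R) (@bell3_le R).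
have h2 := @taylor2 R bell _ _ t (t - Y) 3 (fun y _ => is_derive_bell y)
  (fun y _ => is_derive_bell1 y) (fun y _ => bell2_le y).
move: h2 h3; rewrite [t - Y - t]addrAC subrr add0r sqrrN !mulrN normrN mulNr mulNr opprK.
have b := bell2_le t.
rewrite /trunc_cube -[Y ^+ 2](real_normK (num_real Y)); set z := `|Y|.
have z0 : 0 <= z by exact: normr_ge0.
case: (leP 1 z) => z1 h2 h3; last by rewrite -exprSr.
rewrite mulr1; apply: le_trans (ler_normB _ _) _.
have : `|(t ^+ 2 - 1) * bell t / 2 * z ^+ 2| <= 3 / 2 * z ^+ 2.
  rewrite normrM [`|z ^+ 2|]ger0_norm ?sqr_ge0// ler_wpM2r ?sqr_ge0//.
  by rewrite normrM [`|2^-1|]ger0_norm// ler_wpM2r.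
have := sqr_ge0 z; lra.
Qed.

End HeatKernel.

(** * Lindeberg's replacement *)

Section Lindeberg.
Context {R : realType} {I A : finType} (p : I -> A -> R) (x : I -> A -> int).
Hypothesis p_ge0 : forall i a, 0 <= p i a.
Hypothesis p_sum1 : forall i, \sum_a p i a = 1.

Local Notation E1 := (expect1 p).
Local Notation root2pi := (Num.sqrt (2 * pi : R)).

Definition mean i : R := E1 i (fun a => (x i a)%:~R).
Definition variance i : R := E1 i (fun a => ((x i a)%:~R - mean i) ^+ 2).
Definition scaled_moment (B : R) i : R :=
  E1 i (fun a => trunc_cube (((x i a)%:~R - mean i) / B)).

Lemma centered_mean0 i B : E1 i (fun a => ((x i a)%:~R - mean i) / B) = 0.
Proof.
rewrite (expect1_ext (fun a => B^-1 * ((x i a)%:~R - mean i))); last first.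
  by move=> a; rewrite mulrC.
by rewrite expect1Zl expect1B expect1_cst// subrr mulr0.
Qed.

Lemma centered_variance i B :
  E1 i (fun a => (((x i a)%:~R - mean i) / B) ^+ 2) = variance i / B ^+ 2.
Proof.
rewrite (expect1_ext (fun a => (B ^+ 2)^-1 * ((x i a)%:~R - mean i) ^+ 2)); last first.
  by move=> a; rewrite exprMn exprVn mulrC.
by rewrite expect1Zl mulrC.
Qed.

Lemma variance_ge0 i : 0 <= variance i.
Proof. by apply: expect1_ge0 => // a; apply: sqr_ge0. Qed.

Lemma scaled_moment_ge0 B i : 0 <= scaled_moment B i.
Proof. by apply: expect1_ge0 => // a; apply: trunc_cube_ge0. Qed.

Lemma le_scaled_moment B B' i : 0 < B <= B' -> scaled_moment B' i <= scaled_moment B i.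
Proof.
move=> /andP[B0 BB']; apply: ler_expect1 => // a; apply: le_trunc_cube.
rewrite !normrM ler_wpM2l// !ger0_norm ?invr_ge0 ?(ltW B0) ?(le_trans (ltW B0))//.
by rewrite lef_pV2 ?posrE// (lt_le_trans B0).
Qed.

(** After rescaling to variance one, the expansions of the kernel in space and
    in time agree up to second order: the linear term has mean zero and the
    quadratic one has mean [s / 2] times the second derivative. The remainder
    [s ^ 2] is again controlled by the truncated third moment. *)
Lemma lindeberg_step i v y : 0 < v -> variance i <= v ->
  `|E1 i (fun a => gauss_pdf v (y - (x i a)%:~R)) - gauss_pdf (v + variance i) (y - mean i)|
    <= 40 / Num.sqrt v * scaled_moment (Num.sqrt v) i.
Proof.
move=> v0 var_v; set r := Num.sqrt v; have r0 : 0 < r by rewrite sqrtr_gt0.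
have rr : r ^+ 2 = v by rewrite sqr_sqrtr// ltW.
have /andP[c1 _] := @root2pi_bounds R.
have c0 : 0 < root2pi by rewrite (lt_le_trans ltr01).
pose t := (y - mean i) / r; pose Y a := ((x i a)%:~R - mean i) / r.
pose s := variance i / v; pose m := scaled_moment r i.
have s0 : 0 <= s by rewrite divr_ge0 ?variance_ge0// ltW.
have s1 : s <= 1 by rewrite ler_pdivrMr// mul1r.
have m0 : 0 <= m by exact: scaled_moment_ge0.
have Y0 : E1 i Y = 0 by exact: centered_mean0.
have Y2 : E1 i (fun a => Y a ^+ 2) = s by rewrite centered_variance rr.
have s_m : s ^+ 2 <= 3 * m.
  have [->|/eqP sn0] := eqVneq s 0; first by rewrite expr0n mulr_ge0.
  have sp : 0 < s by rewrite lt0r s0 andbT; apply/eqP.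
  have := @var_le_trunc R I A p p_ge0 p_sum1 (fun i a => ((x i a)%:~R - mean i) / r) i (s / 2).
  have s2 : 0 < s / 2 by lra.
  have s2' : 0 < s / 2 <= 1 by lra.
  move=> /(_ s2'); rewrite -/Y Y2 -/(scaled_moment r i) -/m => h.
  have : (s / 2) * s <= (s / 2) * ((s / 2) ^+ 2 + m / (s / 2)).
    by rewrite ler_wpM2l// ltW.
  rewrite mulrDr [_ * (m / _)]mulrC divfK ?(lt0r_neq0 s2)//.
  have : 0 <= s ^+ 2 * (1 - s) by rewrite mulr_ge0 ?sqr_ge0// subr_ge0.
  lra.
have vs : v * s = variance i by rewrite /s mulrC divfK ?lt0r_neq0.
rewrite -vs.
rewrite gauss_pdf_heat// -/r -/t.
have -> : E1 i (fun a => gauss_pdf v (y - (x i a)%:~R))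
   = (root2pi * r)^-1 * E1 i (fun a => bell (t - Y a)).
  rewrite -expect1Zl; apply: expect1_ext => a; rewrite gauss_pdfE// mulrC.
  by congr (_ * bell _); rewrite /t /Y -/r; ring.
rewrite [_ / (root2pi * r)]mulrC -mulrBr normrM ger0_norm; last first.
  by rewrite invr_ge0 ltW// mulr_gt0.
have -> : 40 / r * scaled_moment r i = r^-1 * (40 * m) by rewrite -/m; ring.
apply: ler_pM => //; first by rewrite invr_ge0 ltW// mulr_gt0.
  by rewrite lef_pV2 ?posrE ?mulr_gt0// ler_pMl.
set H := expR _; have hh : `|H - bell t - s / 2 * ((t ^+ 2 - 1) * bell t)| <= 8 * s ^+ 2.
  exact: heat_expansion.
have hb : `|E1 i (fun a => bell (t - Y a)) - bell t - s / 2 * ((t ^+ 2 - 1) * bell t)|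
    <= 15 * m.
  rewrite /m /scaled_moment -expect1Zl; apply: le_trans (ler_expect1 p_ge0 i
     (fun a => bell_expansion t (Y a))); apply: le_trans (ler_norm_expect1 p_ge0 i _).
  rewrite le_eqVlt; apply/orP; left; apply/eqP; congr `|_|.
  rewrite 3!expect1B expect1_cst// expect1Zl expect1Zl Y0 Y2; ring.
move: hh hb; rewrite !ler_norml => /andP[h1 h2] /andP[h3 h4].
by apply/andP; split; lra.
Qed.

(** Each summand is absorbed into the Gaussian kernel at the price of one
    Lindeberg step; the kernel only gets wider, so every step costs no more than
    at the initial width. *)
Lemma lindeberg (s : seq I) v y k : uniq s -> 0 < v ->
  (forall i, i \in s -> variance i <= v) ->
  `|shift_expect p x s (fun j => gauss_pdf v (y - j%:~R)) k
     - gauss_pdf (v + \sum_(i <- s) variance i) (y - k%:~R - \sum_(i <- s) mean i)|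
    <= 40 / Num.sqrt v * \sum_(i <- s) scaled_moment (Num.sqrt v) i.
Proof.
move=> + v0; elim: s k => [|i s IH] k us vs.
  by rewrite shift_expect_nil// !big_nil addr0 subr0 subrr normr0 mulr0.
move: us => /= /andP[is_ us]; rewrite shift_expect_cons// !big_cons.
have {}IH k' := IH k' us (fun j js => vs j (mem_behead (s := i :: s) js)).
set V := \sum_(j <- s) variance j; set M := \sum_(j <- s) mean j.
have V0 : 0 <= V by apply: sumr_ge0 => j _; apply: variance_ge0.
have vi : variance i <= v by apply: vs; rewrite mem_head.
pose mid := E1 i (fun a => gauss_pdf (v + V) (y - k%:~R - M - (x i a)%:~R)).
have step : `|mid - gauss_pdf (v + V + variance i) (y - k%:~R - M - mean i)|
     <= 40 / Num.sqrt v * scaled_moment (Num.sqrt v) i.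
  have vV : v <= v + V by rewrite lerDl.
  apply: le_trans (lindeberg_step _ _ _) _; [by lra|by lra|].
  have r0 : 0 < Num.sqrt v by rewrite sqrtr_gt0.
  have rr : Num.sqrt v <= Num.sqrt (v + V) by rewrite ler_wsqrtr.
  have r0' := lt_le_trans r0 rr.
  apply: ler_pM; rewrite ?scaled_moment_ge0 ?divr_ge0 ?(ltW r0')//.
    by rewrite ler_wpM2l// lef_pV2.
  by apply: le_scaled_moment; rewrite r0.
have ih : `|E1 i (fun a => shift_expect p x s (fun j => gauss_pdf v (y - j%:~R)) (k + x i a))
     - mid| <= 40 / Num.sqrt v * \sum_(j <- s) scaled_moment (Num.sqrt v) j.
  rewrite -expect1B (le_trans (ler_norm_expect1 p_ge0 _ _))//.
  rewrite -[leRHS](expect1_cst p_sum1 i); apply: ler_expect1 => // a.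
  have := IH (k + x i a); rewrite intrD.
  by have -> : y - (k%:~R + (x i a)%:~R) - M = y - k%:~R - M - (x i a)%:~R by ring.
have -> : v + (variance i + V) = v + V + variance i by ring.
have -> : y - k%:~R - (mean i + M) = y - k%:~R - M - mean i by ring.
rewrite [leRHS]mulrDr [leRHS]addrC; apply: le_trans (lerD ih step).
set e := E1 i _; set g := gauss_pdf _ _.
have -> : e - g = (e - mid) + (mid - g) by ring.
exact: ler_normD.
Qed.

End Lindeberg.

(** * Local limit theorem for finitely supported lattice laws *)

Lemma prefix_sum_between {R : realFieldType} {T : Type} (f : T -> R) (s : seq T) (c : R) :
  (forall i, 0 <= f i <= 1) -> -1 <= c -> c <= \sum_(i <- s) f i ->
  exists s1 s2, s = s1 ++ s2 /\ c <= \sum_(i <- s1) f i <= c + 1.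
Proof.
move=> f01; elim: s c => [|i s IH] c c1 cs.
  by exists [::], [::]; rewrite cs big_nil; split=> //; lra.
have [c0|c0] := leP c 0.
  by exists [::], (i :: s); rewrite big_nil c0; split=> //=; lra.
have /andP[f0 f1] := f01 i.
have [||s1 [s2 [-> h]]] := IH (c - f i).
- by lra.
- by move: cs; rewrite big_cons; lra.
by exists (i :: s1), s2; split=> //; rewrite big_cons; lra.
Qed.

Section BlockEstimates.
Context {R : realType} {I A : finType} (p : I -> A -> R) (x : I -> A -> int).
Hypothesis p_ge0 : forall i a, 0 <= p i a.
Hypothesis p_sum1 : forall i, \sum_a p i a = 1.
Variable theta : I -> R.
Hypothesis theta_part : forall i, has_bernoulli_part (p i) (x i) (theta i).

Local Notation E := (expect p).
Local Notation E1 := (expect1 p).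
Local Notation mu := (mean p x).
Local Notation var := (variance p x).
Local Notation mom := (scaled_moment p x).
Local Notation Phi := (@std_normal_cdf R).

Let th_ge0 := theta_ge0 theta_part.
Let th_le1 := theta_le1 p_sum1 theta_part.
Let m_ge0 := scaled_moment_ge0 x p_ge0.

(** A fair coin has variance one quarter wherever it is centred. *)
Lemma theta_le_variance i : theta i / 4 <= var i.
Proof.
have [tau [tau0 tau1 part]] := theta_part i.
apply: le_trans (part (fun k => (k%:~R - mu i) ^+ 2) (fun k => sqr_ge0 _)).
rewrite -tau1 mulr_suml; apply: ler_sum => a _; apply: ler_wpM2l => //.
rewrite intrD; set y : R := (x i a)%:~R - mu i.
have -> : (x i a)%:~R + 1 - mu i = y + 1 by rewrite /y; ring.
by have := sqr_ge0 (y + 2^-1); lra.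
Qed.

Lemma smoothing_scaled (s : seq I) h k (c : R) : uniq s -> (forall j, `|h j| <= c) ->
  `|shift_expect p x s (increment h) k|
    <= c * (2 / Num.sqrt (1 + (\sum_(i <- s) theta i) / 2)).
Proof.
move=> us hc; have c0 : 0 <= c by apply: le_trans (hc 0).
have [c_0|cn0] := eqVneq c 0.
  rewrite c_0 mul0r (le_trans (shift_expect_norm_le x p_ge0 p_sum1 _ _ (c := 0) _))//.
  have h0 j : h j = 0 by apply/eqP; rewrite -normr_le0 -c_0.
  by move=> j; rewrite /increment !h0 subrr normr0.
have cp : 0 < c by rewrite lt0r cn0.
have h1 j : `|c^-1 * h j| <= 1.
  by rewrite normrM ger0_norm ?invr_ge0// mulrC ler_pdivrMr// mul1r.
have := smoothing p_sum1 theta_part 0 (h := fun j => c^-1 * h j) k us h1.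
have -> : shift_expect p x s (increment (iter 0 half_step (fun j => c^-1 * h j))) k
   = c^-1 * shift_expect p x s (increment h) k.
  by rewrite -shift_expectZl; apply: shift_expect_ext => j; rewrite /increment/= mulrBr.
by rewrite normrM [`|c^-1|]ger0_norm ?invr_ge0// mulrC ler_pdivrMr// mulrC.
Qed.

Lemma berry_esseen (s : seq I) (B z : R) : uniq s -> 0 < B ->
  B ^+ 2 = \sum_(i <- s) var i ->
  `|E (fun w => ((\sum_(i <- s) (x i (w i))%:~R <= z)%R)%:R)
    - Phi ((z - \sum_(i <- s) mu i) / B)| <= 100 * \sum_(i <- s) mom B i.
Proof.
move=> us B0 BV; pose xi i a := ((x i a)%:~R - mu i) / B : R.
pose y := (z - \sum_(i <- s) mu i) / B.
pose m := \sum_(i <- s) mom B i.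
have m0 : 0 <= m by apply: sumr_ge0 => i _; apply: m_ge0.
rewrite -/y -/m; set P := E _.
have P0 : 0 <= P by apply: expect_ge0.
have P1 : P <= 1.
  rewrite -[leRHS](expect_cst p_sum1); apply: ler_expect => // w.
  by rewrite lern1 leq_b1.
have [F0 F1] := (Phi_ge0 y, Phi_le1 y).
apply/ler_addgt0Pr => e e0.
have [d1|d1] := leP (m + e / 100) (100^-1); last first.
  by rewrite ler_norml; apply/andP; split; lra.
have := @berry_esseen_small R I A p p_ge0 p_sum1 xi _ [in s] y (m + e / 100) _ _ d1.
have -> : P = E (fun w => ((\sum_(i in s) xi i (w i) <= y)%R)%:R).
  apply: expect_ext => w; congr (nat_of_bool _)%:R.
  by rewrite -big_uniq// -mulr_suml sumrB /y ler_pM2r ?invr_gt0// lerD2r.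
move=> h; apply: le_trans (h _ _ _ _) _; last by lra.
- by move=> i; apply: centered_mean0.
- rewrite -big_uniq// (eq_bigr (fun i => var i / B ^+ 2)); last first.
    by move=> i _; apply: centered_variance.
  by rewrite -mulr_suml -BV mulfV// expf_neq0// lt0r_neq0.
- by apply: ltr_wpDl => //; lra.
by rewrite -big_uniq// -/m lerDl; lra.
Qed.

(** A prefix of the indices collects between one and two thirds of [theta],
    as no single [theta i] exceeds one. Of the two blocks the one with the larger
    variance becomes [s1]. *)
Lemma split_indices : 3 <= \sum_i theta i ->
  exists s1 s2 : seq I, [/\ perm_eq (s2 ++ s1) (enum I),
    (\sum_i theta i) / 3 <= \sum_(i <- s2) theta i &
    (\sum_i var i) / 2 <= \sum_(i <- s1) var i].
Proof.
set T := \sum_i theta i => T3.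
have [|||s1 [s2 [es /andP[h1 h2]]]] := @prefix_sum_between R I theta (enum I) (T / 3).
- by move=> i; rewrite th_ge0 th_le1.
- by lra.
- by rewrite big_enum/= -/T; lra.
have sum_th : T = \sum_(i <- s1) theta i + \sum_(i <- s2) theta i.
  by rewrite -big_cat -es big_enum.
have sum_v : \sum_i var i = \sum_(i <- s1) var i + \sum_(i <- s2) var i.
  by rewrite -big_cat -es big_enum.
have [v12|v12] := leP (\sum_(i <- s2) var i) (\sum_(i <- s1) var i).
  by exists s1, s2; split; [rewrite es perm_catC|lra|lra].
by exists s2, s1; split; [rewrite es|lra|lra].
Qed.

Local Notation T := (\sum_i theta i).
Local Notation V := (\sum_i var i).

Let P k0 := E (fun w => ((\sum_i x i (w i) == k0)%R)%:R).

Let theta_le_V : T / 4 <= V.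
Proof. by rewrite mulr_suml; apply: ler_sum => i _; apply: theta_le_variance. Qed.

(** A bounded [theta] leaves nothing to prove: both terms are bounded, the
    density because the variance is at least [T / 4]. *)
Lemma llt_small_theta k0 y : 0 < T <= 3 ->
  `|P k0 - gauss_pdf V y| <= 12 / Num.sqrt T ^+ 3.
Proof.
move=> /andP[T0 T3]; set r := Num.sqrt T.
have r0 : 0 < r by rewrite sqrtr_gt0.
have rr : r ^+ 2 = T by rewrite sqr_sqrtr// ltW.
have V0 : 0 < V by have := theta_le_V; lra.
have P0 : 0 <= P k0 by apply: expect_ge0.
have P1 : P k0 <= 1.
  rewrite -[leRHS](expect_cst p_sum1); apply: ler_expect => // w.
  by rewrite lern1 leq_b1.
have B0 : 0 < Num.sqrt V by rewrite sqrtr_gt0.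
have BB : Num.sqrt V ^+ 2 = V by rewrite sqr_sqrtr// ltW.
have rB : r <= 2 * Num.sqrt V by have := theta_le_V; nra.
have /andP[c1 _] := @root2pi_bounds R.
have g0 : 0 <= gauss_pdf V y by rewrite divr_ge0 ?expR_ge0 ?sqrtr_ge0.
have g1 : gauss_pdf V y <= 2 / r.
  rewrite gauss_pdfE// ler_pdivrMr ?mulr_gt0 ?(lt_le_trans ltr01 c1)//.
  have h : 1 <= 2 / r * Num.sqrt V by rewrite mulrAC ler_pdivlMr// mul1r.
  by apply: le_trans (bell_le1 _) _; rewrite mulrCA; nra.
have r3 : 1 <= 6 / r ^+ 3.
  rewrite ler_pdivlMr ?exprn_gt0// mul1r exprSr rr; nra.
have -> : 12 / r ^+ 3 = 6 / r ^+ 3 + 6 / r ^+ 3 by field; apply: lt0r_neq0.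
have g2 : 2 / r <= 6 / r ^+ 3.
  have -> : 2 / r = 2 * r ^+ 2 / r ^+ 3 by field; apply: lt0r_neq0.
  by rewrite ler_pM2r ?invr_gt0 ?exprn_gt0// rr; lra.
by rewrite ler_norml; apply/andP; split; lra.
Qed.

End BlockEstimates.

Section LatticeLLT.
Context {R : realType} {I A : finType} (p : I -> A -> R) (x : I -> A -> int).
Hypothesis p_ge0 : forall i a, 0 <= p i a.
Hypothesis p_sum1 : forall i, \sum_a p i a = 1.
Variable theta : I -> R.
Hypothesis theta_part : forall i, has_bernoulli_part (p i) (x i) (theta i).

Local Notation E := (expect p).
Local Notation E1 := (expect1 p).
Local Notation mu := (mean p x).
Local Notation var := (variance p x).
Local Notation mom := (scaled_moment p x).
Local Notation Phi := (@std_normal_cdf R).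
Local Notation T := (\sum_i theta i).
Local Notation V := (\sum_i var i).
Local Notation M := (\sum_i mu i).

(** Here [h1 k] is the distribution function of the first block at [k0 - k] and
    [h2] its Gaussian approximation, evaluated halfway between lattice points.
    The three error terms come from smoothing [h1 - h2], from replacing the
    increments of [h2] by a density, and from absorbing the second block. *)
Lemma llt_split (s1 s2 : seq I) k0 (B : R) : perm_eq (s2 ++ s1) (enum I) ->
  0 < B -> B ^+ 2 = \sum_(i <- s1) var i ->
  \sum_(i <- s2) var i <= \sum_(i <- s1) var i ->
  `|E (fun w => ((\sum_i x i (w i) == k0)%R)%:R) - gauss_pdf V (k0%:~R - M)|
    <= 100 * (\sum_(i <- s1) mom B i)
         * (2 / Num.sqrt (1 + (\sum_(i <- s2) theta i) / 2))
       + (B ^+ 3)^-1 + 40 / B * \sum_(i <- s2) mom B i.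
Proof.
move=> perm B0 BV V21.
have u12 : uniq (s2 ++ s1) by rewrite (perm_uniq perm) enum_uniq.
have [u2 u1] : uniq s2 /\ uniq s1 by move: u12; rewrite cat_uniq => /and3P[].
set V1 := \sum_(i <- s1) var i; pose M1 := \sum_(i <- s1) mu i.
have V10 : 0 < V1 by rewrite /V1 -BV exprn_gt0.
have BE : Num.sqrt V1 = B by rewrite /V1 -BV sqrtr_sqr gtr0_norm.
pose h1 k : R := shift_expect p x s1 (fun j => ((j <= k0)%R)%:R) k.
pose h2 (k : int) : R := Phi ((k0%:~R - k%:~R + 2^-1 - M1) / B).
have PE : E (fun w => ((\sum_i x i (w i) == k0)%R)%:R)
    = - shift_expect p x s2 (increment h1) 0.
  have -> : E (fun w => ((\sum_i x i (w i) == k0)%R)%:R)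
     = shift_expect p x (s2 ++ s1) (fun j => ((j == k0)%R)%:R) 0.
    apply: expect_ext => w; rewrite add0r; congr (nat_of_bool (_ == _))%:R.
    by rewrite (perm_big _ perm)/= big_enum.
  rewrite shift_expect_cat// -mulN1r -shift_expectZl.
  apply: shift_expect_ext => k; rewrite /increment /h1.
  rewrite -shift_expect_shift -shift_expectB -shift_expectZl.
  apply: shift_expect_ext => j; rewrite mulN1r opprB -[j + 1 <= k0]/(j + 1 <= k0).
  by rewrite lezD1 lt_neqAle; case: eqP => [->|_] /=; rewrite ?lexx ?subr0 ?subrr.
(* At the half-integer the event [S <= k0 - j] of the integer sum [S] is
   unchanged, while the increment of [h2] becomes a symmetric difference. *)
have h12 j : `|h1 j - h2 j| <= 100 * \sum_(i <- s1) mom B i.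
  have := @berry_esseen _ _ _ p x p_ge0 p_sum1 s1 B (k0%:~R - j%:~R + 2^-1) u1 B0 BV.
  rewrite -/M1 -/(h2 j); set a := E _; suff -> : a = h1 j by [].
  apply: expect_ext => w; congr (nat_of_bool _)%:R.
  rewrite -(rmorph_sum (intmul 1)) -lerBlDr.
  set S := \sum_(i <- s1) _; apply/idP/idP => [h|].
    rewrite -ltzD1 -(ltr_int R) !intrD; have -> : (1 : int)%:~R = 1 :> R by [].
    by lra.
  by rewrite -(ler_int R) intrD; lra.
have h2_inc k : `|- increment h2 k - gauss_pdf V1 (k0%:~R - M1 - k%:~R)| <= (B ^+ 3)^-1.
  have := @gauss_pdf_midpoint R V1 (k0%:~R - M1 - k%:~R) V10.
  rewrite BE opprB /increment /h2 intrD.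
  have -> : k0%:~R - M1 - k%:~R + 2^-1 = k0%:~R - k%:~R + 2^-1 - M1 by ring.
  have -> : k0%:~R - M1 - k%:~R - 2^-1 = k0%:~R - (k%:~R + 1%:~R) + 2^-1 - M1.
    by rewrite (_ : 1%:~R = 1 :> R)//; field.
  by [].
have := @lindeberg _ _ _ p x p_ge0 p_sum1 s2 V1 (k0%:~R - M1) 0 u2 V10.
have -> : V1 + \sum_(i <- s2) var i = V.
  by rewrite addrC /V1 -big_cat (perm_big _ perm) big_enum.
have -> : k0%:~R - M1 - 0%:~R - \sum_(i <- s2) mu i = k0%:~R - M.
  have -> : M = \sum_(i <- s2) mu i + M1.
    by rewrite -big_cat (perm_big _ perm) big_enum.
  by rewrite (_ : 0%:~R = 0 :> R)//; ring.
rewrite BE; set g := shift_expect _ _ _ (fun=> gauss_pdf _ _) _ => hL.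
have {}hL : `|g - gauss_pdf V (k0%:~R - M)| <= 40 / B * \sum_(i <- s2) mom B i.
  apply: hL => i i2; apply: le_trans V21.
  by rewrite (big_rem i)//= lerDl sumr_ge0// => j _; apply: variance_ge0.
have hS := smoothing_scaled p_ge0 p_sum1 theta_part 0 u2 h12.
have hM : `|- shift_expect p x s2 (increment h2) 0 - g| <= (B ^+ 3)^-1.
  rewrite /g -mulN1r -shift_expectZl -shift_expectB.
  by apply: shift_expect_norm_le => // j; rewrite mulN1r.
have PS : E (fun w => ((\sum_i x i (w i) == k0)%R)%:R) =
   - shift_expect p x s2 (increment (fun j => h1 j - h2 j)) 0
   - shift_expect p x s2 (increment h2) 0.
  rewrite PE -opprD; congr (- _).
  rewrite -[RHS]opprK -[X in _ = - X]opprK.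
  have -> : shift_expect p x s2 (increment (fun j => h1 j - h2 j)) 0
    = shift_expect p x s2 (increment h1) 0 - shift_expect p x s2 (increment h2) 0.
    by rewrite -shift_expectB; apply: shift_expect_ext => j; rewrite /increment; ring.
  by ring.
move: hS hM hL; rewrite PS !ler_norml => /andP[a1 a2] /andP[b1 b2] /andP[c1 c2].
by apply/andP; split; lra.
Qed.

Theorem lattice_llt k0 : 0 < T ->
  `|E (fun w => ((\sum_i x i (w i) == k0)%R)%:R) - gauss_pdf V (k0%:~R - M)|
    <= 6000 * ((\sum_i mom (Num.sqrt V) i) / Num.sqrt T + (Num.sqrt T ^+ 3)^-1).
Proof.
move=> T0; set r := Num.sqrt T; set g := \sum_i mom _ i.
have r0 : 0 < r by rewrite sqrtr_gt0.
have rr : r ^+ 2 = T by rewrite sqr_sqrtr// ltW.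
have g0 : 0 <= g by apply: sumr_ge0 => i _; apply: scaled_moment_ge0.
have gr0 : 0 <= g / r by rewrite divr_ge0// ltW.
have r30 : 0 <= (r ^+ 3)^-1 by rewrite invr_ge0 exprn_ge0// ltW.
have [T3|T3] := leP T 3.
  apply: le_trans (llt_small_theta p_ge0 p_sum1 theta_part _ _ _) _; first by rewrite T0.
  by rewrite -/r; lra.
have [s1 [s2 [perm th2 v1]]] := split_indices p_sum1 theta_part (ltW T3).
have V_T : T / 4 <= V.
  by rewrite mulr_suml; apply: ler_sum => i _; apply: theta_le_variance.
have V0 : 0 < V by lra.
have sum_v : V = \sum_(i <- s2) var i + \sum_(i <- s1) var i.
  by rewrite -big_cat (perm_big _ perm) big_enum.
set V1 := \sum_(i <- s1) var i in v1 sum_v *.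
have V10 : 0 < V1 by lra.
pose B := Num.sqrt V1.
have B0 : 0 < B by rewrite sqrtr_gt0.
have BV : B ^+ 2 = V1 by rewrite sqr_sqrtr// ltW.
have Vs : Num.sqrt V ^+ 2 = V by rewrite sqr_sqrtr// ltW.
have Vs0 : 0 < Num.sqrt V by rewrite sqrtr_gt0.
have BVs : Num.sqrt V <= 2 * B by nra.
have rB : r <= 3 * B by nra.
apply: le_trans (llt_split k0 perm B0 BV _) _; first by rewrite -/V1; lra.
have mom8 i : mom B i <= 8 * mom (Num.sqrt V) i.
  rewrite /scaled_moment -expect1Zl; apply: ler_expect1 => // a.
  set y := (x i a)%:~R - _.
  apply: (@le_trans _ _ (trunc_cube (2 * (y / Num.sqrt V)))); last first.
    by apply: le_trans (trunc_cubeZ _ _) _; [lra|rewrite ler_wpM2r ?trunc_cube_ge0//; lra].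
  apply: le_trunc_cube; rewrite mulrCA !normrM ler_wpM2l//.
  rewrite !ger0_norm ?divr_ge0 ?invr_ge0 ?(ltW B0) ?(ltW Vs0)//.
  by rewrite ler_pdivlMr// mulrC ler_pdivrMr.
have sum_mom : \sum_(i <- s1) mom B i + \sum_(i <- s2) mom B i <= 8 * g.
  rewrite addrC -big_cat (perm_big _ perm) big_enum/= mulr_sumr.
  by apply: ler_sum.
set m1 := \sum_(i <- s1) _ in sum_mom *; set m2 := \sum_(i <- s2) _ in sum_mom *.
have m10 : 0 <= m1 by apply: sumr_ge0 => i _; apply: scaled_moment_ge0.
have m20 : 0 <= m2 by apply: sumr_ge0 => i _; apply: scaled_moment_ge0.
set t := 1 + _ / 2.
have tT : T / 9 <= t by rewrite /t; lra.
have t0 : 0 < Num.sqrt t by rewrite sqrtr_gt0; lra.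
have tt : Num.sqrt t ^+ 2 = t by rewrite sqr_sqrtr//; lra.
have rt : r <= 3 * Num.sqrt t by nra.
have i1 : 2 / Num.sqrt t <= 6 / r.
  by rewrite ler_pdivrMr// mulrAC ler_pdivlMr//; lra.
have i2 : 40 / B <= 120 / r.
  by rewrite ler_pdivrMr// mulrAC ler_pdivlMr//; lra.
have i3 : (B ^+ 3)^-1 <= 27 / r ^+ 3.
  rewrite ler_pdivlMr ?exprn_gt0// mulrC ler_pdivrMr ?exprn_gt0//.
  have -> : 27 * B ^+ 3 = (3 * B) ^+ 3 by ring.
  by rewrite lerXn2r ?nnegrE ?mulr_ge0 ?(ltW r0) ?(ltW B0).
have j1 : 100 * m1 * (2 / Num.sqrt t) <= 600 * (m1 / r).
  have -> : 600 * (m1 / r) = 100 * m1 * (6 / r) by ring.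
  by rewrite ler_wpM2l// mulr_ge0.
have j2 : 40 / B * m2 <= 120 * (m2 / r).
  have -> : 120 * (m2 / r) = 120 / r * m2 by ring.
  by rewrite ler_wpM2r.
have : m1 / r + m2 / r <= 8 * (g / r).
  by rewrite -mulrDl mulrA ler_wpM2r// invr_ge0 ltW.
have : 0 <= m1 / r by rewrite divr_ge0// ltW.
have : 0 <= m2 / r by rewrite divr_ge0// ltW.
lra.
Qed.

(** A substitute for Jensen's inequality, as [trunc_cube] is not convex. With
    [h] half of [|m|], values below [h] contribute at most [h] to the mean, and
    above [h] the ratio of [trunc_cube] to the identity is at least [l]. *)
Lemma trunc_cube_mean (q : A -> R) (f : A -> R) : (forall a, 0 <= q a) ->
  \sum_a q a = 1 ->
  trunc_cube (\sum_a q a * f a) <= 8 * \sum_a q a * trunc_cube (f a).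
Proof.
move=> q0 q1; set m := \sum_a _; set D := \sum_a _ * trunc_cube _.
have D0 : 0 <= D by apply: sumr_ge0 => a _; rewrite mulr_ge0 ?trunc_cube_ge0.
have [->|mn0] := eqVneq m 0; first by rewrite /trunc_cube expr0n mul0r mulr_ge0.
pose h : R := `|m| / 2.
have h0 : 0 < h by rewrite divr_gt0// normr_gt0.
(* [l] is the ratio of [trunc_cube] to the identity at [h]. *)
pose l : R := h * Num.min 1 h.
have l0 : 0 < l by rewrite mulr_gt0// lt_min ltr01 h0.
have mark a : `|f a| <= h + trunc_cube (f a) / l.
  have [fh|/ltW hf] := leP `|f a| h.
    by rewrite -[leLHS]addr0 lerD// divr_ge0 ?trunc_cube_ge0// ltW.
  rewrite -[leLHS]add0r lerD ?(ltW h0)// ler_pdivlMr// /trunc_cube /l.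
  rewrite -(real_normK (num_real (f a))) expr2 -[leRHS]mulrA; apply: ler_wpM2l => //.
  rewrite ler_pM ?(ltW h0)//; first by rewrite le_min ler01 (ltW h0).
  by rewrite le_min !ge_min lexx hf orbT.
have : 2 * h <= h + D / l.
  have -> : 2 * h = `|m| by rewrite mulrC divfK.
  apply: le_trans (ler_norm_sum _ _ _) _.
  apply: (@le_trans _ _ (\sum_a (q a * h + q a * trunc_cube (f a) / l))).
    apply: ler_sum => a _; rewrite normrM (ger0_norm (q0 a)) -mulrA -mulrDr.
    exact: ler_wpM2l.
  by rewrite big_split/= -!mulr_suml q1 mul1r.
have -> : trunc_cube m = trunc_cube (2 * h).
  by rewrite -trunc_cube_norm; congr trunc_cube; rewrite mulrC divfK.
move=> hD; apply: le_trans (trunc_cubeZ _ _) _; first by lra.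
have -> : 2 ^+ 3 = 8 :> R by ring.
rewrite ler_wpM2l// /trunc_cube gtr0_norm// expr2 -mulrA -/l.
by rewrite -ler_pdivlMr//; lra.
Qed.

Lemma scaled_moment_recenter i (B c : R) :
  mom B i <= 72 * E1 i (fun a => trunc_cube (((x i a)%:~R - c) / B)).
Proof.
pose f a := ((x i a)%:~R - c) / B.
change (mom B i <= 72 * E1 i (fun a => trunc_cube (f a))).
set D := E1 i _.
have mE : E1 i f = (mu i - c) / B.
  rewrite (expect1_ext (fun a => B^-1 * ((x i a)%:~R - c))); last first.
    by move=> a; rewrite mulrC.
  by rewrite expect1Zl expect1B expect1_cst// mulrC.
have h := trunc_cube_mean f (p_ge0 i) (p_sum1 i).
rewrite -/(expect1 p i f) mE -/(expect1 p i (fun a => trunc_cube (f a))) -/D in h.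
apply: (@le_trans _ _ (E1 i (fun a => 8 * trunc_cube (f a) + 8 * trunc_cube ((mu i - c) / B)))).
  apply: ler_expect1 => // a; rewrite -mulrDr -[X in _ <= 8 * (_ + X)]trunc_cube_norm.
  rewrite -normrN trunc_cube_norm.
  have -> : ((x i a)%:~R - mu i) / B = f a + - ((mu i - c) / B) by rewrite /f; ring.
  exact: trunc_cubeD.
rewrite expect1D expect1Zl expect1_cst// -/D; lra.
Qed.

End LatticeLLT.

(** * Truncation to finitely many lattice points *)

Section FiniteValued.
Context {d : measure_display} {T : measurableType d} {R : realType}
  (P : probability T R) {F : finType} (W : T -> F).
Hypothesis measurable_W : forall a, measurable (W @^-1` [set a]).

Lemma finite_valued_measurable (f : F -> R) : measurable_fun setT (f \o W).
Proof.
move=> _ B mB; rewrite setTI.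
rewrite (_ : _ @^-1` _ = \bigcup_(a in [set a | B (f a)]) W @^-1` [set a]).
  by apply: fin_bigcup_measurable => //; exact: finite_finset.
apply/seteqP; split => [w Bw|w [a Ba /= e]]; last by rewrite /= e.
by exists (W w).
Qed.

Lemma finite_valued_integral (f : F -> R) :
  (\int[P]_w (f (W w))%:E)%E = (\sum_a fine (P (W @^-1` [set a])) * f a)%:E.
Proof.
rewrite (eq_integral (fun w => \sum_a ((f a)%:E * (\1_(W @^-1` [set a]) w)%:E)%E)%E).
  rewrite integral_sum//; last first.
    by move=> a; apply: integrableZl => //; apply: integrable_indic.
  rewrite -sumEFin; apply: eq_bigr => a _.
  rewrite integralZl//; last exact: integrable_indic.
  rewrite integral_indic// setIT mulrC EFinM fineK//.
  exact: fin_num_measure.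
move=> w _; rewrite (bigD1 (W w))//= big1 ?adde0.
  by rewrite indicE mem_set// mule1.
move=> a aW; rewrite indicE memNset ?mule0//= => e.
by move: aW; rewrite e eqxx.
Qed.

End FiniteValued.

Section LatticeIndex.
Context {R : realType} (v0 D : R).
Hypothesis D_gt0 : 0 < D.
Implicit Types (M : nat) (y : R) (k : int).

Definition cell M (a : 'I_(2 * M).+1) : int := a%:Z - M%:Z.

(** The index of [v0], which also receives all values off the window. *)
Definition center M : 'I_(2 * M).+1 := inord M.

Definition cell_index M y : 'I_(2 * M).+1 :=
  odflt (center M) [pick a | y == lattice_point v0 D (cell a)].

Lemma cell_center M : cell (center M) = 0.
Proof. by rewrite /cell inordK ?subrr//; lia. Qed.

Lemma cell_inj M : injective (@cell M).
Proof. by move=> a b; rewrite /cell => ab; apply: val_inj => /=; lia. Qed.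

Lemma lattice_point_inj : injective (lattice_point v0 D).
Proof.
move=> j k /addrI /(mulfI (lt0r_neq0 D_gt0)) /eqP.
by rewrite eqr_int => /eqP.
Qed.

Lemma cell_surj M k : `|k| <= M%:Z -> exists a : 'I_(2 * M).+1, cell a = k.
Proof.
move=> kM; have h : (absz (k + M%:Z)%R < (2 * M).+1)%N by lia.
by exists (Ordinal h); rewrite /cell /=; lia.
Qed.

Lemma cell_indexP M y : (y = lattice_point v0 D (cell (cell_index M y)))
  \/ cell_index M y = center M.
Proof. by rewrite /cell_index; case: pickP => [a /eqP|_]; [left|right]. Qed.

Lemma cell_index_point M (a : 'I_(2 * M).+1) :
  cell_index M (lattice_point v0 D (cell a)) = a.
Proof.
rewrite /cell_index; case: pickP => [b /eqP /lattice_point_inj/cell_inj //|].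
by move=> /(_ a); rewrite eqxx.
Qed.

Lemma cell_index_lattice M k : `|k| <= M%:Z ->
  cell (cell_index M (lattice_point v0 D k)) = k.
Proof. by move=> /cell_surj[a <-]; rewrite cell_index_point. Qed.

(** Truncation sends a value to itself or to [v0], so it never increases the
    distance to [v0]; this gives dominating functions independent of [M]. *)
Lemma cell_index_norm_le M y : `|(cell (cell_index M y))%:~R| <= `|(y - v0) / D|.
Proof.
have [yE|->] := cell_indexP M y; last by rewrite cell_center normr0.
rewrite [in leRHS]yE /lattice_point addrAC subrr add0r mulrAC mulfV ?mul1r//.
exact: lt0r_neq0.
Qed.

(** Every fibre is finite or has a finite complement. *)
Lemma measurable_cell_index M a : measurable [set y | cell_index M y = a].
Proof.
pose L : set R := [set lattice_point v0 D (cell b) | b in [set: 'I_(2 * M).+1]].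
have finL : finite_set L by apply: finite_image; exact: finite_finset.
have mfin (A : set R) : finite_set A -> measurable A.
  by move=> fA; apply: countable_measurable; [exact: measurable_set1|exact: finite_set_countable].
have outL y : ~ L y -> cell_index M y = center M.
  move=> nL; have [yE|//] := cell_indexP M y; exfalso; apply: nL.
  by exists (cell_index M y).
have -> : [set y | cell_index M y = a] = ([set y | cell_index M y = a] `&` L)
    `|` (if a == center M then ~` L else set0).
  apply/seteqP; split => [y /= ya|y [[] //|]].
    have [Ly|nL] := pselect (L y); [by left|right].
    by rewrite -ya outL// eqxx.
  by case: eqP => // -> nL; apply: outL.
apply: measurableU; first by apply: mfin; apply: finite_setIr.
by case: eqP => // _; apply: measurableC; apply: mfin.
Qed.

Lemma measurable_lattice : measurable (lattice v0 D).
Proof.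
have -> : lattice v0 D = \bigcup_k [set lattice_point v0 D k].
  by apply/seteqP; split => [_ [k _ <-]|y [k _ ->]]; exists k.
by apply: countable_bigcupT_measurable => //; exact: countableP.
Qed.

End LatticeIndex.

Section Truncation.
Context {d : measure_display} {T : measurableType d} {R : realType}
  (P : probability T R) {n : nat} (X : 'I_n -> {RV P >-> R}) (v0 D : R).
Hypothesis D_gt0 : 0 < D.
Hypothesis X_indep : mutually_independent X.
Hypothesis X_lattice : forall j, P (X j @^-1` lattice v0 D) = 1%E.

Definition trunc_law M (j : 'I_n) (a : 'I_(2 * M).+1) : R :=
  fine (P (X j @^-1` [set y | cell_index v0 D M y = a])).

Definition trunc_vec M (w : T) : {ffun 'I_n -> 'I_(2 * M).+1} :=
  [ffun j => cell_index v0 D M (X j w)].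

Let measurable_event M j a :
  measurable (X j @^-1` [set y | cell_index v0 D M y = a]).
Proof.
by rewrite -[_ @^-1` _]setTI; apply: measurable_funPT => //; exact: measurable_cell_index.
Qed.

Lemma trunc_law_ge0 M j a : 0 <= @trunc_law M j a.
Proof. exact: fine_ge0. Qed.

Lemma trunc_law_sum1 M j : \sum_a @trunc_law M j a = 1.
Proof.
have := finite_valued_integral P (@measurable_event M j) (fun=> 1).
rewrite integral_cst//= probability_setT mul1e => -[->].
by apply: eq_bigr => a _; rewrite mulr1.
Qed.

Let trunc_vec_preimage M w : trunc_vec M @^-1` [set w] =
  \bigcap_(j in [set` [set: 'I_n]%SET]) (X j @^-1` [set y | cell_index v0 D M y = w j]).
Proof.
apply/seteqP; split => [t /= <- j _ /=|t tw /=]; first by rewrite ffunE.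
by apply/ffunP => j; rewrite ffunE; apply: (tw j); rewrite /= finset.in_setT.
Qed.

Let measurable_trunc_vec M w : measurable (trunc_vec M @^-1` [set w]).
Proof.
by rewrite trunc_vec_preimage; apply: fin_bigcap_measurable => //.
Qed.

Lemma integral_trunc_vec M (f : {ffun 'I_n -> 'I_(2 * M).+1} -> R) :
  (\int[P]_w (f (trunc_vec M w))%:E)%E = (expect (@trunc_law M) f)%:E.
Proof.
rewrite (finite_valued_integral P (@measurable_trunc_vec M)); congr (_%:E).
apply: eq_bigr => w _; rewrite trunc_vec_preimage X_indep; last first.
  by move=> j; exact: measurable_cell_index.
by congr (_ * _); apply: eq_bigl => j; rewrite finset.in_setT.
Qed.

(** At almost every outcome all the values lie in the lattice, so truncation
    leaves them unchanged once [M] is large; dominated convergence applies. *)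
Lemma cvg_expect_trunc (F : ('I_n -> R) -> R) (g : T -> R) :
  measurable_fun setT (fun w => F (fun j => (X j w - v0) / D)) ->
  P.-integrable setT (EFin \o g) ->
  (forall M w, `|F (fun j => (cell (cell_index v0 D M (X j w)))%:~R)| <= g w) ->
  expect (@trunc_law M) (fun w => F (fun j => (cell (w j))%:~R)) @[M --> \oo]
    --> fine (\int[P]_w (F (fun j => (X j w - v0) / D))%:E)%E.
Proof.
move=> mF ig Fg.
pose f_ M w := (F (fun j => (cell (cell_index v0 D M (X j w)))%:~R))%:E.
have f_E M : (\int[P]_w f_ M w)%E
    = (expect (@trunc_law M) (fun w => F (fun j => (cell (w j))%:~R)))%:E.
  rewrite -integral_trunc_vec; apply: eq_integral => w _; congr (F _)%:E.
  by apply/funext => j; rewrite ffunE.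
have [|||||iF _ cF] := @dominated_convergence _ T R P setT measurableT f_
   (fun w => (F (fun j => (X j w - v0) / D))%:E) (EFin \o g).
- move=> M; apply/measurable_EFinP.
  rewrite (_ : (fun _ => _) = (fun w => F (fun j => (cell (w j))%:~R)) \o trunc_vec M).
    exact: (finite_valued_measurable (@measurable_trunc_vec M)
      (fun w => F (fun j => (cell (w j))%:~R))).
  by apply/funext => w /=; congr F; apply/funext => j; rewrite ffunE.
- exact/measurable_EFinP.
- have aeL : \forall w \ae P, forall j, lattice v0 D (X j w).
    apply: filter_forall => j; exists (~` (X j @^-1` lattice v0 D)); split.
    + apply: measurableC; rewrite -[_ @^-1` _]setTI.
      by apply: measurable_funPT => //; exact: measurable_lattice.
    + rewrite probability_setC ?X_lattice ?subee//.
      rewrite -[_ @^-1` _]setTI.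
      by apply: measurable_funPT => //; exact: measurable_lattice.
    + by [].
  near=> w => _; apply: cvg_near_cst; have : forall j, lattice v0 D (X j w) by near: w.
  move=> Lw; have {Lw} [k kE] : exists k : 'I_n -> int, forall j, X j w = lattice_point v0 D (k j).
    by exists (fun j => s2val (cid2 (Lw j))) => j; rewrite (s2valP' (cid2 (Lw j))).
  exists (\max_j absz (k j))%N => // M /= leM; congr (F _)%:E.
  apply/funext => j; rewrite kE cell_index_lattice//.
    rewrite /lattice_point addrAC subrr add0r mulrAC mulfV ?mul1r//.
    exact: lt0r_neq0.
  have : (absz (k j) <= M)%N by apply: leq_trans leM; apply: leq_bigmax.
  by lia.
- by [].
- by apply: aeW => w M _; rewrite lee_fin.
have I_fin : (\int[P]_w (F (fun j => (X j w - v0) / D))%:E)%E \is a fin_num.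
  exact: integrable_fin_num.
move: cF; rewrite -(fineK I_fin) (_ : (fun _ => _) = fun M => (expect (@trunc_law M)
   (fun w => F (fun j => (cell (w j))%:~R)))%:E); last by apply/funext => M; exact: f_E.
by move=> /fine_cvg.
Unshelve. all: by end_near. Qed.

End Truncation.

(** * The Bernoulli part of a truncated law *)

Lemma sum_le_window {R : realFieldType} (f : int -> R) (s : seq int) M :
  (forall k, 0 <= f k) -> uniq s -> (forall k, k \in s -> `|k| < M%:Z) ->
  \sum_(k <- s) f k <= \sum_(i < 2 * M) f (i%:Z - M%:Z).
Proof.
move=> f0 us sM.
pose w := [seq i%:Z - M%:Z | i <- iota 0 (2 * M)].
have -> : \sum_(i < 2 * M) f (i%:Z - M%:Z) = \sum_(k <- w) f k.
  by rewrite /w big_map -(big_mkord xpredT (fun i => f (i%:Z - M%:Z))) /index_iota subn0.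
have uw : uniq w by rewrite map_inj_uniq ?iota_uniq// => i j; lia.
have ps : perm_eq s [seq k <- w | k \in s].
  apply: uniq_perm; rewrite ?filter_uniq// => k; rewrite mem_filter.
  case: (boolP (k \in s)) => //= ks; apply/esym/mapP.
  by exists (absz (k + M%:Z)%R); [rewrite mem_iota; have := sM k ks; lia|have := sM k ks; lia].
rewrite (perm_big _ ps) big_filter big_mkcond; apply: ler_sum => k _.
by case: ifP.
Qed.

Section BernoulliPart.
Context {d : measure_display} {T : measurableType d} {R : realType}
  (P : probability T R) {n : nat} (X : 'I_n -> {RV P >-> R}) (v0 D : R).
Hypothesis D_gt0 : 0 < D.

Lemma pmf_le_trunc_law M j (a : 'I_(2 * M).+1) :
  pmf (X j) (lattice_point v0 D (cell a)) <= trunc_law X v0 D j a.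
Proof.
have m1 : measurable (X j @^-1` [set lattice_point v0 D (cell a)]).
  by rewrite -[_ @^-1` _]setTI; apply: measurable_funPT => //; exact: measurable_set1.
have m2 : measurable (X j @^-1` [set y | cell_index v0 D M y = a]).
  by rewrite -[_ @^-1` _]setTI; apply: measurable_funPT => //; exact: measurable_cell_index.
apply: fine_le; rewrite ?fin_num_measure//; apply: le_measure; rewrite ?inE//.
by move=> w /= ->; apply: cell_index_point.
Qed.

(** Finitely many terms of the series defining [vartheta] already exceed
    [t / 2], and they lie in the window for large [M]. The minimum of two
    neighbouring masses can be spent on both points because each point is used by
    two neighbours, each time for one half. *)
Lemma trunc_bernoulli_part j (t : R) : 0 < t -> (t%:E <= vartheta v0 D (X j))%E ->
  \forall M \near \oo, has_bernoulli_part (@trunc_law _ _ _ _ _ X v0 D M j) (@cell M) (t / 2).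
Proof.
move=> t0 t_le.
pose q k := pmf (X j) (lattice_point v0 D k).
pose tau k := Num.min (q k) (q (k + 1)).
have q0 k : 0 <= q k by exact: pmf_ge0.
have tau0 k : 0 <= tau k by rewrite le_min !q0.
have [s [us t_s]] : exists s : seq int, uniq s /\ t / 2 < \sum_(k <- s) tau k.
  have : ((t / 2)%:E < vartheta v0 D (X j))%E.
    by apply: lt_le_trans t_le; rewrite lte_fin; lra.
  move=> /ereal_sup_gt[_ [B [finB _] <-]].
  rewrite fsbig_finite//= sumEFin lte_fin => h.
  by exists (finmap.enum_fset (fset_set B)); split=> //; exact: finmap.fset_uniq.
exists (\max_(k <- s) absz k).+1%N => // M /= leM.
have sM k : k \in s -> `|k| < M%:Z.
  move=> ks; have : (absz k <= \max_(k <- s) absz k)%N by apply: leq_bigmax_seq.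
  lia.
set S := \sum_(i < 2 * M) tau (i%:Z - M%:Z).
have S_t : t / 2 < S by apply: lt_le_trans t_s (sum_le_window tau0 us sM).
have S0 : 0 < S by lra.
pose c := t / 2 / S.
have c0 : 0 <= c by rewrite divr_ge0//; lra.
have c1 : c <= 1 by rewrite ler_pdivrMr// mul1r ltW.
(* The last point of the window has no right neighbour in it, and the factor
   [c] lowers the total mass from [S] to exactly [t / 2]. *)
exists (fun a : 'I_(2 * M).+1 => if (a < 2 * M)%N then c * tau (cell a) else 0).
have recr (f : int -> R) : \sum_(a < (2 * M).+1)
    (if (a < 2 * M)%N then f (a%:Z - M%:Z) else 0) = \sum_(i < 2 * M) f (i%:Z - M%:Z).
  rewrite big_ord_recr/= ltnn addr0; apply: eq_bigr => i _.
  by rewrite ltn_ord.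
split=> [a||h h0].
- by case: ifP => // _; rewrite mulr_ge0.
- rewrite (recr (fun k => c * tau k)) -mulr_sumr -/S /c divfK//.
  exact: lt0r_neq0.
apply: (@le_trans _ _ (\sum_(a < (2 * M).+1) q (cell a) * h (cell a))); last first.
  by apply: ler_sum => a _; rewrite ler_wpM2r// pmf_le_trunc_law.
rewrite (eq_bigr (fun a : 'I_(2 * M).+1 => if (a < 2 * M)%N then
   c * tau (cell a) * ((h (cell a) + h (cell a + 1)) / 2) else 0)); last first.
  by move=> a _; case: ifP => // _; rewrite mul0r.
rewrite (recr (fun k => c * tau k * ((h k + h (k + 1)) / 2))).
have up1 : \sum_(i < 2 * M) q (i%:Z - M%:Z) * h (i%:Z - M%:Z)
    <= \sum_(a < (2 * M).+1) q (cell a) * h (cell a).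
  by rewrite big_ord_recr/= lerDl mulr_ge0.
have up2 : \sum_(i < 2 * M) q (i%:Z - M%:Z + 1) * h (i%:Z - M%:Z + 1)
    <= \sum_(a < (2 * M).+1) q (cell a) * h (cell a).
  rewrite big_ord_recl/=; apply: ler_wpDl; first by rewrite mulr_ge0.
  rewrite le_eqVlt; apply/orP; left; apply/eqP; apply: eq_bigr => i _.
  by congr (q _ * h _); rewrite /cell /= /bump /=; lia.
apply: (@le_trans _ _ (\sum_(i < 2 * M) (q (i%:Z - M%:Z) * h (i%:Z - M%:Z)
    + q (i%:Z - M%:Z + 1) * h (i%:Z - M%:Z + 1)) / 2)); last first.
  by rewrite -mulr_suml big_split/=; lra.
apply: ler_sum => i _; set k := i%:Z - M%:Z.
have tq : tau k <= q k by rewrite ge_min lexx.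
have tq1 : tau k <= q (k + 1) by rewrite ge_min lexx orbT.
have ct : c * tau k <= tau k by rewrite ler_piMl.
have h1 : c * tau k * h k <= q k * h k by rewrite ler_wpM2r// (le_trans ct).
have h2 : c * tau k * h (k + 1) <= q (k + 1) * h (k + 1).
  by rewrite ler_wpM2r// (le_trans ct).
lra.
Qed.

End BernoulliPart.

(** * Moment functions and passage to the limit *)

Section MomentFunction.
Context {R : realType} (psi : R -> R).
Hypothesis psi_mom : moment_function psi.

Lemma moment_function_norm y : psi `|y| = psi y.
Proof.
have [_ _ even _ _] := psi_mom.
by have [y0|y0] := leP 0 y; [rewrite ger0_norm|rewrite ltr0_norm].
Qed.

(** For [y] beyond [s] the ratio [psi x / x ^ 2] only grows, and below [s] the
    ratio [x ^ 3 / psi x] does: the two regimes of [trunc_cube]. *)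
Lemma trunc_cube_le_moment s y : 0 < s -> trunc_cube (y / s) <= psi y / psi s.
Proof.
move=> s0; have [psi0 psi_gt0 even _ [sq cube]] := psi_mom.
rewrite -(moment_function_norm y) -trunc_cube_norm normrM [`|s^-1|]ger0_norm ?invr_ge0 ?(ltW s0)//.
have ps := psi_gt0 s s0.
have [->|yn0] := eqVneq y 0.
  rewrite normr0 mul0r (_ : trunc_cube 0 = 0); first exact: divr_ge0 (ltW ps).
  by rewrite /trunc_cube expr0n mul0r.
have : 0 < `|y| by rewrite normr_gt0.
move: `|y| => z z0; have pz := psi_gt0 z z0.
have zs0 : 0 <= z / s by rewrite divr_ge0// ltW.
rewrite /trunc_cube ger0_norm// ler_pdivlMr//.
have zin : z \in `]0, +oo[%R by rewrite in_itv/= z0.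
have sin : s \in `]0, +oo[%R by rewrite in_itv/= s0.
have [sz|/ltW zs] := leP s z.
  rewrite min_l ?ler_pdivlMr ?mul1r// mulr1.
  have := sq s z sin zin sz; rewrite ler_pdivrMr ?exprn_gt0// => h.
  apply: le_trans (ler_wpM2l (sqr_ge0 (z / s)) h) _.
  rewrite le_eqVlt; apply/orP; left; apply/eqP.
  by field; rewrite !lt0r_neq0.
rewrite min_r ?ler_pdivrMr ?mul1r// -exprSr exprMn exprVn mulrAC ler_pdivrMr ?exprn_gt0//.
have := cube z s zin sin zs.
by rewrite ler_pdivrMr// mulrAC ler_pdivlMr// [psi z * _]mulrC.
Qed.

(** On the positive half-line [psi] is nondecreasing, being [x ^ 2] times a
    nondecreasing function. *)
Lemma measurable_moment_function : measurable_fun setT psi.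
Proof.
have [psi0 psi_gt0 even conv [sq cube]] := psi_mom.
pose h (y : R) := if y <= 0 then 0 else psi y.
have h_nd : nondecreasing_fun h.
  move=> s z sz; rewrite /h; case: (leP s 0) => [s0|s0]; case: (leP z 0) => [z0|z0] //.
    by move: sz; rewrite leNgt (le_lt_trans z0 s0).
  have sin : s \in `]0, +oo[%R by rewrite in_itv/= s0.
  have zin : z \in `]0, +oo[%R by rewrite in_itv/= z0.
  have := sq s z sin zin sz; rewrite ler_pdivrMr ?exprn_gt0// => {}h.
  apply: le_trans h _; rewrite mulrAC ler_pdivrMr ?exprn_gt0//.
  by apply: ler_wpM2l => //; rewrite lerXn2r ?nnegrE ?(ltW s0) ?(ltW z0).
have -> : psi = (fun y => h `|y| + psi 0 * \1_[set 0 : R] y).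
  apply/funext => y; rewrite /h indicE normr_le0 moment_function_norm.
  have [->|y0] := eqVneq y 0; first by rewrite mem_set// mulr1 add0r.
  by rewrite memNset ?mulr0 ?addr0// => /eqP; rewrite (negbTE y0).
apply: measurable_funD.
  apply: (measurableT_comp (nondecreasing_measurable measurableT h_nd)).
  exact: normr_measurable.
by apply: measurable_funM => //; apply: measurable_indic; exact: measurable_set1.
Qed.

End MomentFunction.

Section GaussLimit.
Context {R : realType}.

Lemma cvg_gauss_pdf (v y : nat -> R) (v_ y_ : R) : 0 < v_ ->
  v @ \oo --> v_ -> y @ \oo --> y_ ->
  gauss_pdf (v M) (y M) @[M --> \oo] --> gauss_pdf v_ y_.
Proof.
move=> v0 cv cy; rewrite /gauss_pdf; apply: cvgM.
  apply: (cvg_comp _ expR); last exact: continuous_expR.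
  apply: cvgN; apply: cvgM.
    by rewrite expr2; under eq_fun do rewrite expr2; apply: cvgM.
  apply: cvgV; first by rewrite mulf_neq0// lt0r_neq0.
  by apply: cvgM => //; apply: cvg_cst.
apply: cvgV.
  by rewrite sqrtr_eq0 -ltNge !mulr_gt0// pi_gt0.
apply: (cvg_comp _ Num.sqrt); last exact: sqrt_continuous.
by apply: cvgM => //; apply: cvg_cst.
Qed.

End GaussLimit.

Section SumMoments.
Context {R : realType} {I A : finType} (p : I -> A -> R) (x : I -> A -> int).
Hypothesis p_sum1 : forall i, \sum_a p i a = 1.

Lemma sum_mean : \sum_i mean p x i = expect p (fun w => \sum_i (x i (w i))%:~R).
Proof.
rewrite expect_sum; apply: eq_bigr => i _.
by rewrite (expect_coord p_sum1 i (fun a => (x i a)%:~R)).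
Qed.

(** The form in which the total variance passes to the limit. *)
Lemma sum_variance : \sum_i variance p x i =
  expect p (fun w => (\sum_i (x i (w i))%:~R) ^+ 2)
  - expect p (fun w => \sum_i (x i (w i))%:~R) ^+ 2.
Proof.
have c0 i : expect1 p i (fun a => (x i a)%:~R - mean p x i) = 0.
  by rewrite expect1B expect1_cst// subrr.
rewrite -(@expect_sum_sqr _ _ _ _ p_sum1 xpredT _ c0) -sum_mean.
set M := \sum_i mean p x i.
rewrite (expect_ext (fun w => (\sum_i (x i (w i))%:~R) ^+ 2
   - 2 * M * (\sum_i (x i (w i))%:~R) + M ^+ 2)); last first.
  by move=> w; rewrite sumrB -/M; ring.
rewrite expectD expectB expect_cst// expectZl -sum_mean -/M; ring.
Qed.

End SumMoments.

Section LfunClosure.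
Context {d : measure_display} {T : measurableType d} {R : realType}
  (P : probability T R) {r : \bar R} (r1 : (1 <= r)%E).

Lemma Lfun_sub (f g : T -> R) :
  f \in Lfun P r -> g \in Lfun P r -> (f \- g)%R \in Lfun P r.
Proof.
by move=> hf hg; apply: (Lfun_addr_closed P r1).2 => //; apply: Lfun_oppr_closed.
Qed.

Lemma Lfun_sum (I : finType) (f : I -> T -> R) :
  (forall i, f i \in Lfun P r) -> (fun w => \sum_i f i w) \in Lfun P r.
Proof.
move=> hf; have -> : (fun w => \sum_i f i w) = \sum_i f i.
  by apply/funext => w; rewrite fct_sumE.
elim/big_ind : _ => //; first exact: (Lfun_addr_closed P r1).1.
exact: (Lfun_addr_closed P r1).2.
Qed.

End LfunClosure.

Section Rescaling.
Context {d : measure_display} {T : measurableType d} {R : realType}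
  (P : probability T R) {n : nat} (X : 'I_n -> {RV P >-> R}) (v0 D : R).
Hypothesis D_gt0 : 0 < D.
Hypothesis X_L2 : forall j, (X j : T -> R) \in Lfun P 2%:E.

Local Notation S := (rv_sum X).

Let one_le2 : (1 <= 2%:E :> \bar R)%E.
Proof. by rewrite lee_fin ler1n. Qed.

Definition lattice_coord j (w : T) : R := (X j w - v0) / D.

Lemma lattice_coord_L2 j : lattice_coord j \in Lfun P 2%:E.
Proof.
have -> : lattice_coord j = (D^-1 \o* ((X j : T -> R) \- cst v0))%R by [].
by apply: Lfun_scale; rewrite ?ler1n//; apply: Lfun_sub => //; exact: Lfun_cst.
Qed.

Lemma rv_sum_L2 : S \in Lfun P 2%:E.
Proof.
exact: (Lfun_sum one_le2 (f := fun j => X j)).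
Qed.

Definition coord_sum (w : T) : R := \sum_j lattice_coord j w.

Lemma coord_sumE : coord_sum = (D^-1 \o* (S \- cst (v0 * n%:R)))%R.
Proof.
apply/funext => w; rewrite /coord_sum /lattice_coord -mulr_suml sumrB; congr ((_ - _) * _).
by rewrite sumr_const card_ord mulr_natr.
Qed.

Lemma coord_sum_L2 : coord_sum \in Lfun P 2%:E.
Proof.
rewrite coord_sumE; apply: Lfun_scale; rewrite ?ler1n//.
by apply: Lfun_sub => //; [exact: rv_sum_L2|exact: Lfun_cst].
Qed.

Lemma L2_L1 (f : T -> R) : f \in Lfun P 2%:E -> f \in Lfun P 1.
Proof. by apply: Lfun_subset12; exact: fin_num_measure. Qed.

Lemma expectation_coord_sum :
  fine 'E_P[coord_sum] = (fine 'E_P[S] - v0 * n%:R) / D.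
Proof.
have S1 := L2_L1 rv_sum_L2.
rewrite coord_sumE expectationZl ?expectationB ?expectation_cst//; last 2 first.
- exact: Lfun_cst.
- by apply: Lfun_sub => //; exact: Lfun_cst.
by rewrite fineM ?fineB ?fin_numB ?expectation_fin_num//= mulrC.
Qed.

Lemma variance_coord_sum : fine 'V_P[coord_sum] = fine 'V_P[S] / D ^+ 2.
Proof.
have S2 := rv_sum_L2.
rewrite coord_sumE varianceZ; last by apply: Lfun_sub => //; exact: Lfun_cst.
by rewrite varianceB_cst_r// fineM ?variance_fin_num//= mulrC exprVn.
Qed.

Lemma variance_coord_sumE : fine 'V_P[coord_sum] =
  fine (\int[P]_w ((coord_sum w) ^+ 2)%:E)%E - fine (\int[P]_w (coord_sum w)%:E)%E ^+ 2.
Proof.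
have S2 := coord_sum_L2.
have E1 : ('E_P[coord_sum] = \int[P]_w (coord_sum w)%:E)%E by rewrite unlock.
have E2 : ('E_P[coord_sum ^+ 2] = \int[P]_w ((coord_sum w) ^+ 2)%:E)%E by rewrite unlock.
rewrite varianceE// -E1 -E2 fineB; last 2 first.
- apply: expectation_fin_num; rewrite expr2; exact: Lfun2_mul_Lfun1.
- by rewrite fin_numX// expectation_fin_num// L2_L1.
congr (_ - _); rewrite -[in LHS](fineK (expectation_fin_num (L2_L1 S2))).
by rewrite -EFin_expe.
Qed.

Let sqr_integrable j : P.-integrable setT (EFin \o (fun w => lattice_coord j w ^+ 2)).
Proof. exact: (Lfun2_integrable_sqr (lattice_coord_L2 j)). Qed.

Lemma dominating_integrable (a b : R) :
  P.-integrable setT (EFin \o (fun w => a + b * \sum_j lattice_coord j w ^+ 2)).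
Proof.
apply/Lfun1_integrable.
have -> : (fun w => a + b * \sum_j lattice_coord j w ^+ 2)
  = b \o* (fun w => \sum_j lattice_coord j w ^+ 2) \- cst (- a).
  by apply/funext => w /=; rewrite opprK mulrC addrC.
apply: Lfun_sub => //; last exact: Lfun_cst.
apply: Lfun_scale => //; apply: Lfun_sum => // j; apply/Lfun1_integrable.
exact: sqr_integrable.
Qed.

End Rescaling.

Lemma sqr_sum_le {R : realFieldType} (n : nat) (u : 'I_n -> R) :
  (\sum_i u i) ^+ 2 <= n%:R * \sum_i u i ^+ 2.
Proof.
have e1 : (\sum_i u i) ^+ 2 = \sum_i \sum_j u i * u j.
  by rewrite expr2 mulr_suml; apply: eq_bigr => i _; rewrite mulr_sumr.
have e2 : n%:R * (\sum_i u i ^+ 2) = \sum_i \sum_j (u i ^+ 2 + u j ^+ 2) / 2.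
  set q := \sum_i u i ^+ 2.
  rewrite (eq_bigr (fun i => (n%:R * u i ^+ 2 + q) / 2)) => [|i _]; last first.
    by rewrite -mulr_suml big_split/= sumr_const card_ord mulr_natl.
  rewrite -mulr_suml big_split/= -mulr_sumr sumr_const card_ord -/q -mulr_natl.
  by field.
rewrite e1 e2; apply: ler_sum => i _; apply: ler_sum => j _.
by have := sqr_ge0 (u i - u j); lra.
Qed.

Lemma measurable_trunc_cube {R : realType} : measurable_fun setT (@trunc_cube R).
Proof.
apply: measurable_funM; first exact: measurable_funX.
by apply: measurable_minr => //; exact: normr_measurable.
Qed.

Section Limits.
Context {d : measure_display} {T : measurableType d} {R : realType}
  (P : probability T R) {n : nat} (X : 'I_n -> {RV P >-> R}) (v0 D : R).
Hypothesis D_gt0 : 0 < D.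
Hypothesis X_indep : mutually_independent X.
Hypothesis X_lattice : forall j, P (X j @^-1` lattice v0 D) = 1%E.
Hypothesis X_L2 : forall j, (X j : T -> R) \in Lfun P 2%:E.

Local Notation Y := (lattice_coord X v0 D).
Local Notation law M := (@trunc_law _ _ _ _ _ X v0 D M).

Lemma measurable_lattice_coord j : measurable_fun setT (Y j).
Proof. by have := sub_Lfun_mfun (lattice_coord_L2 v0 D X_L2 j); rewrite inE. Qed.

Lemma measurable_coord_sum : measurable_fun setT (coord_sum X v0 D).
Proof. by have := sub_Lfun_mfun (coord_sum_L2 v0 D X_L2); rewrite inE. Qed.

Let cell_le M j w : `|(cell (cell_index v0 D M (X j w)))%:~R| <= `|Y j w|.
Proof. exact: cell_index_norm_le. Qed.

Let cell_sqr_le M j w : (cell (cell_index v0 D M (X j w)))%:~R ^+ 2 <= Y j w ^+ 2.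
Proof.
rewrite -[leLHS](real_normK (num_real _)) -[leRHS](real_normK (num_real _)).
by rewrite lerXn2r ?nnegrE.
Qed.

Lemma cvg_trunc_point (k : int) :
  expect (law M) (fun w => ((\sum_i cell (w i) == k)%R)%:R) @[M --> \oo]
    --> fine (P (rv_sum X @^-1` [set lattice_point (v0 * n%:R) D k])).
Proof.
have := @cvg_expect_trunc _ _ _ P _ X v0 D D_gt0 X_indep X_lattice
  (fun u => ((\sum_j u j == k%:~R)%R)%:R) (cst 1).
have eqS : (fun w => ((\sum_j (X j w - v0) / D == k%:~R)%R)%:R)
   = \1_(rv_sum X @^-1` [set lattice_point (v0 * n%:R) D k]) :> (T -> R).
  apply/funext => w; rewrite indicE; congr (nat_of_bool _)%:R.
  have -> : \sum_j (X j w - v0) / D = (rv_sum X w - v0 * n%:R) / D.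
    by have := congr1 (fun f => f w) (coord_sumE X v0 D).
  have D0 := lt0r_neq0 D_gt0.
  apply/eqP/idP => [h|]; last first.
    by rewrite inE /= /lattice_point => ->; field.
  rewrite inE /= /lattice_point -h; by field.
have mS : measurable (rv_sum X @^-1` [set lattice_point (v0 * n%:R) D k]).
  rewrite -[_ @^-1` _]setTI; apply: (_ : measurable_fun setT (rv_sum X)) => //.
  by have := sub_Lfun_mfun (rv_sum_L2 X_L2); rewrite inE.
rewrite eqS => /(_ (measurable_indic mS)) h.
have -> : P (rv_sum X @^-1` [set lattice_point (v0 * n%:R) D k]) =
   (\int[P]_w ((\sum_j (X j w - v0) / D == k%:~R)%R)%:R%:E)%E.
  have -> : (\int[P]_w ((\sum_j (X j w - v0) / D == k%:~R)%R)%:R%:E)%E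
    = (\int[P]_w (\1_(rv_sum X @^-1` [set lattice_point (v0 * n%:R) D k]) w)%:E)%E.
    by apply: eq_integral => w _; rewrite -eqS.
  by rewrite integral_indic// setIT.
have -> : (fun M => expect (law M) (fun w => ((\sum_i cell (w i) == k)%R)%:R)) =
  (fun M => expect (law M) (fun w => ((\sum_j (cell (w j))%:~R == k%:~R :> R)%R)%:R)).
  apply/funext => M; apply: expect_ext => w.
  by rewrite -(rmorph_sum (intmul 1)) eqr_int.
apply: h; first exact: finite_measure_integrable_cst.
by move=> M w; rewrite ger0_norm// lern1 leq_b1.
Qed.

Lemma cvg_trunc_mean : expect (law M) (fun w => \sum_i (cell (w i))%:~R) @[M --> \oo]
    --> fine (\int[P]_w (coord_sum X v0 D w)%:E)%E.
Proof.
apply: (@cvg_expect_trunc _ _ _ P _ X v0 D D_gt0 X_indep X_lattice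
  (fun u => \sum_j u j) (fun w => n%:R + 1 * \sum_j Y j w ^+ 2)).
- exact: measurable_coord_sum.
- exact: dominating_integrable.
move=> M w; rewrite mul1r (le_trans (ler_norm_sum _ _ _))//.
have -> : n%:R = \sum_(j < n) (1 : R) by rewrite sumr_const card_ord.
rewrite -big_split/=; apply: ler_sum => j _; apply: (le_trans (cell_le M j w)).
by rewrite -(real_normK (num_real (Y j w))); have := sqr_ge0 (`|Y j w| - 2^-1); lra.
Qed.

Lemma cvg_trunc_sqr : expect (law M) (fun w => (\sum_i (cell (w i))%:~R) ^+ 2) @[M --> \oo]
    --> fine (\int[P]_w (coord_sum X v0 D w ^+ 2)%:E)%E.
Proof.
apply: (@cvg_expect_trunc _ _ _ P _ X v0 D D_gt0 X_indep X_lattice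
  (fun u => (\sum_j u j) ^+ 2) (fun w => 0 + n%:R * \sum_j Y j w ^+ 2)).
- by apply: measurable_funX; exact: measurable_coord_sum.
- exact: dominating_integrable.
move=> M w; rewrite add0r ger0_norm ?sqr_ge0// (le_trans (sqr_sum_le _))//.
by rewrite ler_wpM2l//; apply: ler_sum => j _; apply: cell_sqr_le.
Qed.

Lemma cvg_trunc_moment (c s : R) : 0 < s ->
  \sum_j expect1 (law M) j (fun a => trunc_cube (((cell a)%:~R - c) / s)) @[M --> \oo]
    --> \sum_j fine (\int[P]_w (trunc_cube ((Y j w - c) / s))%:E)%E.
Proof.
move=> s0; apply: cvg_big => [|j _]; first exact: add_continuous.
under eq_fun => M do rewrite -(expect_coord (@trunc_law_sum1 _ _ _ P _ X v0 D M) j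
  (fun a => trunc_cube (((cell a)%:~R - c) / s))).
pose b := 2 * (s^-1) ^+ 2.
apply: (@cvg_expect_trunc _ _ _ P _ X v0 D D_gt0 X_indep X_lattice
  (fun u => trunc_cube ((u j - c) / s)) (fun w => b * c ^+ 2 + b * \sum_j Y j w ^+ 2)).
- apply: measurableT_comp; first exact: measurable_trunc_cube.
  apply: measurable_funM => //; apply: measurable_funB => //.
  exact: measurable_lattice_coord.
- exact: dominating_integrable.
move=> M w; rewrite ger0_norm ?trunc_cube_ge0// (le_trans (trunc_cube_le_sqr _))//.
have : Y j w ^+ 2 <= \sum_j Y j w ^+ 2.
  by rewrite (bigD1 j)//= lerDl sumr_ge0// => i _; apply: sqr_ge0.
have := cell_sqr_le M j w; set u := _%:~R => uY YS.
have i0 : 0 <= (s^-1) ^+ 2 by exact: sqr_ge0.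
move: YS; set q := \sum_j _ => YS.
have -> : b * c ^+ 2 + b * q = (s^-1) ^+ 2 * (2 * (c ^+ 2 + q)) by rewrite /b; ring.
rewrite exprMn [leLHS]mulrC; apply: ler_wpM2l => //.
have := sqr_ge0 (u + c); lra.
Qed.

End Limits.

Section LimitTheorem.
Context {d : measure_display} {T : measurableType d} {R : realType}
  (P : probability T R) {n : nat} (X : 'I_n -> {RV P >-> R}) (v0 D : R).
Hypothesis D_gt0 : 0 < D.
Hypothesis X_indep : mutually_independent X.
Hypothesis X_lattice : forall j, P (X j @^-1` lattice v0 D) = 1%E.
Hypothesis X_L2 : forall j, (X j : T -> R) \in Lfun P 2%:E.
Variable theta : 'I_n -> R.
Hypothesis theta_gt0 : forall j, 0 < theta j.
Hypothesis theta_le : forall j, ((theta j)%:E <= vartheta v0 D (X j))%E.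

Local Notation law M := (@trunc_law _ _ _ _ _ X v0 D M).
Local Notation point M := (fun (_ : 'I_n) (a : 'I_(2 * M).+1) => cell a).
Local Notation Z := (coord_sum X v0 D).
Local Notation Theta := (\sum_j theta j).

Let law_ge0 M j a : 0 <= law M j a. Proof. exact: trunc_law_ge0. Qed.
Let law_sum1 M j : \sum_a law M j a = 1. Proof. exact: trunc_law_sum1. Qed.

Let near_bernoulli : \forall M \near \oo,
  forall j, has_bernoulli_part (law M j) (@cell M) (theta j / 2).
Proof. by apply: filter_forall => j; apply: trunc_bernoulli_part. Qed.

Let EZ := fine 'E_P[Z].
Let VZ := fine 'V_P[Z].

Let cvg_mean : \sum_j mean (law M) (point M) j @[M --> \oo] --> EZ.
Proof.
have EZE : EZ = fine (\int[P]_w (Z w)%:E)%E by rewrite /EZ unlock.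
rewrite EZE; have h := cvg_trunc_mean D_gt0 X_indep X_lattice X_L2.
have e M : \sum_j mean (law M) (point M) j = expect (law M) (fun w => \sum_i (cell (w i))%:~R).
  exact: sum_mean.
by rewrite (eq_cvg _ _ e).
Qed.

Let cvg_variance : \sum_j variance (law M) (point M) j @[M --> \oo] --> VZ.
Proof.
have c1 := cvg_trunc_mean D_gt0 X_indep X_lattice X_L2.
have c2 := cvg_trunc_sqr D_gt0 X_indep X_lattice X_L2.
rewrite /VZ variance_coord_sumE//.
have e M : \sum_j variance (law M) (point M) j =
    expect (law M) (fun w => (\sum_i (cell (w i))%:~R) ^+ 2)
    - expect (law M) (fun w => \sum_i (cell (w i))%:~R) ^+ 2 by exact: sum_variance.
rewrite (eq_cvg _ _ e); apply: (cvgB c2).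
exact: (cvgM c1 c1).
Qed.

Lemma variance_coord_sum_ge : Theta / 8 <= VZ.
Proof.
apply: (ler_cvg_to (@cvg_cst _ (Theta / 8) _ _ _) cvg_variance).
near=> M; have part : forall j, has_bernoulli_part (law M j) (@cell M) (theta j / 2).
  by near: M.
rewrite mulr_suml; apply: ler_sum => j _.
have := @theta_le_variance _ _ _ (law M) (point M) _ part j.
lra.
Unshelve. all: by end_near. Qed.

(** The finite estimate with [theta / 2], which the truncated laws satisfy from
    some [M] on, let [M] tend to infinity. The standard deviation inside
    [trunc_cube] depends on [M]; it is at least half of its limit, which costs
    the factor [8]. *)
Lemma coord_sum_llt k0 : 0 < Theta ->
  `|fine (P (rv_sum X @^-1` [set lattice_point (v0 * n%:R) D k0]))
     - gauss_pdf VZ (k0%:~R - EZ)|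
  <= 6000 * (576 * (\sum_j fine (\int[P]_w
         (trunc_cube ((lattice_coord X v0 D j w + v0 / D) / Num.sqrt VZ))%:E)%E)
       / Num.sqrt (Theta / 2) + (Num.sqrt (Theta / 2) ^+ 3)^-1).
Proof.
move=> Th0; have V0 : 0 < VZ by have := variance_coord_sum_ge; lra.
set s := Num.sqrt VZ; have s0 : 0 < s by rewrite sqrtr_gt0.
have cP := @cvg_trunc_point _ _ _ P _ X v0 D D_gt0 X_indep X_lattice X_L2 k0.
have cm := @cvg_trunc_moment _ _ _ P _ X v0 D D_gt0 X_indep X_lattice X_L2 (- (v0 / D)) s s0.
have cG : gauss_pdf (\sum_j variance (law M) (point M) j)
    (k0%:~R - \sum_j mean (law M) (point M) j) @[M --> \oo]
    --> gauss_pdf VZ (k0%:~R - EZ).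
  by apply: cvg_gauss_pdf => //; apply: cvgB => //; apply: cvg_cst.
have cL : `|expect (law M) (fun w => ((\sum_i cell (w i) == k0)%R)%:R)
    - gauss_pdf (\sum_j variance (law M) (point M) j)
        (k0%:~R - \sum_j mean (law M) (point M) j)| @[M --> \oo]
    --> `|fine (P (rv_sum X @^-1` [set lattice_point (v0 * n%:R) D k0]))
          - gauss_pdf VZ (k0%:~R - EZ)|.
  by apply: cvg_norm; apply: cvgB.
set r := Num.sqrt (Theta / 2).
have cR : 6000 * (576 * (\sum_j expect1 (law M) j
      (fun a => trunc_cube (((cell a)%:~R + v0 / D) / s))) / r + (r ^+ 3)^-1) @[M --> \oo]
    --> 6000 * (576 * (\sum_j fine (\int[P]_w
         (trunc_cube ((lattice_coord X v0 D j w + v0 / D) / s))%:E)%E) / r + (r ^+ 3)^-1).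
  apply: cvgM; first exact: cvg_cst.
  apply: cvgD; last exact: cvg_cst.
  apply: cvgM; last exact: cvg_cst.
  apply: cvgM; first exact: cvg_cst.
  by move: cm; rewrite opprK.
apply: (ler_cvg_to cL cR).
near=> M; have part : forall j, has_bernoulli_part (law M j) (@cell M) (theta j / 2).
  by near: M.
have := @lattice_llt _ _ _ (law M) (point M) (@law_ge0 M) (@law_sum1 M) _ part k0.
rewrite -mulr_suml divr_gt0// => /(_ isT) h; apply: le_trans h _.
set V := \sum_j variance _ _ _.
have VM : VZ / 4 <= V.
  rewrite /V ltW//; near: M; move/cvgr_gt : cvg_variance; apply; lra.
have sV : s <= 2 * Num.sqrt V.
  have -> : 2 = Num.sqrt (2 ^+ 2) :> R by rewrite sqrtr_sqr ger0_norm.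
  by rewrite -sqrtrM ?sqr_ge0// ler_wsqrtr//; lra.
have V_0 : 0 < Num.sqrt V by rewrite sqrtr_gt0; lra.
have r0 : 0 < r by rewrite sqrtr_gt0 divr_gt0.
apply: ler_wpM2l; first exact: ler0n.
rewrite lerD2r ler_pM2r ?invr_gt0; last exact: r0.
rewrite mulr_sumr; apply: ler_sum => j _.
apply: le_trans (scaled_moment_recenter (point M) (@law_ge0 M) (@law_sum1 M) j _ (- (v0 / D))) _.
(* Centring at another point costs 72, doubling the argument costs 8. *)
have -> : 576 = 72 * 8 :> R by ring.
rewrite -[leRHS]mulrA; apply: ler_wpM2l; first exact: ler0n.
rewrite -expect1Zl; apply: ler_expect1 => // a.
rewrite opprK; set y := _ + _.
apply: (@le_trans _ _ (trunc_cube (2 * (y / s)))).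
  apply: le_trunc_cube; rewrite mulrCA !normrM ler_wpM2l//.
  rewrite !ger0_norm ?divr_ge0 ?invr_ge0 ?(ltW s0) ?(ltW V_0)//.
  by rewrite ler_pdivlMr// mulrC ler_pdivrMr.
by apply: le_trans (trunc_cubeZ _ _) _; [lra|rewrite ler_wpM2r ?trunc_cube_ge0//; lra].
Unshelve. all: by end_near. Qed.

End LimitTheorem.

(** * The theorem *)

Lemma gauss_pdf_rescale {R : realType} (D v y : R) : 0 < D -> 0 < v ->
  gauss_pdf (v / D ^+ 2) (y / D) = D * expR (- (y ^+ 2 / (2 * v))) / Num.sqrt (2 * pi * v).
Proof.
move=> D0 v0; rewrite /gauss_pdf.
have -> : (y / D) ^+ 2 / (2 * (v / D ^+ 2)) = y ^+ 2 / (2 * v).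
  by field; rewrite !lt0r_neq0.
have -> : 2 * pi * (v / D ^+ 2) = 2 * pi * v * (D^-1) ^+ 2 by rewrite exprVn mulrA.
rewrite (sqrtrM _ (_ : 0 <= 2 * pi * v)); last by rewrite !mulr_ge0 ?pi_ge0// ltW.
rewrite sqrtr_sqr ger0_norm ?invr_ge0 ?(ltW D0)//; set e := expR _.
by rewrite invfM invrK; ring.
Qed.

Lemma integral_trunc_cube_le {d : measure_display} {T : measurableType d} {R : realType}
    (P : probability T R) (psi : R -> R) (X : {RV P >-> R}) (s : R) :
  moment_function psi -> 0 < s -> ('E_P[psi \o X] < +oo)%E ->
  fine (\int[P]_w (trunc_cube (X w / s))%:E)%E <= fine 'E_P[psi \o X] / psi s.
Proof.
move=> mpsi s0; have [psi0 psi_gt0 _ _ _] := mpsi; have ps := psi_gt0 s s0.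
have EE : ('E_P[psi \o X] = \int[P]_w (psi (X w))%:E)%E by rewrite unlock.
have mpX : measurable_fun setT (fun w => (psi (X w))%:E).
  apply/measurable_EFinP; apply: measurableT_comp => //.
  exact: measurable_moment_function.
have mtX : measurable_fun setT (fun w => (trunc_cube (X w / s))%:E).
  apply/measurable_EFinP; apply: measurableT_comp; first exact: measurable_trunc_cube.
  exact: measurable_funM.
have le_int : (\int[P]_w (trunc_cube (X w / s))%:E
    <= ((psi s)^-1)%:E * \int[P]_w (psi (X w))%:E)%E.
  rewrite -ge0_integralZl//.
  - apply: ge0_le_integral => //.
    + by move=> w _; rewrite lee_fin trunc_cube_ge0.
    + exact: measurable_funeM.
    + move=> w _; rewrite -EFinM lee_fin [leRHS]mulrC.
      exact: trunc_cube_le_moment.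
  - by move=> w _; rewrite lee_fin.
  - by rewrite lee_fin invr_ge0 ltW.
have I0 : (0 <= \int[P]_w (psi (X w))%:E)%E.
  by apply: integral_ge0 => w _; rewrite lee_fin.
rewrite EE => Ifin; have If : (\int[P]_w (psi (X w))%:E)%E \is a fin_num.
  by rewrite ge0_fin_numE.
have T0 : (0 <= \int[P]_w (trunc_cube (X w / s))%:E)%E.
  by apply: integral_ge0 => w _; rewrite lee_fin trunc_cube_ge0.
have rhs_fin : (((psi s)^-1)%:E * \int[P]_w (psi (X w))%:E)%E \is a fin_num.
  by rewrite fin_numM.
have := fine_le _ rhs_fin le_int; rewrite ge0_fin_numE// => /(_ _) h.
rewrite mulrC; apply: le_trans (h _) _; first by rewrite (le_lt_trans le_int)// ltey_eq rhs_fin.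
by rewrite fineM.
Qed.

Theorem corollary1p10 (R : realType) :
  exists C_E : R,
  forall C0 : R, binomial_llt_constant C0 ->
  let C1 := Num.max 4 C0 in
  let C2 := 12 * (C1 + 1) in
  let C3 := Num.max C2 (2 `^ (3 / 2) * C_E) in
  forall psi : R -> R, moment_function psi ->
  forall (v0 D : R), 0 < D ->
  forall (d : measure_display) (T : measurableType d) (P : probability T R)
    (n : nat), (1 <= n)%N ->
  forall (X : 'I_n -> {RV P >-> R}) (theta : 'I_n -> R),
  mutually_independent X ->
  (forall j, (X j : T -> R) \in Lfun P 2%:E) ->
  (forall j, P (X j @^-1` lattice v0 D) = 1%E) ->
  (forall j, (0 < vartheta v0 D (X j))%E) ->
  (forall j, ('E_P[psi \o X j] < +oo)%E) ->
  (forall j, 0 < theta j /\ ((theta j)%:E <= vartheta v0 D (X j))%E) ->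
  let S := rv_sum X in
  let ES := fine 'E_P[S] in
  let VarS := fine 'V_P[S] in
  let Theta := \sum_(j < n) theta j in
  let L := Lratio psi X in
  1 < Theta ->
  ln Theta / Theta <= 14^-1 ->
  forall kappa : R, lattice (v0 * n%:R) D kappa ->
  (kappa - ES) ^+ 2 / VarS <= Num.sqrt (7 * ln Theta / (2 * Theta)) ->
  `| fine (P (S @^-1` [set kappa]))
     - D * expR (- ((kappa - ES) ^+ 2 / (2 * VarS)))
       / Num.sqrt (2 * pi * VarS) |
  <= C3 * (D * Num.sqrt (ln Theta / (VarS * Theta))
           + (L + Theta^-1) / Num.sqrt Theta).
Proof.
(* The factor 1000 covers [576 * 3 / 2] and [4], the losses in passing from
   [Theta / 2] back to [Theta]. *)
exists (6000 * 1000) => C0 _ C1 C2 C3 psi mpsi v0 D D0 d T P n _ X theta indep L2 latt _ Epsi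
  th S ES VarS Theta L Th1 _ kappa [k0 _ <-] _.
have Th0 : 0 < Theta by lra.
have th0 j : 0 < theta j by case: (th j).
have thle j : ((theta j)%:E <= vartheta v0 D (X j))%E by case: (th j).
have := coord_sum_llt D0 indep latt L2 th0 thle k0 Th0.
have VZ_ge := variance_coord_sum_ge D0 indep latt L2 th0 thle.
move: VZ_ge; rewrite variance_coord_sum// expectation_coord_sum// -/VarS -/ES -/Theta.
move=> VZ_ge.
have D2 : 0 < D ^+ 2 by rewrite exprn_gt0.
have V0 : 0 < VarS.
  have : 0 < VarS / D ^+ 2 by apply: lt_le_trans VZ_ge; rewrite divr_gt0.
  by rewrite pmulr_lgt0 ?invr_gt0.
have kE : k0%:~R - (ES - v0 * n%:R) / D = (lattice_point (v0 * n%:R) D k0 - ES) / D.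
  by rewrite /lattice_point; field; rewrite lt0r_neq0.
rewrite kE gauss_pdf_rescale//.
set lhs := `|_|; set t := \sum_j fine _ => main.
have t_le : t <= L.
  rewrite /t /L /Lratio mulr_suml; apply: ler_sum => j _.
  have s0 : 0 < Num.sqrt VarS by rewrite sqrtr_gt0.
  apply: le_trans _ (integral_trunc_cube_le mpsi s0 (Epsi j)).
  rewrite le_eqVlt; apply/orP; left; apply/eqP; congr fine.
  apply: eq_integral => w _; congr (trunc_cube _)%:E.
  rewrite /lattice_coord -mulrDl subrK sqrtrM ?(ltW V0)// -exprVn sqrtr_sqr.
  rewrite ger0_norm ?invr_ge0 ?(ltW D0)//.
  by field; rewrite !lt0r_neq0 ?sqrtr_gt0.
have t0 : 0 <= t.
  apply: sumr_ge0 => j _; apply: fine_ge0; apply: integral_ge0 => w _.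
  by rewrite lee_fin trunc_cube_ge0.
set q := Num.sqrt Theta; have q0 : 0 < q by rewrite sqrtr_gt0.
have qq : q ^+ 2 = Theta by rewrite sqr_sqrtr// ltW.
set r := Num.sqrt (Theta / 2) in main.
have r0 : 0 < r by rewrite sqrtr_gt0 divr_gt0.
have rr : r ^+ 2 = Theta / 2 by rewrite sqr_sqrtr// ltW// divr_gt0.
have qr : q <= 3 / 2 * r by nra.
have ir : r^-1 <= 3 / 2 * q^-1.
  by rewrite ler_pdivlMr// mulrC ler_pdivrMr.
have iq0 : 0 < q^-1 by rewrite invr_gt0.
have ir0 : 0 < r^-1 by rewrite invr_gt0.
have ir3 : (r ^+ 3)^-1 <= 4 * (Theta^-1 / q).
  have -> : (r ^+ 3)^-1 = 2 * Theta^-1 * r^-1.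
    rewrite exprSr rr; field; rewrite !lt0r_neq0//.
  have : Theta^-1 * r^-1 <= Theta^-1 * (3 / 2 * q^-1).
    by rewrite ler_wpM2l// invr_ge0 ltW.
  have : 0 <= Theta^-1 / q by rewrite mulr_ge0 ?invr_ge0 ?ltW.
  lra.
have CE0 : 0 <= 6000 * 1000 :> R by rewrite mulr_ge0 ?ler0n.
have C3_ge : 6000 * 1000 <= C3.
  rewrite /C3 le_max; apply/orP; right.
  have p1 : 1 <= 2 `^ (3 / 2) :> R.
    rewrite -[leLHS](powRr0 2); apply: ler_powR; first by rewrite ler1n.
    by rewrite divr_ge0.
  exact: ler_peMl.
have C30 : 0 <= C3 by apply: le_trans C3_ge.
have lnT : 0 <= ln Theta by rewrite ln_ge0// ltW.
have extra : 0 <= D * Num.sqrt (ln Theta / (VarS * Theta)).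
  by rewrite mulr_ge0 ?sqrtr_ge0 ?(ltW D0).
have LT0 : 0 <= (L + Theta^-1) / q.
  by rewrite divr_ge0 ?(ltW q0)// addr_ge0 ?invr_ge0 ?(ltW Th0)// (le_trans t0).
apply: (@le_trans _ _ (6000 * 1000 * ((L + Theta^-1) / q))); last first.
  apply: le_trans (ler_wpM2r LT0 C3_ge) _.
  by apply: ler_wpM2l => //; rewrite lerDr.
apply: le_trans main _.
have tr : t / r <= 3 / 2 * (L / q).
  have : t / r <= L * (3 / 2 * q^-1) by rewrite ler_pM ?(ltW ir0).
  lra.
have Lq0 : 0 <= L / q by rewrite divr_ge0 ?(ltW q0)// (le_trans t0).
have Tq0 : 0 <= Theta^-1 / q by rewrite divr_ge0 ?(ltW q0)// invr_ge0 ltW.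
rewrite -[leRHS]mulrA; apply: ler_wpM2l; first exact: ler0n.
rewrite -[576 * t / r]mulrA [(L + _) / q]mulrDl.
move: tr ir3 Lq0 Tq0.
move: (t / r) (L / q) (Theta^-1 / q) (r ^+ 3)^-1 => a b c e.
lra.
Qed.
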